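(* Let $Y\in\mathscr{M}_{SG}(\mathbb{R}^d\times\mathbb{R}^+)$. Let $g:\mathbb{R}^d\to\mathbb{C}$ be a continuous (spatial) symbol function with real part $g_R\ge0$. Let $V_0\in\mathscr{M}_{SG}(\mathbb{R}^d)$. Then there exists a unique measure $V\in\mathscr{M}(\mathbb{R}^d\times\mathbb{R})$ such that: (1) $\frac{\partial V}{\partial t}+gV=Y$ in the sense of $\mathscr{D}'(\mathbb{R}^d\times\mathbb{R})$; (2) its restriction to $\mathbb{R}^d\times\mathbb{R}^+$, namely $\mathbf{1}_{\mathbb{R}^d\times\mathbb{R}^+}V$, is in $\mathscr{M}_{SG}(\mathbb{R}^d\times\mathbb{R}^+)$ and has a càdlàg-in-time representation whose evaluation at $t=0$ is $V_0$.
   Context: Here $d\ge1$, $\mathbb{R}^+=[0,\infty)$, $\mathbb{N}=\{0,1,2,\dots\}$; points of $\mathbb{R}^d\times\mathbb{R}$ are written $(\xi,t)$. A symbol function is a measurable, polynomially bounded function $g:\mathbb{R}^d\to\mathbb{C}$ that is Hermitian (real part $g_R$ even, imaginary part odd). For $n\ge1$, $\mathscr{M}(\mathbb{R}^n)$ is the space of complex Radon measures, i.e. $\sigma$-additive functions from bounded Borel subsets of $\mathbb{R}^n$ to $\mathbb{C}$, with total variation $|\mu|$; $\mathscr{M}_{SG}(\mathbb{R}^n)$ is the space of slow-growing ones, i.e. those with $\int(1+|x|^2)^{-N}d|\mu|(x)<\infty$ for some $N\in\mathbb{N}$. $\mathscr{M}_{SG}(\mathbb{R}^d\times\mathbb{R}^+)$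 is the set of $\mu\in\mathscr{M}_{SG}(\mathbb{R}^d\times\mathbb{R})$ with support in $\mathbb{R}^d\times\mathbb{R}^+$. For measurable locally bounded $f$, $f\mu$ is the measure $A\mapsto\int_Af\,d\mu$ (so $gV$ is $V$ multiplied by $(\xi,t)\mapsto g(\xi)$, and $\mathbf{1}_A\mu$ is the restriction of $\mu$ to $A$). $C_{FD}(\mathbb{R}^n)$ is the space of continuous $\varphi:\mathbb{R}^n\to\mathbb{C}$ with $\sup_x|(1+|x|^2)^N\varphi(x)|<\infty$ for all $N\in\mathbb{N}$. With $(\varphi\boxtimes\theta)(\xi,t)=\varphi(\xi)\theta(t)$, a measure $T\in\mathscr{M}_{SG}(\mathbb{R}^d\times\mathbb{R})$ has a càdlàg-in-time representation $(T_t)_{t\in\mathbb{R}}\subset\mathscr{M}_{SG}(\mathbb{R}^d)$ if for all $\varphi\in C_{FD}(\mathbb{R}^d)$ the function $t\mapsto\langle T_t,\varphi\rangle=\int\varphi\,dT_t$ is càdlàg (right-continuous with left limits) and defines (as a density) a slow-growing measure over $\mathbb{R}$, and $\langle T,\varphi\boxtimes\theta\rangle=\int_{\mathbb{R}}\langle T_t,\varphi\rangle\theta(t)dt$ for all $\varphi\in C_{FD}(\mathbb{R}^d)$, $\theta\in C_{FD}(\mathbb{R})$. Such a representation is unique when it exists; its evaluation at $t=0$ is $T_0$. *)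

(* Defs.v *)
From HB Require Import structures.
From mathcomp Require Import all_boot all_order all_algebra.
From mathcomp Require Import all_classical all_reals all_analysis.
From mathcomp Require Export complex.

Set Implicit Arguments.
Unset Strict Implicit.
Unset Printing Implicit Defensive.

Import Order.TTheory GRing.Theory Num.Theory.
Import numFieldNormedType.Exports.

Local Open Scope classical_set_scope.
Local Open Scope ring_scope.
Local Open Scope complex_scope.

Local Notation normc := ComplexField.Normc.normc.

(* The general notions below are stated on a normed space E, which is one of
   R^d, R and R^d * R. The library norms on these spaces are max norms; they
   are only used for the topology and for bounded sets. The Euclidean quantity
   |x|^2 is the explicit parameter [sq : E -> R]. *)

Definition sq_space (R : realType) (d : nat) (x : 'rV[R]_d) : R :=
  \sum_(i < d) x ord0 i ^+ 2.

Definition sq_time (R : realType) (t : R^o) : R := t ^+ 2.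

Definition sq_spacetime (R : realType) (d : nat) (z : 'rV[R]_d * R^o) : R :=
  sq_space z.1 + sq_time z.2.

Definition borel (E : ptopologicalType) := g_sigma_algebraType (@open E).

Section complex_radon_measures.
Variables (R : realType) (E : normedModType R).
Implicit Types (A B : set E) (mu : set E -> R[i]) (nu : set E -> R).

Definition bounded_borel A := bounded_set A /\ measurable (A : set (borel E)).

(* A set function defined on bounded Borel sets only is encoded as a total
   function with value 0 on all other sets, so that equality of measures is
   equality on bounded Borel sets. *)
Definition radon mu : Prop :=
  (forall A, ~ bounded_borel A -> mu A = 0) /\
  (forall A : nat -> set E, (forall n, bounded_borel (A n)) ->
     trivIset setT A -> bounded_borel (\bigcup_n A n) ->
     (\sum_(0 <= k < n) (mu (A k) : R[i]^o)) @[n --> \oo]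
       --> (mu (\bigcup_n A n) : R[i]^o)).

(* Every Borel set, bounded or not, has countable partitions into bounded
   Borel sets. *)
Definition radon_variation mu A : \bar R :=
  ereal_sup [set x | exists B : nat -> set E,
    [/\ forall n, bounded_borel (B n), trivIset setT B,
        \bigcup_n B n = A &
        x = (\sum_(0 <= n <oo) (normc (mu (B n)))%:E)%E]].

(* Jordan decomposition of a real Radon measure:
   nu^+(A) = sup {nu B : B in A} and nu^- = (- nu)^+ . *)
Definition positive_variation nu A : \bar R :=
  ereal_sup [set (nu B)%:E | B in [set B | bounded_borel B /\ B `<=` A]].

Definition integral_real nu A (f : E -> R) : R :=
  let pos : set (borel E) -> \bar R := positive_variation nu in
  let neg : set (borel E) -> \bar R := positive_variation (fun B => - nu B) in
  fine (\int[pos]_(x in A) (f x)%:E)%E - fine (\int[neg]_(x in A) (f x)%:E)%E.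

Definition integral_radon mu A (f : E -> R[i]) : R[i] :=
  let muR := fun B => complex.Re (mu B) in
  let muI := fun B => complex.Im (mu B) in
  let fR := fun x => complex.Re (f x) in
  let fI := fun x => complex.Im (f x) in
  (integral_real muR A fR - integral_real muI A fI) +i*
  (integral_real muR A fI + integral_real muI A fR).

Definition pairing mu (f : E -> R[i]) : R[i] := integral_radon mu setT f.

Definition radon_density (f : E -> R[i]) mu : set E -> R[i] :=
  fun A => if `[< bounded_borel A >] then integral_radon mu A f else 0.

Definition radon_support mu : set E :=
  [set x | forall U : set E, open U -> U x -> radon_variation mu U != 0%E].

Definition slow_growing (sq : E -> R) : set (set E -> R[i]) :=
  [set mu | radon mu /\
    let var : set (borel E) -> \bar R := radon_variation mu in
    exists N : nat, (\int[var]_x ((1 + sq x) ^- N)%:E < +oo)%E].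

Definition fast_decreasing (sq : E -> R) : set (E -> R[i]) :=
  [set phi | continuous (phi : E -> R[i]^o) /\
    forall N : nat, exists M : R, forall x,
      (1 + sq x) ^+ N * normc (phi x) <= M].

Fixpoint Ck (k : nat) (f : E -> R^o) : Prop :=
  continuous f /\
  if k is k'.+1
  then forall v, (forall x, derivable f x v) /\ Ck k' ('D_v f)
  else True.

Definition smooth (f : E -> R^o) : Prop := forall k, Ck k f.

Definition test_function (phi : E -> R[i]) : Prop :=
  [/\ smooth (fun x => complex.Re (phi x)), smooth (fun x => complex.Im (phi x)) &
      compact (closure [set x | phi x != 0])].

Definition derive_complex (v : E) (phi : E -> R[i]) : E -> R[i] :=
  fun x => ('D_v (fun y => complex.Re (phi y) : R^o) x) +i*
           ('D_v (fun y => complex.Im (phi y) : R^o) x).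

(* Distributions are represented by their action on test functions. *)
Definition derive_distribution (v : E) (S : (E -> R[i]) -> R[i]) :=
  fun phi : E -> R[i] => - S (derive_complex v phi).

Definition distribution_eq (S1 S2 : (E -> R[i]) -> R[i]) : Prop :=
  forall phi, test_function phi -> S1 phi = S2 phi.

End complex_radon_measures.

Section time_dependent.
Variables (R : realType) (d : nat).
Local Notation space := 'rV[R]_d.
Local Notation spacetime := ('rV[R]_d * R^o)%type.

Definition lebesgue_integral_complex (A : set R) (h : R -> R[i]) : R[i] :=
  (\int[lebesgue_measure]_(t in A) complex.Re (h t)) +i*
  (\int[lebesgue_measure]_(t in A) complex.Im (h t)).

Definition lebesgue_density (h : R -> R[i]) : set R^o -> R[i] :=
  fun A => if `[< bounded_borel A >] then lebesgue_integral_complex A h else 0.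

Definition cadlag (h : R -> R[i]^o) : Prop :=
  forall t : R, h s @[s --> t^'+] --> h t /\ cvg (h s @[s --> t^'-]).

Definition boxtimes (phi : space -> R[i]) (theta : R -> R[i])
  : spacetime -> R[i] := fun z => phi z.1 * theta z.2.

Definition cadlag_representation (T : set spacetime -> R[i])
    (Tt : R -> set space -> R[i]) : Prop :=
  slow_growing (@sq_spacetime R d) T /\
  (forall t, slow_growing (@sq_space R d) (Tt t)) /\
  (forall phi, fast_decreasing (@sq_space R d) phi ->
     let h := fun t => pairing (Tt t) phi in
     [/\ cadlag h, slow_growing (@sq_time R) (lebesgue_density h) &
         forall theta, fast_decreasing (@sq_time R) theta ->
           pairing T (boxtimes phi theta) =
           lebesgue_integral_complex setT (fun t => h t * theta t)]).

Definition halfspace : set spacetime := [set z | 0 <= z.2].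

Definition slow_growing_halfspace : set (set spacetime -> R[i]) :=
  [set mu | slow_growing (@sq_spacetime R d) mu /\ radon_support mu `<=` halfspace].

Definition symbol_function (g : space -> R[i]) : Prop :=
  [/\ measurable_fun setT (g : borel space -> borel R[i]^o),
      exists (M : R) (N : nat), forall xi,
        normc (g xi) <= M * (1 + sq_space xi) ^+ N,
      forall xi, complex.Re (g (- xi)) = complex.Re (g xi) &
      forall xi, complex.Im (g (- xi)) = - complex.Im (g xi)].

Definition indicator_halfspace : spacetime -> R[i] :=
  fun z => (\1_halfspace z : R)%:C.

Definition time_direction : spacetime := (0, 1).

(* dV/dt + g V = Y in the sense of distributions. *)
Definition evolution_equation (g : space -> R[i])
    (V Y : set spacetime -> R[i]) : Prop :=
  distribution_eq
    (fun phi => derive_distribution time_direction (pairing V) phi +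
                pairing (radon_density (fun z => g z.1) V) phi)
    (pairing Y).

End time_dependent.

(* Main.v *)
Require Import Defs.
From HB Require Import structures.
From mathcomp Require Import all_boot all_order all_algebra.
From mathcomp Require Import all_classical all_reals all_analysis.
From mathcomp Require Import measurable_realfun ring lra.

(* Write [Y = f_Y lam] and [V0 = f_0 lam] as images of one measure [lam] with bounded densities.
   Duhamel's formula then gives a solution: the mass of [Y] at [(xi, s)] with [s > 0] is spread over
   the half line [t >= s] with the weight [exp (- (t - s) g(xi))], that of [V0] over the whole time
   line with the weight [exp (- t g(xi))], and that of [Y] at [s = 0], which makes [V] jump to its
   prescribed value [V0], over [t < 0] with the opposite sign.  Since [Re g >= 0], the restriction
   to [t >= 0] is slow-growing; for [t < 0] only local finiteness is needed.

   For uniqueness, let [L] be the integral against the difference of two solutions.  Testing with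
   [a(xi) chi(t)] gives [L (a (- chi' + g chi)) = 0], first for smooth [a], and then for all
   measurable bounded [a] of bounded support, because for fixed [chi] this is a complex measure in
   [a].  As both solutions have the same initial value, cutting off at [t = 0] produces no boundary
   term, so [L (a 1_(t > 0) psi') = L (a g 1_(t > 0) psi)] as soon as [psi] vanishes for large [t],
   and likewise on [t <= 0].  Replacing [psi'] by [psi] repeatedly, a weighted norm decreases
   geometrically, whence [L (a psi) = 0]. *)

Set Implicit Arguments.
Unset Strict Implicit.
Unset Printing Implicit Defensive.

Import Order.TTheory GRing.Theory Num.Theory.
Import numFieldNormedType.Exports.

Local Open Scope classical_set_scope.
Local Open Scope ring_scope.
Local Open Scope complex_scope.

Local Notation normc := ComplexField.Normc.normc.
Local Notation Re := complex.Re.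
Local Notation Im := complex.Im.

(** A Radon measure is given here as a function of bounded Borel sets, with integrals taken against
    suprema of values and a variation defined as a supremum over partitions. Fubini and dominated
    convergence do not apply to these directly. Once the measure is the image of [f lam], with [lam]
    a sigma-finite measure on an auxiliary space, every integral moves to that space, and a disjoint
    union of such spaces lets several measures share one [lam].

    For uniqueness, the natural dual function solves [- psi' + g psi = theta] for each [xi]
    separately. It is not a product of a function of [xi] and a function of [t], and it is only
    continuous in [xi], as [g] is. The iteration of primitives amounts to its Neumann series, whose
    terms are products. A primitive that vanishes for large [t] is in general not zero for large
    negative [t]; this forces the separation of the two half lines, and it is at their common end
    that the initial value enters. On a bounded set of [xi] the symbol is bounded, so the past is
    determined like the future, without using the sign of [Re g]. *)

(** * The l^1 modulus and limits of complex numbers *)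

Section abs1.
Variable R : realType.
Implicit Types z w : R[i].

(* The l^1 modulus is used instead of [normc] because its measurability and
   its bounds are immediate from the real and imaginary parts. *)
Definition abs1 z : R := `|Re z| + `|Im z|.

Lemma abs1_ge0 z : 0 <= abs1 z.
Proof. exact: addr_ge0. Qed.

Lemma cReD z w : Re (z + w) = Re z + Re w. Proof. by case: z w => [a b] []. Qed.
Lemma cImD z w : Im (z + w) = Im z + Im w. Proof. by case: z w => [a b] []. Qed.
Lemma cReN z : Re (- z) = - Re z. Proof. by case: z. Qed.
Lemma cImN z : Im (- z) = - Im z. Proof. by case: z. Qed.
Lemma cReM z w : Re (z * w) = Re z * Re w - Im z * Im w.
Proof. by case: z w => [a b] []. Qed.
Lemma cImM z w : Im (z * w) = Re z * Im w + Im z * Re w.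
Proof. by case: z w => [a b] [c d] /=; rewrite mulrC. Qed.

Lemma complex_eqP z w : Re z = Re w -> Im z = Im w -> z = w.
Proof. by case: z w => [a b] [c d] /= -> ->. Qed.

Lemma abs1D z w : abs1 (z + w) <= abs1 z + abs1 w.
Proof.
rewrite /abs1 cReD cImD addrACA.
by apply: lerD; apply: ler_normD.
Qed.

Lemma abs1N z : abs1 (- z) = abs1 z.
Proof. by rewrite /abs1 cReN cImN !normrN. Qed.

Lemma abs1M z w : abs1 (z * w) <= abs1 z * abs1 w.
Proof.
rewrite /abs1 cReM cImM.
apply: (@le_trans _ _ ((`|Re z| * `|Re w| + `|Im z| * `|Im w|) +
  (`|Re z| * `|Im w| + `|Im z| * `|Re w|))).
  by apply: lerD; rewrite -!normrM; [apply: ler_normB|apply: ler_normD].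
by rewrite le_eqVlt; apply/orP; left; apply/eqP; ring.
Qed.

Lemma abs1_real (r : R) : abs1 r%:C = `|r|.
Proof. by rewrite /abs1 /= normr0 addr0. Qed.

Lemma abs1Z (r : R) z : 0 <= r -> abs1 (r%:C * z) = r * abs1 z.
Proof.
move=> r0; rewrite /abs1 cReM cImM /= !mul0r subr0 addr0 !normrM -mulrDr.
by rewrite (ger0_norm r0).
Qed.

Lemma ler_Re_abs1 z : `|Re z| <= abs1 z.
Proof. by rewrite lerDl. Qed.

Lemma ler_Im_abs1 z : `|Im z| <= abs1 z.
Proof. by rewrite lerDr. Qed.

Lemma Re_normc z : `|Re z| <= normc z.
Proof.
case: z => a b /=; rewrite -sqrtr_sqr ler_wsqrtr // lerDl sqr_ge0 //.
Qed.

Lemma Im_normc z : `|Im z| <= normc z.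
Proof.
case: z => a b /=; rewrite -sqrtr_sqr ler_wsqrtr // lerDr sqr_ge0 //.
Qed.

Lemma normc_abs1 z : normc z <= abs1 z.
Proof.
have h : 0 <= abs1 z := abs1_ge0 z.
rewrite -[leRHS](ger0_norm h) -sqrtr_sqr; case: z h => a b h /=.
rewrite ler_wsqrtr // /abs1 /= sqrrD !real_normK ?num_real //.
by rewrite -addrA lerD2l lerDr mulrn_wge0// mulr_ge0.
Qed.

Lemma abs1_normc z : abs1 z <= 2 * normc z.
Proof. by rewrite mulr_natl mulr2n lerD // ?Re_normc ?Im_normc. Qed.

Lemma normc_complex z : `|z| = (normc z)%:C.
Proof. by rewrite normc_def; case: z. Qed.

Lemma cvg_complexP (T : Type) (F : set_system T) (FF : Filter F)
    (f : T -> R[i]) (l : R[i]) :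
  ((fun x => f x : R[i]^o) @ F --> (l : R[i]^o)) <->
  ((fun x => Re (f x)) @ F --> Re l /\ (fun x => Im (f x)) @ F --> Im l).
Proof.
have subE z w : (Re (z - w) = Re z - Re w) * (Im (z - w) = Im z - Im w).
  by rewrite cReD cImD cReN cImN.
split.
  move=> /cvgrPdist_lt h; split; apply/cvgrPdist_lt => e e0;
    have /h : (0 : R[i]) < e%:C by rewrite ltcE /= eqxx.
    apply: filterS => x; rewrite (normc_complex (l - f x)) ltcR.
    by apply: le_lt_trans; rewrite -subE Re_normc.
  apply: filterS => x; rewrite (normc_complex (l - f x)) ltcR.
  by apply: le_lt_trans; rewrite -subE Im_normc.
move=> [/cvgrPdist_lt hr /cvgrPdist_lt hi]; apply/cvgrPdist_lt => -[e e'].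
(* A radius is here an element of [R[i]]; its positivity means that its imaginary part vanishes. *)
rewrite ltcE /= => /andP[/eqP -> e0].
have e20 : 0 < e / 2 by rewrite divr_gt0.
move: (hr _ e20) (hi _ e20); apply: filterS2 => x; rewrite -!subE => xr xi.
rewrite (normc_complex (l - f x)) ltcR.
by apply: le_lt_trans (normc_abs1 _) _; rewrite [ltRHS]splitr ltrD.
Qed.

End abs1.

(** * Integrals of complex functions *)

Section complex_integral.
Context d (T : measurableType d) (R : realType).
Implicit Types (m : {measure set T -> \bar R}) (D : set T) (f g : T -> R[i]).

Definition cmeasurable f :=
  measurable_fun setT (fun x => Re (f x)) /\ measurable_fun setT (fun x => Im (f x)).

(** Measurability is asked on the whole space even for an integral over [D], so that it passes to
    subsets and products without side conditions. *)
Definition cintegrable m D f :=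
  cmeasurable f /\ m.-integrable D (EFin \o (fun x => abs1 (f x))).

Definition Cint m D f : R[i] :=
  (\int[m]_(x in D) Re (f x)) +i* (\int[m]_(x in D) Im (f x)).

Lemma cmeasurable_cst z : cmeasurable (fun _ => z).
Proof. by split; exact: measurable_cst. Qed.

Lemma cmeasurableD f g : cmeasurable f -> cmeasurable g ->
  cmeasurable (fun x => f x + g x).
Proof.
move=> [fr fi] [gr gi]; split.
  by under eq_fun do rewrite cReD; exact: measurable_funD.
by under eq_fun do rewrite cImD; exact: measurable_funD.
Qed.

Lemma cmeasurableN f : cmeasurable f -> cmeasurable (fun x => - f x).
Proof.
move=> [fr fi]; split.
  by under eq_fun do rewrite cReN; exact: measurableT_comp.
by under eq_fun do rewrite cImN; exact: measurableT_comp.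
Qed.

Lemma cmeasurableB f g : cmeasurable f -> cmeasurable g ->
  cmeasurable (fun x => f x - g x).
Proof. by move=> mf mg; apply: cmeasurableD => //; exact: cmeasurableN. Qed.

Lemma cmeasurableM f g : cmeasurable f -> cmeasurable g ->
  cmeasurable (fun x => f x * g x).
Proof.
move=> [fr fi] [gr gi]; split.
  under eq_fun do rewrite cReM.
  by apply: measurable_funB; exact: measurable_funM.
under eq_fun do rewrite cImM.
by apply: measurable_funD; exact: measurable_funM.
Qed.

Lemma cmeasurable_real (u : T -> R) : measurable_fun setT u ->
  cmeasurable (fun x => (u x)%:C).
Proof. by move=> mu; split => //=; exact: measurable_cst. Qed.

Lemma cmeasurable_indic D : measurable D -> cmeasurable (fun x => (\1_D x)%:C).
Proof. by move=> mD; apply: cmeasurable_real; exact: measurable_indic. Qed.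

Lemma measurable_abs1 f : cmeasurable f -> measurable_fun setT (fun x => abs1 (f x)).
Proof.
by move=> [fr fi]; apply: measurable_funD; exact: measurableT_comp.
Qed.

Lemma cintegrable_le m D (G : T -> R) f : measurable D -> cmeasurable f ->
  m.-integrable D (EFin \o G) -> (forall x, D x -> abs1 (f x) <= G x) ->
  cintegrable m D f.
Proof.
move=> mD mf iG fG; split=> //; apply: (le_integrable mD) iG.
  by apply/measurable_EFinP/measurable_funTS; exact: measurable_abs1.
move=> x Dx /=; rewrite lee_fin ger0_norm ?abs1_ge0//.
exact: le_trans (fG _ Dx) (ler_norm _).
Qed.

Lemma cintegrable_ReIm m D f : measurable D -> cintegrable m D f ->
  m.-integrable D (EFin \o (fun x => Re (f x))) /\
  m.-integrable D (EFin \o (fun x => Im (f x))).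
Proof.
move=> mD [[fr fi] iF]; split; apply: (le_integrable mD) iF => //.
- exact/measurable_EFinP/measurable_funTS.
- move=> x Dx /=; rewrite lee_fin (ger0_norm (abs1_ge0 _)); exact: ler_Re_abs1.
- exact/measurable_EFinP/measurable_funTS.
- move=> x Dx /=; rewrite lee_fin (ger0_norm (abs1_ge0 _)); exact: ler_Im_abs1.
Qed.

Lemma cintegrableS m D D' f : measurable D -> measurable D' -> D' `<=` D ->
  cintegrable m D f -> cintegrable m D' f.
Proof. by move=> mD mD' DD' [mf iF]; split=> //; exact: integrableS iF. Qed.

Lemma cintegrableD m D f g : measurable D -> cintegrable m D f ->
  cintegrable m D g -> cintegrable m D (fun x => f x + g x).
Proof.
move=> mD [mf iF] [mg ig].
apply: (@cintegrable_le m D (fun x => abs1 (f x) + abs1 (g x))) => //.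
- exact: cmeasurableD.
- exact: (integrableD mD iF ig).
- by move=> x _; exact: abs1D.
Qed.

Lemma cintegrableN m D f : measurable D -> cintegrable m D f ->
  cintegrable m D (fun x => - f x).
Proof.
move=> mD [mf iF]; split; first exact: cmeasurableN.
by apply: eq_integrable iF => // x _ /=; rewrite abs1N.
Qed.

Lemma cintegrableB m D f g : measurable D -> cintegrable m D f ->
  cintegrable m D g -> cintegrable m D (fun x => f x - g x).
Proof. by move=> mD iF ig; apply: cintegrableD => //; exact: cintegrableN. Qed.

Lemma cintegrableM_bounded m D f g (C : R) : measurable D -> cmeasurable f ->
  (forall x, D x -> abs1 (f x) <= C) ->
  cintegrable m D g -> cintegrable m D (fun x => f x * g x).
Proof.
move=> mD mf fC [mg ig].
apply: (@cintegrable_le m D (fun x => C * abs1 (g x))) => //.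
- exact: cmeasurableM.
- exact: (integrableZl mD C ig).
- move=> x Dx; apply: le_trans (abs1M _ _) _.
  by apply: ler_wpM2r; [exact: abs1_ge0|exact: fC].
Qed.

Lemma cintegrableZ m D z f : measurable D -> cintegrable m D f ->
  cintegrable m D (fun x => z * f x).
Proof.
move=> mD; apply: (@cintegrableM_bounded _ _ _ _ (abs1 z)) => //.
Qed.

Lemma eq_Cint m D f g : (forall x, D x -> f x = g x) -> Cint m D f = Cint m D g.
Proof.
by move=> fg; congr (_ +i* _); apply: eq_Rintegral => x; rewrite inE => /fg ->.
Qed.

Lemma CintD m D f g : measurable D -> cintegrable m D f -> cintegrable m D g ->
  Cint m D (fun x => f x + g x) = Cint m D f + Cint m D g.
Proof.
move=> mD /(cintegrable_ReIm mD)[fr fi] /(cintegrable_ReIm mD)[gr gi].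
apply: complex_eqP; rewrite ?cReD ?cImD /=.
  by under eq_Rintegral do rewrite cReD; exact: RintegralD.
by under eq_Rintegral do rewrite cImD; exact: RintegralD.
Qed.

Lemma CintZ m D z f : measurable D -> cintegrable m D f ->
  Cint m D (fun x => z * f x) = z * Cint m D f.
Proof.
move=> mD /(cintegrable_ReIm mD)[fr fi].
have h (h : T -> R) r : m.-integrable D (EFin \o h) ->
    m.-integrable D (EFin \o (fun x => r * h x)) by exact: integrableZl.
apply: complex_eqP; rewrite ?cReM ?cImM /=.
  under eq_Rintegral do rewrite cReM.
  by rewrite RintegralB ?RintegralZl//; exact: h.
under eq_Rintegral do rewrite cImM.
by rewrite RintegralD ?RintegralZl//; exact: h.
Qed.

Lemma CintN m D f : measurable D -> cintegrable m D f ->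
  Cint m D (fun x => - f x) = - Cint m D f.
Proof.
move=> mD iF; rewrite -mulN1r -CintZ//.
by apply: eq_Cint => x _; rewrite mulN1r.
Qed.

Lemma CintB m D f g : measurable D -> cintegrable m D f -> cintegrable m D g ->
  Cint m D (fun x => f x - g x) = Cint m D f - Cint m D g.
Proof.
by move=> mD iF ig; rewrite CintD ?CintN//; exact: cintegrableN.
Qed.

Lemma Cint_mkcond m D f :
  Cint m D f = Cint m setT (fun x => (\1_D x)%:C * f x).
Proof.
rewrite /Cint !(Rintegral_mkcond _ D); congr (_ +i* _); apply: eq_Rintegral => x _;
  by rewrite patchE ?cReM ?cImM /= indicE; case: ifPn => _ /=;
    rewrite ?mul1r ?mul0r ?subr0 ?addr0.
Qed.

Lemma cintegrable_mkcond m D f : measurable D -> cmeasurable f ->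
  cintegrable m D f <-> cintegrable m setT (fun x => (\1_D x)%:C * f x).
Proof.
move=> mD mf.
have e : (EFin \o (fun x => abs1 (f x))) \_ D =
         EFin \o (fun x => abs1 ((\1_D x)%:C * f x)).
  apply/funext => x; rewrite /= patchE indicE; case: ifPn => _.
    by rewrite mul1r.
  by rewrite mul0r /abs1 /= normr0 addr0.
split=> -[_ iF]; split=> //.
- by apply: cmeasurableM => //; exact: cmeasurable_indic.
- by rewrite -e; exact/(integrable_mkcond _ mD).1.
- by apply/(integrable_mkcond _ mD).2; rewrite e.
Qed.

(** With the l^1 modulus the triangle inequality holds componentwise, hence with constant 1. *)
Lemma abs1_Cint m D f : measurable D -> cintegrable m D f ->
  abs1 (Cint m D f) <= \int[m]_(x in D) abs1 (f x).
Proof.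
move=> mD iF; have [fr fi] := cintegrable_ReIm mD iF.
rewrite [leRHS](_ : _ = \int[m]_(x in D) `|Re (f x)| + \int[m]_(x in D) `|Im (f x)|).
  by apply: lerD; exact: le_normr_Rintegral.
by rewrite -RintegralD//; exact: integrable_norm.
Qed.

Lemma Cint_dominated m D (f_ : nat -> T -> R[i]) f (G : T -> R) : measurable D ->
  (forall n, cmeasurable (f_ n)) -> cmeasurable f ->
  (forall x, D x -> ((f_ n x : R[i]^o) @[n --> \oo] --> (f x : R[i]^o))) ->
  m.-integrable D (EFin \o G) ->
  (forall n x, D x -> abs1 (f_ n x) <= G x) ->
  ((Cint m D (f_ n) : R[i]^o) @[n --> \oo] --> (Cint m D f : R[i]^o)).
Proof.
move=> mD mf_ mf ff iG fG.
have fr x : D x -> Re (f_ n x) @[n --> \oo] --> Re (f x).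
  by move=> /ff /cvg_complexP[].
have fi x : D x -> Im (f_ n x) @[n --> \oo] --> Im (f x).
  by move=> /ff /cvg_complexP[].
have H (h_ : nat -> T -> R) (h : T -> R) : (forall n, measurable_fun setT (h_ n)) ->
    measurable_fun setT h -> (forall x, D x -> h_ n x @[n --> \oo] --> h x) ->
    (forall n x, D x -> `|h_ n x| <= abs1 (f_ n x)) ->
    (\int[m]_(x in D) h_ n x) @[n --> \oo] --> \int[m]_(x in D) h x.
  move=> mh_ mh hh hf.
  have [|||||ih _ c] := @dominated_convergence _ _ _ m D mD (fun n => EFin \o h_ n)
      (EFin \o h) (EFin \o G).
  - by move=> n; exact/measurable_EFinP/measurable_funTS.
  - exact/measurable_EFinP/measurable_funTS.
  - by apply/aeW => x Dx; apply/cvg_EFin; [exact: nearW|exact: hh].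
  - exact: iG.
  - apply/aeW => x n Dx /=; rewrite lee_fin.
    exact: le_trans (hf _ _ Dx) (fG _ _ Dx).
  apply/fine_cvg; rewrite /Rintegral fineK; first exact: c.
  exact: integrable_fin_num.
apply/cvg_complexP; split.
  apply: H => [n|||n x _]; [exact: (mf_ n).1|exact: mf.1|exact: fr|].
  exact: ler_Re_abs1.
apply: H => [n|||n x _]; [exact: (mf_ n).2|exact: mf.2|exact: fi|].
exact: ler_Im_abs1.
Qed.

(** Extended by zero outside the union, [h] is integrable and induces a charge, whose
    sigma-additivity is the claim. *)
Lemma Rintegral_bigcup m (A : nat -> set T) (h : T -> R) : trivIset setT A ->
  (forall n, measurable (A n)) -> m.-integrable (\bigcup_n A n) (EFin \o h) ->
  (\sum_(0 <= k < n) \int[m]_(x in A k) h x) @[n --> \oo] -->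
    \int[m]_(x in \bigcup_n A n) h x.
Proof.
move=> tA mA ih.
have mU : measurable (\bigcup_n A n) by exact: bigcupT_measurable.
have iU : m.-integrable setT ((EFin \o h) \_ (\bigcup_n A n)).
  exact/(integrable_mkcond _ mU).1.
have resE B : B `<=` \bigcup_n A n ->
    induced_charge iU B =
    (\int[m]_(x in B) (h x)%:E)%E.
  move=> BU; apply: eq_integral => x; rewrite inE => Bx.
  by rewrite patchE mem_set//; exact: BU.
have fin B : measurable B -> B `<=` \bigcup_n A n ->
    (\int[m]_(x in B) (h x)%:E)%E \is a fin_num.
  by move=> mB BU; apply: integrable_fin_num => //; exact: integrableS ih.
have : (fun n => \sum_(0 <= k < n) induced_charge iU (A k))%E @ \oo -->
    induced_charge iU (\bigcup_n A n).
  exact: (charge_semi_sigma_additive (s := induced_charge iU) A mA tA mU).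
rewrite resE// -[X in _ --> X]fineK; last exact: fin.
move=> /fine_cvg; apply: cvg_trans; apply: near_eq_cvg; apply: nearW => n /=.
rewrite -sum_fine; last first.
  by move=> k _; rewrite resE; [apply: fin => //|]; exact: bigcup_sup.
by apply: eq_bigr => k _; rewrite resE//; exact: bigcup_sup.
Qed.

Lemma Cint_bigcup m (A : nat -> set T) f : trivIset setT A ->
  (forall n, measurable (A n)) -> cintegrable m (\bigcup_n A n) f ->
  ((\sum_(0 <= k < n) (Cint m (A k) f : R[i]^o)) @[n --> \oo]
     --> (Cint m (\bigcup_n A n) f : R[i]^o)).
Proof.
move=> tA mA iF.
have mU : measurable (\bigcup_n A n) by exact: bigcupT_measurable.
have [fr fi] := cintegrable_ReIm mU iF.
have sumRe n : Re (\sum_(0 <= k < n) (Cint m (A k) f)) =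
    \sum_(0 <= k < n) \int[m]_(x in A k) Re (f x).
  elim: n => [|n IH]; first by rewrite !big_geq.
  by rewrite !big_nat_recr//= cReD IH.
have sumIm n : Im (\sum_(0 <= k < n) (Cint m (A k) f)) =
    \sum_(0 <= k < n) \int[m]_(x in A k) Im (f x).
  elim: n => [|n IH]; first by rewrite !big_geq.
  by rewrite !big_nat_recr//= cImD IH.
apply/cvg_complexP; split.
  by under eq_fun do rewrite sumRe; exact: Rintegral_bigcup.
by under eq_fun do rewrite sumIm; exact: Rintegral_bigcup.
Qed.

End complex_integral.

Lemma cmeasurable_comp d1 d2 (T1 : measurableType d1) (T2 : measurableType d2)
    (R : realType) (f : T2 -> R[i]) (p : T1 -> T2) :
  cmeasurable f -> measurable_fun setT p -> cmeasurable (fun x => f (p x)).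
Proof.
by move=> [fr fi] mp; split; [exact: (measurableT_comp fr)|exact: (measurableT_comp fi)].
Qed.

(** * Set functions, bounded Borel sets and Jordan parts *)

Section set_function_integral.
Import HBNNSimple.
Context d (T : measurableType d) (R : realType).
Local Open Scope ereal_scope.

(** The integral of a nonnegative function is a supremum of sums over simple functions, which is
    monotone in the set function whether or not it is a measure. In this way integrals against
    [radon_variation] are compared with integrals against measures. *)
Lemma le_integral_set_function (m1 m2 : set T -> \bar R) (f : T -> \bar R) :
  m1 set0 = 0 -> m2 set0 = 0 -> (forall A, measurable A -> m1 A <= m2 A) ->
  (forall x, 0 <= f x) -> \int[m1]_x f x <= \int[m2]_x f x.
Proof.
move=> m10 m20 m12 f0; rewrite /integral patch_setT.
(* Levels outside the range have an empty preimage; this is where [m set0 = 0] enters. *)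
have sintegral_range (m : set T -> \bar R) (h : {nnsfun T >-> R}) : m set0 = 0 ->
    sintegral m h = \sum_(x \in range h) x%:E * m (h @^-1` [set x]).
  move=> m0; rewrite /sintegral; apply/esym/fsbig_widen => //= x [_ /= hx].
  by rewrite preimage10// m0 mule0.
have neg0 (m : set T -> \bar R) : m set0 = 0 ->
    ereal_sup [set sintegral m h | h in
      [set h : {nnsfun T >-> R} | forall x, (h x)%:E <= f^\- x]] = 0.
  move=> m0.
  have f_neg x : f^\- x = 0.
    by apply: (@ge0_funenegE _ _ setT) => //; rewrite in_setT.
  have sint0 (h : {nnsfun T >-> R}) : (forall x, h x = 0%R) -> sintegral m h = 0.
    move=> h0; rewrite sintegral_range//; rewrite fsbig1// => r -[x _ <-].
    by rewrite h0 mul0e.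
  apply/eqP; rewrite eq_le; apply/andP; split.
    apply: ge_ereal_sup => _ [h hf <-]; rewrite sint0// => x.
    have := hf x; rewrite f_neg lee_fin => h0.
    by apply/eqP; rewrite eq_le h0 fun_ge0.
  apply: ereal_sup_ubound; exists nnsfun0; first by move=> x; rewrite f_neg.
  by apply: sint0.
rewrite !neg0// !sube0.
apply: ge_ereal_sup => _ [h /= hf <-].
apply: (@le_trans _ _ (sintegral m2 h)); last first.
  by apply: ereal_sup_ubound; exists h.
rewrite !sintegral_range//; apply: lee_fsum => // _ [x _ <-].
apply: lee_wpmul2l; last by apply: m12; exact: measurable_funPTI.
by rewrite lee_fin.
Qed.

End set_function_integral.

Section exhaustion.
Context (R : realType) (E : normedModType R).
Implicit Types A B : set E.

Lemma borel_open A : open A -> measurable (A : set (borel E)).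
Proof. by move=> oA; exact: sub_sigma_algebra. Qed.

Lemma bounded_setP A : bounded_set A <-> exists M : R, forall x, A x -> `|x| <= M.
Proof.
split=> [[M [_ h]]|[M h]].
  by exists (M + 1) => x Ax; apply: h => //; rewrite ltrDl.
exists M; split; first exact: num_real.
by move=> N MN x /h /le_trans; apply; exact: ltW.
Qed.

Definition nball (n : nat) : set E := [set x | `|x| < n%:R].

Lemma nballE n : nball n = ball (0 : E) n%:R.
Proof. by apply/seteqP; split => x; rewrite /nball -ball_normE /= sub0r normrN. Qed.

Lemma bounded_borel_nball n : bounded_borel (nball n).
Proof.
split; first by apply/bounded_setP; exists n%:R => x /ltW.
have [->|n0] := posnP n.
  rewrite (_ : nball 0 = set0); first exact: measurable0.
  by apply/seteqP; split => // x; rewrite /nball /= ltNge normr_ge0.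
by apply: borel_open; rewrite nballE; apply: ball_open; rewrite ltr0n.
Qed.

Lemma bigcup_nball : \bigcup_n nball n = setT.
Proof.
apply/seteqP; split => // x _; exists (Num.trunc `|x|).+1 => //.
by rewrite /nball /= truncnS_gt.
Qed.

Lemma bounded_borel0 : bounded_borel (set0 : set E).
Proof. by split; [apply/bounded_setP; exists 0|exact: measurable0]. Qed.

Lemma bounded_borelS A B : bounded_borel A -> measurable (B : set (borel E)) -> B `<=` A ->
  bounded_borel B.
Proof.
move=> [/bounded_setP[M h] _] mB BA; split => //.
by apply/bounded_setP; exists M => x /BA /h.
Qed.

Lemma bounded_borelIr A B : bounded_borel A -> measurable (B : set (borel E)) ->
  bounded_borel (A `&` B).
Proof.
move=> bA mB; apply: bounded_borelS (bA) _ _; last exact: subIsetl.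
by apply: measurableI => //; case: bA.
Qed.

Lemma bounded_borelU A B : bounded_borel A -> bounded_borel B -> bounded_borel (A `|` B).
Proof.
move=> [/bounded_setP[M hM] mA] [/bounded_setP[N hN] mB]; split; last exact: measurableU.
apply/bounded_setP; exists (Num.max M N) => x [/hM|/hN] h; rewrite le_max h ?orbT//.
Qed.

Lemma bounded_borelD A B : bounded_borel A -> bounded_borel B -> bounded_borel (A `\` B).
Proof.
move=> bA [_ mB]; apply: bounded_borelS (bA) _ _; last exact: subDsetl.
by apply: measurableD => //; case: bA.
Qed.

Lemma measurable_nball n : measurable (nball n : set (borel E)).
Proof. by case: (bounded_borel_nball n). Qed.

(* Every Borel set is partitioned by the shells of consecutive balls. *)
Lemma bounded_borel_partition A : measurable (A : set (borel E)) ->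
  exists B : nat -> set E, [/\ forall n, bounded_borel (B n), trivIset setT B &
    \bigcup_n B n = A].
Proof.
move=> mA; exists (fun n => seqDU nball n `&` A); split.
- move=> n; apply: bounded_borelIr => //.
  apply: bounded_borelS (bounded_borel_nball n) _ _.
    apply: measurableD; first exact: measurable_nball.
    by apply: bigsetU_measurable => k _; exact: measurable_nball.
  exact: subDsetl.
- apply: trivIset_setIr; exact: trivIset_seqDU.
- by rewrite -setI_bigcupl -seqDU_bigcup_eq bigcup_nball setTI.
Qed.

End exhaustion.

Section positive_variation.
Context (R : realType) (E : normedModType R).
Implicit Types (A B : set E) (nu : set E -> R).

Definition real_radon nu := forall A : nat -> set E,
  (forall n, bounded_borel (A n)) -> trivIset setT A ->
  bounded_borel (\bigcup_n A n) ->
  (\sum_(0 <= k < n) nu (A k)) @[n --> \oo] --> nu (\bigcup_n A n).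

Lemma real_radonN nu : real_radon nu -> real_radon (fun B => - nu B).
Proof.
by move=> h A bA tA bU; under eq_fun do rewrite sumrN; apply: cvgN; exact: h.
Qed.

(** The series with constant term [nu set0] converges, so its term tends to zero. *)
Lemma real_radon_set0 nu : real_radon nu -> nu set0 = 0.
Proof.
move=> h; have b0 := @bounded_borel0 R E.
have := h (fun _ => set0) (fun=> b0); rewrite bigcup0// => /(_ _ b0) c.
have {}c : \sum_(0 <= k < n) nu set0 @[n --> \oo] --> nu set0.
  by apply: c; apply/trivIsetP => i j _ _ _; rewrite setI0.
have : (fun _ : nat => nu set0) @ \oo --> (0 : R).
  by apply: cvg_series_cvg_0; apply/cvg_ex; eexists; exact: c.
by move=> /(cvg_unique (@Rhausdorff R) (cvg_cst _)).
Qed.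

Lemma real_radonU nu A B : real_radon nu -> bounded_borel A -> bounded_borel B ->
  A `&` B = set0 -> nu (A `|` B) = nu A + nu B.
Proof.
move=> h bA bB AB0; have nu0 := real_radon_set0 h.
have := h (bigcup2 A B); rewrite bigcup2E => /(_ _ _ _) c.
have {}c : (\sum_(0 <= k < n) nu (bigcup2 A B k)) @[n --> \oo] --> nu (A `|` B).
  apply: c.
  - by move=> [|[|n]] //=; exact: bounded_borel0.
  - by rewrite -trivIset_bigcup2.
  - exact: bounded_borelU.
move: c; rewrite -(cvg_shiftn 2) => c.
apply: (cvg_unique (@Rhausdorff R) c).
apply: cvg_near_cst; apply: nearW => n.
by rewrite /= addn2 big_nat_recl // big_nat_recl //= big1 ?addr0//.
Qed.

Lemma real_radonD nu A B : real_radon nu -> bounded_borel A -> bounded_borel B ->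
  B `<=` A -> nu (A `\` B) = nu A - nu B.
Proof.
move=> h bA bB BA; rewrite -[in nu A](setDUK BA) real_radonU//.
- by rewrite addrC addKr.
- exact: bounded_borelD.
- exact: setDIK.
Qed.

(** Restricted to [A], [nu] is a finite charge; a Hahn decomposition bounds it by the total mass of
    its positive part. *)
Lemma real_radon_bounded nu A : real_radon nu -> bounded_borel A ->
  exists M : R, forall B, bounded_borel B -> B `<=` A -> nu B <= M.
Proof.
move=> h bA; pose c (B : set (borel E)) : \bar R := (nu (A `&` B))%:E.
have c0 : c set0 = 0%E by rewrite /c setI0 real_radon_set0.
have cfin (B : set (borel E)) : measurable B -> c B \is a fin_num by [].
have csig : semi_sigma_additive c.
  move=> F mF tF mU; apply/cvg_EFin; first by apply: nearW => n; rewrite sumEFin.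
  have := h (fun n => A `&` F n).
  rewrite -setI_bigcupr => /(_ _ _ _) cv.
  have {}cv : (\sum_(0 <= k < n) nu (A `&` F k)) @[n --> \oo] --> nu (A `&` \bigcup_k F k).
    apply: cv.
    - by move=> n; exact: bounded_borelIr.
    - exact: trivIset_setIl.
    - exact: bounded_borelIr.
  apply: cvg_trans cv; apply: near_eq_cvg; apply: nearW => n /=.
  by rewrite sumEFin.
pose C : {charge set (borel E) -> \bar R} :=
  HB.pack c (isCharge.Build _ (borel E) R c c0 cfin csig).
have [P [N PN]] := Hahn_decomposition C.
exists (fine (jordan_pos PN setT)) => B bB BA.
have mB := bB.2.
have := jordan_decomp PN mB; rewrite /cadd /= /C /= /c (setIidr BA) => e.
rewrite -lee_fin e fineK ?fin_num_measure//.
apply: (@le_trans _ _ (jordan_pos PN B)).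
  by rewrite geeDl// /cscale EFinN mulN1e oppe_le0.
by apply: le_measure; rewrite ?inE.
Qed.

Lemma positive_variation_ub nu A B : bounded_borel B -> B `<=` A ->
  ((nu B)%:E <= positive_variation nu A)%E.
Proof. by move=> bB BA; apply: ereal_sup_ubound; exists B. Qed.

Lemma positive_variation_ge0 nu A : real_radon nu -> (0 <= positive_variation nu A)%E.
Proof.
move=> h; have := @positive_variation_ub nu A set0 (@bounded_borel0 R E) (@sub0set _ A).
by rewrite real_radon_set0.
Qed.

Lemma positive_variation_set0 nu : real_radon nu -> positive_variation nu set0 = 0%E.
Proof.
move=> h; apply/eqP; rewrite eq_le positive_variation_ge0// andbT.
apply: ge_ereal_sup => _ [B [_ +] <-].
rewrite subset0 => ->.
by rewrite real_radon_set0.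
Qed.

Lemma positive_variation_le nu A B : A `<=` B ->
  (positive_variation nu A <= positive_variation nu B)%E.
Proof.
move=> AB; apply: le_ereal_sup => _ [C [bC CA] <-]; exists C => //.
by split => //; exact: subset_trans AB.
Qed.

Lemma positive_variation_fin nu A : real_radon nu -> bounded_borel A ->
  positive_variation nu A \is a fin_num.
Proof.
move=> h bA; rewrite ge0_fin_numE ?positive_variation_ge0//.
have [M hM] := real_radon_bounded h bA.
apply: (@le_lt_trans _ _ M%:E); last exact: ltry.
by apply: ge_ereal_sup => _ [C [bC CA] <-]; rewrite lee_fin hM.
Qed.

Lemma positive_variation_superadditive nu A B : real_radon nu -> A `&` B = set0 ->
  (positive_variation nu A + positive_variation nu B <= positive_variation nu (A `|` B))%E.
Proof.
move=> h AB0.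
have [fA|] := boolP (positive_variation nu A \is a fin_num); last first.
  rewrite ge0_fin_numE ?positive_variation_ge0// -leNgt leye_eq => /eqP eA.
  have := @positive_variation_le nu A (A `|` B) (@subsetUl _ _ _).
  by rewrite eA leye_eq => /eqP ->; rewrite leey.
rewrite addeC -leeBrDr//; apply: ge_ereal_sup => _ [D [bD DB] <-].
rewrite leeBrDr// addeC -leeBrDr//; apply: ge_ereal_sup => _ [C [bC CA] <-].
rewrite leeBrDr// -EFinD -real_radonU//; last first.
  by rewrite -subset0 -AB0; exact: setISS.
by apply: positive_variation_ub; [exact: bounded_borelU|exact: setUSS].
Qed.

(** Superadditivity on finite unions gives one inequality. For the other, a competitor [B] is cut
    along the sets [F k], and sigma-additivity of [nu] on the bounded set [B] sums the pieces. *)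
Lemma positive_variation_sigma_additive nu : real_radon nu ->
  semi_sigma_additive (positive_variation nu : set (borel E) -> \bar R).
Proof.
move=> h F mF tF mU.
have pv0 A : (0 <= positive_variation nu A)%E by exact: positive_variation_ge0.
have cv : cvgn (fun n => \sum_(0 <= k < n) positive_variation nu (F k))%E.
  by apply: is_cvg_ereal_nneg_natsum_cond => n _ _; exact: pv0.
suff <- : (\sum_(0 <= k <oo) positive_variation nu (F k) =
    positive_variation nu (\bigcup_n F n))%E by exact: cv.
apply/eqP; rewrite eq_le; apply/andP; split.
  apply: lime_le => //; apply: nearW => n.
  apply: (@le_trans _ _ (positive_variation nu (\bigcup_(k in `I_n) F k))); last first.
    by apply: positive_variation_le; exact: bigcup_subset.
  elim: n => [|n IH]; first by rewrite big_geq// positive_variation_ge0.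
  rewrite big_nat_recr//= IIS bigcup_setU bigcup_set1.
  apply: le_trans (positive_variation_superadditive h _); first exact: leeD.
  apply/seteqP; split => // x [[k /= kn Fk] Fn].
  have := tF k n I I (ex_intro _ x (conj Fk Fn)) => kE.
  by rewrite kE ltnn in kn.
apply: ge_ereal_sup => _ [B [bB BU] <-].
have /eqP eB : B == \bigcup_n (B `&` F n).
  by rewrite -setI_bigcupr; apply/eqP; rewrite setIidl.
have c : (\sum_(0 <= k < n) nu (B `&` F k)) @[n --> \oo] --> nu B.
  rewrite [in nu B]eB; apply: h; last by rewrite -eB.
  - by move=> n; exact: bounded_borelIr.
  - exact: trivIset_setIl.
have le n : ((\sum_(0 <= k < n) nu (B `&` F k))%:E <=
    \sum_(0 <= k <oo) positive_variation nu (F k))%E.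
  apply: (@le_trans _ _ (\sum_(0 <= k < n) positive_variation nu (F k))%E).
    rewrite -sumEFin; apply: lee_sum => k _.
    by apply: positive_variation_ub; [exact: bounded_borelIr|exact: subIsetr].
  by apply: nneseries_lim_ge => k _ _; exact: pv0.
case E0 : (\sum_(0 <= k <oo) positive_variation nu (F k))%E le => [r||] le.
- rewrite lee_fin -(cvg_lim (@Rhausdorff R) c); apply: limr_le.
    by apply/cvg_ex; eexists; exact: c.
  by apply: nearW => n; rewrite -lee_fin.
- by rewrite leey.
- by have := le 0%N; rewrite leeNy_eq.
Qed.

(** The equality holds for every [A], measurable or not, so that the two set functions can be
    exchanged inside an integral by functional extensionality. *)
Lemma positive_variation_measure nu : real_radon nu ->
  exists m : {measure set (borel E) -> \bar R}, forall A, m A = positive_variation nu A.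
Proof.
move=> h.
pose m : {measure set (borel E) -> \bar R} := HB.pack (positive_variation nu : set (borel E) -> \bar R)
  (isMeasure.Build _ (borel E) R (positive_variation nu : set (borel E) -> \bar R) (positive_variation_set0 h)
  (fun A => positive_variation_ge0 A h) (positive_variation_sigma_additive h)).
by exists m.
Qed.

(** Replacing a competitor [C] by its complement [B \ C] gives one inequality; the other is the same
    for [- nu]. *)
Lemma positive_variation_decomp nu B : real_radon nu -> bounded_borel B ->
  positive_variation nu B = ((nu B)%:E + positive_variation (fun A => - nu A)%R B)%E.
Proof.
suff le nu' : real_radon nu' -> bounded_borel B ->
    (positive_variation nu' B <= (nu' B)%:E + positive_variation (fun A => - nu' A)%R B)%E.
  move=> h bB; apply/eqP; rewrite eq_le le//=.
  have := le _ (real_radonN h) bB.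
  rewrite (_ : (fun A => - (- nu A))%R = nu); last by apply/funext => A; rewrite opprK.
  by rewrite EFinN addeC leeBrDr// addeC.
move=> h bB; apply: ge_ereal_sup => _ [C [bC CB] <-].
have -> : nu' C = nu' B + - nu' (B `\` C) by rewrite real_radonD// opprB addrC subrK.
rewrite EFinD leeD2l//; apply: (@positive_variation_ub (fun A => - nu' A)).
  exact: bounded_borelD.
exact: subDsetl.
Qed.

End positive_variation.

Definition image_measure d1 d2 (T1 : measurableType d1) (T2 : measurableType d2)
    (R : realType) (m : {measure set T1 -> \bar R}) (f : T1 -> T2)
    (mf : measurable_fun setT f) : {measure set T2 -> \bar R} :=
  measure_function_pushforward__canonical__measure_function_Measure m mf.

(** * Real measures given by a density *)

Section density.
Import HBNNSimple.
Context d (T : measurableType d) (R : realType) (lam : {measure set T -> \bar R}).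
Variables (v : T -> R) (mv : measurable_fun setT v) (v0 : forall x, 0 <= v x).
Local Open Scope ereal_scope.

Lemma density_measure : exists m : {measure set T -> \bar R},
  forall A, m A = \int[lam]_(x in A) (v x)%:E.
Proof.
pose f A := \int[lam]_(x in A) (v x)%:E.
have f0 : f set0 = 0 by exact: integral_set0.
have fge0 A : 0 <= f A by apply: integral_ge0 => x _; rewrite lee_fin.
have fs : semi_sigma_additive f.
  apply: semi_sigma_additive_nng_induced; first exact/measurable_EFinP.
  by move=> x; rewrite lee_fin.
pose m : {measure set T -> \bar R} := HB.pack f (isMeasure.Build _ T R f f0 fge0 fs).
by exists m.
Qed.

Variable m : {measure set T -> \bar R}.
Hypothesis mE : forall A, measurable A -> m A = \int[lam]_(x in A) (v x)%:E.

Let nnsfun_density (h : {nnsfun T >-> R}) :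
  \int[m]_x (h x)%:E = \int[lam]_x ((h x)%:E * (v x)%:E).
Proof.
have mh r : measurable (h @^-1` [set r]) by exact: measurable_funPTI.
rewrite integralT_nnsfun sintegralE.
transitivity (\int[lam]_x
    (\sum_(r \in range h) (r%:E * ((\1_(h @^-1` [set r]) x)%:E * (v x)%:E)))).
  rewrite ge0_integral_fsum//.
  - apply: eq_fsbigr => r; rewrite inE => -[x _ <-].
    rewrite ge0_integralZl//; last 3 first.
    + apply: emeasurable_funM; last exact/measurable_EFinP.
      by apply/measurable_EFinP; exact: measurable_indic.
    + by move=> y _; rewrite mule_ge0// lee_fin.
    + by rewrite lee_fin.
    congr (_ * _); rewrite mE// integral_mkcond; apply: eq_integral => y _.
    by rewrite patchE indicE; case: ifPn => _; rewrite ?mul1e ?mul0e.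
  - move=> r; apply: emeasurable_funM; first exact: measurable_cst.
    apply: emeasurable_funM; last exact/measurable_EFinP.
    by apply/measurable_EFinP; exact: measurable_indic.
  - move=> r x _; rewrite muleA; apply: mule_ge0; last by rewrite lee_fin.
    exact: nnfun_muleindic_ge0.
apply: eq_integral => x _; rewrite [in RHS]fimfunE -fsumEFin//.
rewrite ge0_mule_fsuml; first by apply: eq_fsbigr => r _; rewrite EFinM muleA.
by move=> r; exact: nnfun_muleindic_ge0.
Qed.

Lemma ge0_integral_density (f : T -> \bar R) : measurable_fun setT f ->
  (forall x, 0 <= f x) -> \int[m]_x f x = \int[lam]_x (f x * (v x)%:E).
Proof.
move=> mf f0; pose h := nnsfun_approx measurableT mf.
have hcv x : (h n x)%:E @[n --> \oo] --> f x by exact: cvg_nnsfun_approx.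
have hnd x a b : (a <= b)%N -> (h a x)%:E <= (h b x)%:E.
  by move=> ab; rewrite lee_fin; exact/lefP/nd_nnsfun_approx.
transitivity (limn (fun n => \int[m]_x (h n x)%:E)).
  rewrite -monotone_convergence//.
  - by apply: eq_integral => x _; apply/esym/cvg_lim => //; exact: hcv.
  - by move=> n; apply/measurable_EFinP; exact: measurable_funP.
  - by move=> n x _; rewrite lee_fin.
  - by move=> x _ a b; exact: hnd.
under eq_fun do rewrite nnsfun_density.
rewrite -monotone_convergence//.
- apply: eq_integral => x _; apply/cvg_lim => //.
  by apply: cvgeZr => //; exact: hcv.
- move=> n; apply: emeasurable_funM; last exact/measurable_EFinP.
  by apply/measurable_EFinP; exact: measurable_funP.
- by move=> n x _; rewrite mule_ge0// lee_fin.
- by move=> x _ a b ab; apply: lee_wpmul2r; [rewrite lee_fin|exact: hnd].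
Qed.

Lemma integrable_density (f : T -> R) : measurable_fun setT f ->
  lam.-integrable setT (EFin \o (fun x => f x * v x)%R) ->
  m.-integrable setT (EFin \o f).
Proof.
move=> mf /integrableP[_ fv]; apply/integrableP; split; first exact/measurable_EFinP.
rewrite ge0_integral_density//; last by do 2 apply: measurableT_comp => //.
apply: le_lt_trans fv; rewrite le_eqVlt; apply/orP; left; apply/eqP.
by apply: eq_integral => x _; rewrite /= -EFinM normrM (ger0_norm (v0 x)).
Qed.

Lemma Rintegral_density (f : T -> R) : measurable_fun setT f ->
  lam.-integrable setT (EFin \o (fun x => f x * v x)%R) ->
  (\int[m]_x f x = \int[lam]_x (f x * v x))%R.
Proof.
move=> mf fv; congr fine; rewrite integralE [RHS]integralE.
have mfE : measurable_fun setT (EFin \o f) by exact/measurable_EFinP.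
congr (_ - _).
  rewrite ge0_integral_density//; last exact: measurable_funepos.
  apply: eq_integral => x _; rewrite !funeposE /= -!EFin_max -EFinM.
  by rewrite maxr_pMl// mul0r.
rewrite ge0_integral_density//; last exact: measurable_funeneg.
apply: eq_integral => x _; rewrite !funenegE /= -!EFin_max -EFinM.
by rewrite maxr_pMl// mul0r mulNr.
Qed.

End density.

Section represented_real_measure.
Context d (T : measurableType d) (R : realType) (E : normedModType R).
Implicit Types (A B : set E).

Lemma measure_le_bounded (m1 m2 : {measure set (borel E) -> \bar R}) A :
  (forall B, bounded_borel B -> (m1 B <= m2 B)%E) ->
  measurable (A : set (borel E)) -> (m1 A <= m2 A)%E.
Proof.
move=> h mA; have [B [bB tB <-]] := bounded_borel_partition mA.
have mB n : measurable (B n : set (borel E)) by case: (bB n).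
rewrite !measure_semi_bigcup//; try exact: bigcupT_measurable.
by apply: lee_nneseries => // n _; exact: h.
Qed.

Lemma measure_eq_bounded (m1 m2 : {measure set (borel E) -> \bar R}) A :
  (forall B, bounded_borel B -> m1 B = m2 B) ->
  measurable (A : set (borel E)) -> m1 A = m2 A.
Proof.
by move=> h mA; apply/eqP; rewrite eq_le !measure_le_bounded// => B bB; rewrite h.
Qed.

Lemma integral_real_mkcond (nu : set E -> R) A (f : E -> R) :
  integral_real nu A f = integral_real nu setT (f \_ A).
Proof.
rewrite /integral_real; congr (fine _ - fine _);
  by rewrite /integral !patch_setT restrict_EFin.
Qed.

Variables (lam : {measure set T -> \bar R}) (p : T -> borel E) (u : T -> R).
Hypotheses (mp : measurable_fun setT p) (mu : measurable_fun setT u).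
Hypothesis iu : forall B, bounded_borel B -> lam.-integrable (p @^-1` B) (EFin \o u).

Let mpre A : measurable (A : set (borel E)) -> measurable (p @^-1` A).
Proof. by move=> mA; rewrite -[X in measurable X]setTI; exact: mp. Qed.

Lemma represented_real_radon (nu : set E -> R) :
  (forall B, bounded_borel B -> nu B = \int[lam]_(x in p @^-1` B) u x) -> real_radon nu.
Proof.
move=> nuE A bA tA bU; rewrite nuE// preimage_bigcup.
under eq_fun do under eq_bigr do rewrite nuE//.
apply: Rintegral_bigcup.
- apply/trivIsetP => i j _ _ ij; rewrite -preimage_setI.
  by have /trivIsetP/(_ i j I I ij) -> := tA; rewrite preimage_set0.
- by move=> n; apply: mpre; case: (bA n).
- by rewrite -preimage_bigcup; exact: iu.
Qed.

(** The map [p] may send points where [u] has opposite signs to the same place, so the images [a]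
    and [b] of [u^+ lam] and [u^- lam] only dominate the Jordan parts [pos] and [neg] of [nu]. Still
    [pos + b = a + neg], and integrating [f] against both sides gives the formula. *)
Lemma integral_real_represented (nu : set E -> R) A (f : borel E -> R) :
  (forall B, bounded_borel B -> nu B = \int[lam]_(x in p @^-1` B) u x) ->
  measurable (A : set (borel E)) -> measurable_fun setT f ->
  lam.-integrable (p @^-1` A) (EFin \o (fun x => f (p x) * u x)) ->
  integral_real nu A f = \int[lam]_(x in p @^-1` A) (f (p x) * u x).
Proof.
move=> nuE mA mf; wlog -> : A f mA mf / A = setT => [wl|].
  move=> fA; rewrite integral_real_mkcond wl//.
  - rewrite preimage_setT [RHS]Rintegral_mkcond; apply: eq_Rintegral => x _.
    rewrite !patchE -(_ : (x \in p @^-1` A) = (p x \in A)); last first.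
      by apply/idP/idP; rewrite !inE.
    by case: ifPn => //; rewrite mul0r.
  - by apply: (measurable_restrictT f mA).1; exact: measurable_funTS.
  - rewrite preimage_setT.
    have := (integrable_mkcond _ (mpre mA)).1 fA.
    rewrite [X in _.-integrable _ X -> _](_ : _ =
      EFin \o (fun x => (f \_ A) (p x) * u x))//; apply/funext => x.
    rewrite /= !patchE -(_ : (x \in p @^-1` A) = (p x \in A)); last first.
      by apply/idP/idP; rewrite !inE.
    by case: ifPn => //=; rewrite mul0r.
rewrite preimage_setT => fu {A mA}.
have rnu := represented_real_radon nuE.
have [pos posE] := positive_variation_measure rnu.
have [neg negE] := positive_variation_measure (real_radonN rnu).
have mup : measurable_fun setT u^\+ by exact: measurable_funrpos.
have mun : measurable_fun setT u^\- by exact: measurable_funrneg.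
have [mP mPE] := density_measure lam mup (funrpos_ge0 u).
have [mN mNE] := density_measure lam mun (funrneg_ge0 u).
pose a := image_measure mP mp; pose b := image_measure mN mp.
have aE B : a B = (\int[lam]_(x in p @^-1` B) (u^\+ x)%:E)%E by exact: mPE.
have bE B : b B = (\int[lam]_(x in p @^-1` B) (u^\- x)%:E)%E by exact: mNE.
have iup B : bounded_borel B -> lam.-integrable (p @^-1` B) (EFin \o u^\+).
  by move=> bB; apply: integrable_funrpos; [apply: mpre; case: bB|exact: iu].
have iun B : bounded_borel B -> lam.-integrable (p @^-1` B) (EFin \o u^\-).
  by move=> bB; apply: integrable_funrneg; [apply: mpre; case: bB|exact: iu].
have afin B : bounded_borel B -> a B \is a fin_num.
  by move=> bB; rewrite aE; apply: integrable_fin_num; [apply: mpre; case: bB|exact: iup].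
have bfin B : bounded_borel B -> b B \is a fin_num.
  by move=> bB; rewrite bE; apply: integrable_fin_num; [apply: mpre; case: bB|exact: iun].
have abE B : bounded_borel B -> ((nu B)%:E + b B = a B)%E.
  move=> bB; rewrite -(fineK (afin _ bB)) -(fineK (bfin _ bB)) -EFinD; congr EFin.
  rewrite nuE// aE bE -/(Rintegral _ _ _) -/(Rintegral _ _ _) -RintegralD//.
  - apply: eq_Rintegral => x _; have := congr1 (fun h => h x) (funrposBneg u).
    by rewrite /= !fctE => {1}<-; rewrite subrK.
  - by apply: mpre; case: bB.
  - exact: iu.
  - exact: iun.
have posa B : measurable (B : set (borel E)) -> (pos B <= a B)%E.
  move=> mB; rewrite posE; apply: ge_ereal_sup => _ [C [bC CB] <-].
  apply: (@le_trans _ _ (a C)); first by rewrite -(abE _ bC) leeDl.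
  by apply: le_measure; rewrite ?inE//; case: bC.
have negb B : measurable (B : set (borel E)) -> (neg B <= b B)%E.
  move=> mB; rewrite negE; apply: ge_ereal_sup => _ [C [bC CB] <-].
  apply: (@le_trans _ _ (b C)); last by apply: le_measure; rewrite ?inE//; case: bC.
  have a0 : 0 <= fine (a C) by rewrite fine_ge0.
  have := abE _ bC; rewrite -(fineK (afin _ bC)) -(fineK (bfin _ bC)) -EFinD => -[e].
  by rewrite lee_fin; lra.
(* On bounded sets both sides equal [nu + b + neg], and bounded sets determine a measure. *)
have eqm B : measurable (B : set (borel E)) ->
    measure_add pos b B = measure_add a neg B.
  apply: measure_eq_bounded => C bC.
  change (measure_add pos b C = measure_add a neg C); rewrite !measure_addE posE negE.
  by rewrite positive_variation_decomp// -addeA [X in (_ + X)%E]addeC addeA abE.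
have fup : lam.-integrable setT (EFin \o (fun x => f (p x) * u^\+ x)).
  apply: (le_integrable measurableT) fu.
    by apply/measurable_EFinP; apply: measurable_funM => //; exact: measurableT_comp.
  move=> x _ /=; rewrite lee_fin !normrM ler_wpM2l// ger0_norm ?funrpos_ge0//.
  by rewrite /funrpos ge_max ler_norm normr_ge0.
have fun' : lam.-integrable setT (EFin \o (fun x => f (p x) * u^\- x)).
  apply: (le_integrable measurableT) fu.
    by apply/measurable_EFinP; apply: measurable_funM => //; exact: measurableT_comp.
  move=> x _ /=; rewrite lee_fin !normrM ler_wpM2l// ger0_norm ?funrneg_ge0//.
  by rewrite /funrneg ge_max -normrN ler_norm normr_ge0.
have mfp : measurable_fun setT (f \o p) by exact: measurableT_comp.
have fmP := @integrable_density _ _ _ _ _ mup (funrpos_ge0 u) mP (fun X _ => mPE X) _ mfp fup.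
have fmN := @integrable_density _ _ _ _ _ mun (funrneg_ge0 u) mN (fun X _ => mNE X) _ mfp fun'.
have mfE : measurable_fun setT (EFin \o f) by exact/measurable_EFinP.
have ia : a.-integrable setT (EFin \o f).
  by apply: integrable_pushforward => //; rewrite preimage_setT.
have ib : b.-integrable setT (EFin \o f).
  by apply: integrable_pushforward => //; rewrite preimage_setT.
have sub_int (m1 m2 : {measure set (borel E) -> \bar R}) :
    (forall B : set (borel E), measurable B -> (m1 B <= m2 B)%E) ->
    m2.-integrable setT (EFin \o f) -> m1.-integrable setT (EFin \o f).
  move=> m12 /integrableP[_ fi]; apply/integrableP; split => //.
  by apply: le_lt_trans fi; exact: le_integral_set_function.
have ipos := sub_int _ _ posa ia.
have ineg := sub_int _ _ negb ib.
have : (\int[pos]_x (f x)%:E + \int[b]_x (f x)%:E =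
        \int[a]_x (f x)%:E + \int[neg]_x (f x)%:E)%E.
  rewrite -!integral_measure_add//; apply: eq_measure_integral => B mB _; exact: eqm.
have fin (m : {measure set (borel E) -> \bar R}) : m.-integrable setT (EFin \o f) ->
    (\int[m]_x (f x)%:E)%E = (\int[m]_x f x)%:E.
  by move=> im; rewrite fineK//; exact: integrable_fin_num.
rewrite !fin// -!EFinD => -[e].
have -> : integral_real nu setT f = \int[pos]_x f x - \int[neg]_x f x.
  by rewrite /integral_real -(funext posE) -(funext negE).
have aI : \int[a]_x f x = \int[lam]_x (f (p x) * u^\+ x).
  rewrite -(@Rintegral_density _ _ _ _ _ mup (funrpos_ge0 u) mP (fun X _ => mPE X) (f \o p))//; congr fine.
  by rewrite integral_pushforward// preimage_setT.
have bI : \int[b]_x f x = \int[lam]_x (f (p x) * u^\- x).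
  rewrite -(@Rintegral_density _ _ _ _ _ mun (funrneg_ge0 u) mN (fun X _ => mNE X) (f \o p))//; congr fine.
  by rewrite integral_pushforward// preimage_setT.
have -> : \int[lam]_x (f (p x) * u x) = \int[a]_x f x - \int[b]_x f x.
  rewrite aI bI -RintegralB//; apply: eq_Rintegral => x _.
  by rewrite -mulrBr -[in LHS](funrposBneg u).
lra.
Qed.

End represented_real_measure.

(** * Represented complex measures and their variation *)

Section represents.
Context d (T : measurableType d) (R : realType) (E : normedModType R).
Implicit Types (A B : set E) (mu : set E -> R[i]).

(* [mu] is the image under [p] of the complex measure [f lam]. *)
Definition represents (lam : {measure set T -> \bar R}) (p : T -> borel E)
    (f : T -> R[i]) mu : Prop :=
  [/\ measurable_fun setT p, cmeasurable f,
      forall B, bounded_borel B -> cintegrable lam (p @^-1` B) f &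
      forall B, mu B = if `[< bounded_borel B >] then Cint lam (p @^-1` B) f else 0].

Variables (lam : {measure set T -> \bar R}) (p : T -> borel E) (f : T -> R[i]).
Variable mu : set E -> R[i].
Hypothesis rep : represents lam p f mu.

Lemma represents_preimage A : measurable (A : set (borel E)) -> measurable (p @^-1` A).
Proof. by case: rep => mp _ _ _ mA; rewrite -[X in measurable X]setTI; exact: mp. Qed.

Lemma representsE B : bounded_borel B -> mu B = Cint lam (p @^-1` B) f.
Proof. by case: rep => _ _ _ -> bB; rewrite asboolT. Qed.

Lemma represents_radon : radon mu.
Proof.
case: rep => mp mf fi muE; split => [A nA|A bA tA bU]; first by rewrite muE asboolF.
under eq_fun do under eq_bigr do rewrite representsE//.
rewrite representsE// preimage_bigcup; apply: Cint_bigcup.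
- apply/trivIsetP => i j _ _ ij; rewrite -preimage_setI.
  by have /trivIsetP/(_ i j I I ij) -> := tA; rewrite preimage_set0.
- by move=> n; apply: represents_preimage; case: (bA n).
- by rewrite -preimage_bigcup; exact: fi.
Qed.

(** The product of the moduli dominates the four products of real and imaginary parts, so the real
    formula applies to each of them. *)
Lemma represents_integral A (phi : borel E -> R[i]) :
  measurable (A : set (borel E)) -> cmeasurable phi ->
  lam.-integrable (p @^-1` A) (EFin \o (fun x => abs1 (phi (p x)) * abs1 (f x))) ->
  integral_radon mu A phi = Cint lam (p @^-1` A) (fun x => phi (p x) * f x).
Proof.
case: rep => mp mf fi _ mA [phr phi_i] H.
have mpA := represents_preimage mA.
have mul (a : borel E -> R) (u : T -> R) : measurable_fun setT a ->
    measurable_fun setT u -> (forall x, `|a x| <= abs1 (phi x)) ->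
    (forall x, `|u x| <= abs1 (f x)) ->
    lam.-integrable (p @^-1` A) (EFin \o (fun x => a (p x) * u x)).
  move=> ma mu_ aphi uf; apply: (le_integrable mpA) H.
    apply/measurable_EFinP/measurable_funTS.
    by apply: measurable_funM => //; exact: measurableT_comp.
  move=> x _ /=; rewrite lee_fin [leRHS]ger0_norm ?mulr_ge0 ?abs1_ge0//.
  by rewrite normrM ler_pM.
have mre : measurable_fun setT (fun x => Re (f x)) by case: mf.
have mim : measurable_fun setT (fun x => Im (f x)) by case: mf.
have IR (a : borel E -> R) (u : T -> R) (nu : set E -> R) : measurable_fun setT a ->
    measurable_fun setT u -> (forall x, `|a x| <= abs1 (phi x)) ->
    (forall x, `|u x| <= abs1 (f x)) ->
    (forall B, bounded_borel B -> nu B = \int[lam]_(x in p @^-1` B) u x) ->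
    integral_real nu A a = \int[lam]_(x in p @^-1` A) (a (p x) * u x).
  move=> ma mu_ aphi uf nuE; apply: integral_real_represented => //; last exact: mul.
  move=> B bB; have [_ iB] := fi _ bB; apply: (le_integrable _ _ _ iB) => //.
  - by apply: represents_preimage; case: bB.
  - exact/measurable_EFinP/measurable_funTS.
  - by move=> x _ /=; rewrite lee_fin (ger0_norm (abs1_ge0 _)).
rewrite /integral_radon /Cint.
have Rphi x := ler_Re_abs1 (phi x); have Iphi x := ler_Im_abs1 (phi x).
have Rf x := ler_Re_abs1 (f x); have If x := ler_Im_abs1 (f x).
have muR B : bounded_borel B -> Re (mu B) = \int[lam]_(x in p @^-1` B) Re (f x).
  by move=> bB; rewrite representsE.
have muI B : bounded_borel B -> Im (mu B) = \int[lam]_(x in p @^-1` B) Im (f x).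
  by move=> bB; rewrite representsE.
rewrite (IR _ (fun x => Re (f x)))// (IR _ (fun x => Im (f x)))//.
rewrite (IR _ (fun x => Re (f x)))// (IR _ (fun x => Im (f x)))//.
congr (_ +i* _).
  rewrite -RintegralB//; [|exact: (mul (fun y => Re (phi y)))|exact: (mul (fun y => Im (phi y)))].
  by apply: eq_Rintegral => x _; rewrite cReM.
rewrite -RintegralD//; [|exact: (mul (fun y => Im (phi y)))|exact: (mul (fun y => Re (phi y)))].
by apply: eq_Rintegral => x _; rewrite cImM addrC mulrC [X in _ + X]mulrC; lra.
Qed.

(** Local boundedness of [phi] is enough, because a Radon measure is evaluated on bounded sets. *)
Lemma represents_density (phi : borel E -> R[i]) : cmeasurable phi ->
  (forall B, bounded_set B -> exists C : R, forall x, B x -> abs1 (phi x) <= C) ->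
  represents lam p (fun x => phi (p x) * f x) (radon_density phi mu).
Proof.
case: rep => mp mf fi muE mphi lb.
have mphip : cmeasurable (fun x => phi (p x)) by exact: cmeasurable_comp.
split => //; first exact: cmeasurableM.
  move=> B bB; have [C hC] := lb _ bB.1.
  apply: (@cintegrableM_bounded _ _ _ _ _ _ _ C) => //.
  - by apply: represents_preimage; case: bB.
  - by move=> x; exact: hC.
  - exact: fi.
move=> B; rewrite /radon_density; case: asboolP => // bB.
have [C hC] := lb _ bB.1; have mB := bB.2; have mpB := represents_preimage mB.
apply: represents_integral => //.
have [_ iB] := fi _ bB; apply: (le_integrable mpB) (integrableZl mpB C iB).
  apply/measurable_EFinP/measurable_funTS.
  by apply: measurable_funM; exact: measurable_abs1.
move=> x Bx /=; rewrite lee_fin !normrM ler_wpM2r// ger0_norm ?abs1_ge0//.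
by apply: le_trans (ler_norm _); exact: hC.
Qed.

End represents.

Section variation.
Context (R : realType) (E : normedModType R).
Implicit Types (A B : set E) (mu : set E -> R[i]).

Lemma normc_nneg (z : R[i]) : 0 <= normc z.
Proof. by case: z => a b; exact: sqrtr_ge0. Qed.

Lemma normc0 : normc (0 : R[i]) = 0.
Proof. by rewrite /= expr0n /= addr0 sqrtr0. Qed.

Lemma radon_set0 mu : radon mu -> mu set0 = 0.
Proof.
move=> [_ h]; have b0 := @bounded_borel0 R E.
have := h (fun _ => set0) (fun=> b0); rewrite bigcup0// => /(_ _ b0) c.
have /cvg_complexP[cr ci] : (\sum_(0 <= k < n) (mu set0 : R[i]^o)) @[n --> \oo] --> (mu set0 : R[i]^o).
  by apply: c; apply/trivIsetP => i j _ _ _; rewrite setI0.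
have sumRe n : Re (\sum_(0 <= k < n) mu set0) = \sum_(0 <= k < n) Re (mu set0).
  by elim: n => [|n IH]; [rewrite !big_geq|rewrite !big_nat_recr//= cReD IH].
have sumIm n : Im (\sum_(0 <= k < n) mu set0) = \sum_(0 <= k < n) Im (mu set0).
  by elim: n => [|n IH]; [rewrite !big_geq|rewrite !big_nat_recr//= cImD IH].
have z (a : R) : (\sum_(0 <= k < n) a) @[n --> \oo] --> a -> a = 0.
  move=> ca; have : (fun _ : nat => a) @ \oo --> (0 : R).
    by apply: cvg_series_cvg_0; apply/cvg_ex; eexists; exact: ca.
  by move=> /(cvg_unique (@Rhausdorff R) (cvg_cst _)).
apply: complex_eqP; apply: z.
  by under eq_fun do rewrite -sumRe.
by under eq_fun do rewrite -sumIm.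
Qed.

Lemma radon_variation_ge0 mu A : measurable (A : set (borel E)) ->
  (0 <= radon_variation mu A)%E.
Proof.
move=> mA; have [B [bB tB UB]] := bounded_borel_partition mA.
apply: (@le_trans _ _ (\sum_(0 <= n <oo) (normc (mu (B n)))%:E)%E).
  by apply: nneseries_ge0 => n _ _; rewrite lee_fin normc_nneg.
by apply: ereal_sup_ubound; exists B.
Qed.

Lemma radon_variation_le (m : {measure set (borel E) -> \bar R}) mu A :
  measurable (A : set (borel E)) ->
  (forall B, bounded_borel B -> ((normc (mu B))%:E <= m B)%E) ->
  (radon_variation mu A <= m A)%E.
Proof.
move=> mA h; apply: ge_ereal_sup => _ [B [bB tB <- ->]].
have mB n : measurable (B n : set (borel E)) by case: (bB n).
rewrite measure_semi_bigcup//; last exact: bigcupT_measurable.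
by apply: lee_nneseries => // n _; [rewrite lee_fin normc_nneg|exact: h].
Qed.

Lemma radon_variation_set0 mu : mu set0 = 0 -> radon_variation mu set0 = 0%E.
Proof.
move=> mu0; apply/eqP; rewrite eq_le radon_variation_ge0; last exact: measurable0.
rewrite andbT; apply: ge_ereal_sup => _ [B [bB tB B0 ->]].
rewrite eseries0// => n _ _.
have -> : B n = set0 by rewrite -subset0 -B0; exact: bigcup_sup.
by rewrite mu0 normc0.
Qed.

Lemma normc_le_variation mu A B : bounded_borel B -> B `<=` A ->
  measurable (A : set (borel E)) -> ((normc (mu B))%:E <= radon_variation mu A)%E.
Proof.
move=> bB BA mA.
have mAB : measurable (A `\` B : set (borel E)) by apply: measurableD => //; case: bB.
have [C [bC tC UC]] := bounded_borel_partition mAB.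
(* [B] followed by a partition of [A \ B] is a partition of [A], and [normc (mu B)] is the first
   term of its series. *)
pose D n := if n is n'.+1 then C n' else B.
apply: (@le_trans _ _ (\sum_(0 <= n <oo) (normc (mu (D n)))%:E)%E).
  apply: le_trans (nneseries_lim_ge 1%N _) => /=.
    by rewrite big_nat1.
  by move=> n _ _; rewrite lee_fin normc_nneg.
have CB n : C n `&` B = set0.
  apply/seteqP; split => // x [Cx Bx].
  have : (A `\` B) x by rewrite -UC; exists n.
  by case.
apply: ereal_sup_ubound; exists D; split => //.
- by case.
- apply/trivIsetP => -[|i] [|j] _ _ //= ij; rewrite ?CB// setIC ?CB//.
  by rewrite setIC; have /trivIsetP := tC; apply.
- rewrite -[RHS](setDUK BA) -UC; apply/seteqP; split => x.
    by move=> [[|n] _ /= h]; [left|right; exists n].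
  by move=> [h|[n _ h]]; [exists 0%N|exists n.+1].
Qed.

End variation.

Lemma measurable_weight d (T : measurableType d) (R : realType) (u : T -> R) N :
  measurable_fun setT u -> (forall x, 0 <= u x) ->
  measurable_fun setT (fun x => (1 + u x) ^- N).
Proof.
move=> mu u0; under eq_fun => x.
  rewrite -exprVn -powR_inv1; last by rewrite addr_ge0.
  over.
apply: measurable_funX; apply: (measurableT_comp (measurable_powR _)) => //.
exact: measurable_funD.
Qed.

Section represents_variation.
Context d (T : measurableType d) (R : realType) (E : normedModType R).
Variables (lam : {measure set T -> \bar R}) (p : T -> borel E) (f : T -> R[i]).
Variable mu : set E -> R[i].
Hypothesis rep : represents lam p f mu.

(** Cancellations under [p] can make the inequality strict; an upper bound is what slow growth and
    the location of the support call for. *)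
Lemma represents_variation_le A : measurable (A : set (borel E)) ->
  (radon_variation mu A <= \int[lam]_(x in p @^-1` A) (abs1 (f x))%:E)%E.
Proof.
case: (rep) => mp mf fi _ mA.
have [m mE] := density_measure lam (measurable_abs1 mf) (fun x => abs1_ge0 (f x)).
rewrite -mE; apply: (radon_variation_le (m := image_measure m mp)) => //.
move=> B bB; have mpB : measurable (p @^-1` B).
  by apply: (represents_preimage rep); case: bB.
apply: (@le_trans _ _ (abs1 (mu B))%:E); first by rewrite lee_fin normc_abs1.
rewrite (representsE rep)//.
apply: (@le_trans _ _ (\int[lam]_(x in p @^-1` B) abs1 (f x))%:E).
  by rewrite lee_fin; apply: abs1_Cint => //; exact: fi.
rewrite /Rintegral fineK -?mE//; rewrite mE.
by apply: integrable_fin_num => //; case: (fi _ bB).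
Qed.

Lemma represents_slow_growing (sq : E -> R) (N : nat) :
  measurable_fun setT (sq : borel E -> R) -> (forall x, 0 <= sq x) ->
  lam.-integrable setT (EFin \o (fun x => (1 + sq (p x)) ^- N * abs1 (f x))) ->
  slow_growing sq mu.
Proof.
move=> msq sq0 iw; have rmu := represents_radon rep; split => //=; exists N.
case: (rep) => mp mf fi _.
have [m mE] := density_measure lam (measurable_abs1 mf) (fun x => abs1_ge0 (f x)).
have mw : measurable_fun setT (fun x : borel E => (1 + sq x) ^- N) by exact: measurable_weight.
apply: (@le_lt_trans _ _ (\int[image_measure m mp]_x ((1 + sq x) ^- N)%:E)%E).
  apply: le_integral_set_function => //.
  - exact/radon_variation_set0/radon_set0.
  - by move=> A mA; apply: le_trans (represents_variation_le mA) _; rewrite -mE.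
  - by move=> x; rewrite lee_fin invr_ge0 exprn_ge0// addr_ge0.
rewrite integral_pushforward//; last 2 first.
- exact/measurable_EFinP.
- rewrite preimage_setT; apply: (@integrable_density _ _ _ _ _ (measurable_abs1 mf)
    (fun x => abs1_ge0 (f x)) m (fun X _ => mE X) (fun x => (1 + sq (p x)) ^- N)) => //.
  exact: (measurableT_comp mw).
rewrite preimage_setT (@ge0_integral_density _ _ _ _ _ (measurable_abs1 mf) (fun x => abs1_ge0 (f x)) m (fun X _ => mE X))//.
- exact: integrable_lty.
- by apply/measurable_EFinP; exact: (measurableT_comp mw).
- by move=> x /=; rewrite lee_fin invr_ge0 exprn_ge0// addr_ge0.
Qed.

End represents_variation.

(** * Disjoint unions; every Radon measure is represented *)

Section glue.
Context d1 d2 (T1 : measurableType d1) (T2 : measurableType d2) (R : realType).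

(* [T1 * T2 * bool] plays the role of the disjoint union of T1 and T2: the
   glued measure is carried by the slices [(T1, point, true)] and [(point, T2, false)]. *)
Definition glue (X : Type) (f1 : T1 -> X) (f2 : T2 -> X) (x : T1 * T2 * bool) : X :=
  if x.2 then f1 x.1.1 else f2 x.1.2.

Let in1 (x : T1) : T1 * T2 * bool := (x, point, true).
Let in2 (x : T2) : T1 * T2 * bool := (point, x, false).

Let min1 : measurable_fun setT in1.
Proof. by apply: measurable_fun_pair => //; exact: measurable_fun_pair. Qed.

Let min2 : measurable_fun setT in2.
Proof. by apply: measurable_fun_pair => //; exact: measurable_fun_pair. Qed.

Lemma measurable_glue d (X : measurableType d) (f1 : T1 -> X) (f2 : T2 -> X) :
  measurable_fun setT f1 -> measurable_fun setT f2 -> measurable_fun setT (glue f1 f2).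
Proof.
move=> m1 m2; apply: measurable_fun_ifT => //.
- by apply: (measurableT_comp m1); exact: measurableT_comp.
- by apply: (measurableT_comp m2); exact: measurableT_comp.
Qed.

Lemma cmeasurable_glue (f1 : T1 -> R[i]) (f2 : T2 -> R[i]) :
  cmeasurable f1 -> cmeasurable f2 -> cmeasurable (glue f1 f2).
Proof.
move=> [r1 i1] [r2 i2]; split.
  rewrite (_ : (fun x => _) = glue (fun x => Re (f1 x)) (fun x => Re (f2 x))).
    exact: measurable_glue.
  by apply/funext => -[? []].
rewrite (_ : (fun x => _) = glue (fun x => Im (f1 x)) (fun x => Im (f2 x))).
  exact: measurable_glue.
by apply/funext => -[? []].
Qed.

Variables (lam1 : {sigma_finite_measure set T1 -> \bar R})
  (lam2 : {sigma_finite_measure set T2 -> \bar R}).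

Let lam : {measure set (T1 * T2 * bool) -> \bar R} :=
  measure_add (image_measure lam1 min1) (image_measure lam2 min2).

Let lamE A : lam A = (lam1 (in1 @^-1` A) + lam2 (in2 @^-1` A))%E.
Proof. exact: measure_addE. Qed.

Let lam_sigma_finite : sigma_finite setT lam.
Proof.
have [F1 U1 F1P] := sigma_finiteT lam1; have [F2 U2 F2P] := sigma_finiteT lam2.
pose F n : set (T1 * T2 * bool) := ((fun x => x.1.1) @^-1` F1 n `&` snd @^-1` [set true])
  `|` ((fun x => x.1.2) @^-1` F2 n `&` snd @^-1` [set false]).
exists F.
  apply/esym/seteqP; split => // -[[x y] b] _.
  case: b.
    by have : setT x by []; rewrite U1 => -[n _ Fx]; exists n => //; left.
  by have : setT y by []; rewrite U2 => -[n _ Fx]; exists n => //; right.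
move=> n; have [mF1 fF1] := F1P n; have [mF2 fF2] := F2P n; split.
  apply: measurableU; apply: measurableI.
  - rewrite -[X in measurable X]setTI.
    by apply: (measurableT_comp (f := fst) (g := fst)).
  - by rewrite -[X in measurable X]setTI; exact: measurable_snd.
  - rewrite -[X in measurable X]setTI.
    by apply: (measurableT_comp (f := snd) (g := fst)).
  - by rewrite -[X in measurable X]setTI; exact: measurable_snd.
rewrite lamE; apply: lte_add_pinfty.
  by rewrite (_ : _ @^-1` _ = F1 n)//; apply/seteqP; split => x; [move=> [[]//|[]]//|by left].
by rewrite (_ : _ @^-1` _ = F2 n)//; apply/seteqP; split => x; [move=> [[]//|[]]//|by right].
Qed.

Definition glue_measure : {sigma_finite_measure set (T1 * T2 * bool)%type -> \bar R} :=
  HB.pack (Measure.sort lam) (Measure.class lam) (Measure_isSigmaFinite.Build _ (T1 * T2 * bool)%type R lam lam_sigma_finite).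

Lemma ge0_integral_glue (f1 : T1 -> \bar R) (f2 : T2 -> \bar R) :
  measurable_fun setT f1 -> measurable_fun setT f2 ->
  (forall x, 0 <= f1 x)%E -> (forall x, 0 <= f2 x)%E ->
  (\int[glue_measure]_x (glue f1 f2 x) = \int[lam1]_x f1 x + \int[lam2]_x f2 x)%E.
Proof.
move=> m1 m2 f10 f20; have mg := measurable_glue m1 m2.
have g0 x : (0 <= glue f1 f2 x)%E by rewrite /glue; case: ifP.
transitivity (\int[image_measure lam1 min1]_x (glue f1 f2 x) +
  \int[image_measure lam2 min2]_x (glue f1 f2 x))%E.
  by rewrite -ge0_integral_measure_add.
by rewrite !ge0_integral_pushforward// !preimage_setT.
Qed.

Lemma cintegrable_glue (f1 : T1 -> R[i]) (f2 : T2 -> R[i])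
    (E : Type) (p1 : T1 -> E) (p2 : T2 -> E) (B : set E) :
  measurable (p1 @^-1` B) -> measurable (p2 @^-1` B) ->
  cintegrable lam1 (p1 @^-1` B) f1 -> cintegrable lam2 (p2 @^-1` B) f2 ->
  cintegrable glue_measure (glue p1 p2 @^-1` B) (glue f1 f2) /\
  Cint glue_measure (glue p1 p2 @^-1` B) (glue f1 f2) =
    Cint lam1 (p1 @^-1` B) f1 + Cint lam2 (p2 @^-1` B) f2.
Proof.
move=> mB1 mB2 i1 i2.
have mB : measurable (glue p1 p2 @^-1` B).
  rewrite (_ : _ @^-1` _ = ((fun x => x.1.1) @^-1` (p1 @^-1` B) `&` snd @^-1` [set true])
    `|` ((fun x => x.1.2) @^-1` (p2 @^-1` B) `&` snd @^-1` [set false])); last first.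
    apply/seteqP; split => -[[x y] []]; rewrite /glue /=; by [left|right|move=> [[]|[]]].
  apply: measurableU; apply: measurableI.
  - rewrite -[X in measurable X]setTI.
    by apply: (measurableT_comp (f := fst) (g := fst)).
  - by rewrite -[X in measurable X]setTI; exact: measurable_snd.
  - rewrite -[X in measurable X]setTI.
    by apply: (measurableT_comp (f := snd) (g := fst)).
  - by rewrite -[X in measurable X]setTI; exact: measurable_snd.
have [mf1 _] := i1; have [mf2 _] := i2.
have mf := cmeasurable_glue mf1 mf2.
(* One real statement serves for [abs1], [Re] and [Im]. *)
have H (h : R[i] -> R) (h0 : h 0 = 0) :
    measurable_fun setT (fun x => h (f1 x)) -> measurable_fun setT (fun x => h (f2 x)) ->
    lam1.-integrable (p1 @^-1` B) (EFin \o (fun x => h (f1 x))) ->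
    lam2.-integrable (p2 @^-1` B) (EFin \o (fun x => h (f2 x))) ->
    glue_measure.-integrable (glue p1 p2 @^-1` B) (EFin \o (fun x => h (glue f1 f2 x))) /\
    \int[glue_measure]_(x in glue p1 p2 @^-1` B) h (glue f1 f2 x) =
    \int[lam1]_(x in p1 @^-1` B) h (f1 x) + \int[lam2]_(x in p2 @^-1` B) h (f2 x).
  move=> m1 m2 j1 j2.
  have mh : measurable_fun setT (fun x => h (glue f1 f2 x)).
    rewrite (_ : (fun x => _) = glue (fun x => h (f1 x)) (fun x => h (f2 x))).
      exact: measurable_glue.
    by apply/funext => -[? []].
  have mhE : measurable_fun setT (EFin \o (fun x => h (glue f1 f2 x))) by exact/measurable_EFinP.
  have k1 : (image_measure lam1 min1).-integrable (glue p1 p2 @^-1` B)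
      (EFin \o (fun x => h (glue f1 f2 x))) by exact: integrable_pushforward.
  have k2 : (image_measure lam2 min2).-integrable (glue p1 p2 @^-1` B)
      (EFin \o (fun x => h (glue f1 f2 x))) by exact: integrable_pushforward.
  split.
    apply/integrableP; split; first exact: measurable_funTS.
    rewrite ge0_integral_measure_add//; last first.
      by apply: measurableT_comp => //; exact: measurable_funTS.
    by apply: lte_add_pinfty; [case/integrableP: k1|case/integrableP: k2].
  rewrite -fineD; last 2 first.
  - exact: integrable_fin_num.
  - exact: integrable_fin_num.
  congr fine; transitivity
    (\int[image_measure lam1 min1]_(x in glue p1 p2 @^-1` B) (h (glue f1 f2 x))%:E +
     \int[image_measure lam2 min2]_(x in glue p1 p2 @^-1` B) (h (glue f1 f2 x))%:E)%E.
    by rewrite -integral_measure_add//; exact: measurable_funTS.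
  by rewrite !integral_pushforward.
have [r1 im1] := cintegrable_ReIm mB1 i1; have [r2 im2] := cintegrable_ReIm mB2 i2.
split.
  split => //; apply: (H _ _ _ _ _ _).1.
  - by rewrite /abs1 /= normr0 addr0.
  - exact: measurable_abs1.
  - exact: measurable_abs1.
  - by case: i1.
  - by case: i2.
have [_ e1] := H (@complex.Re R) erefl mf1.1 mf2.1 r1 r2.
have [_ e2] := H (@complex.Im R) erefl mf1.2 mf2.2 im1 im2.
by rewrite /Cint e1 e2.
Qed.

(** With one of the two measures equal to zero, this moves a representation to a larger base space,
    so that two measures come to share the same [lam]. *)
Lemma represents_glue (E : normedModType R) (p1 : T1 -> borel E) (p2 : T2 -> borel E)
    (f1 : T1 -> R[i]) (f2 : T2 -> R[i]) (mu1 mu2 mu : set E -> R[i]) :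
  represents lam1 p1 f1 mu1 -> represents lam2 p2 f2 mu2 ->
  (forall B, mu B = mu1 B + mu2 B) ->
  represents glue_measure (glue p1 p2) (glue f1 f2) mu.
Proof.
move=> rep1 rep2 muE.
have [mp1 mf1 if1 muE1] := rep1; have [mp2 mf2 if2 muE2] := rep2.
have CB B : bounded_borel B -> _ := fun bB => cintegrable_glue
  (represents_preimage rep1 bB.2) (represents_preimage rep2 bB.2) (if1 B bB) (if2 B bB).
split => //.
- exact: measurable_glue.
- exact: cmeasurable_glue.
- by move=> B /CB[].
- move=> B; rewrite muE muE1 muE2; case: asboolP => [/CB[_ ->]//|_].
  by rewrite addr0.
Qed.

End glue.

Section radon_represented.
Context (R : realType) (E : normedModType R).
Implicit Types (A B : set E) (mu : set E -> R[i]).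

(** The last clause transports finiteness of weighted integrals instead of an inequality between
    measures. It survives the addition of representations without any factor to keep track of. *)
Definition dominated_representation (v : set (borel E) -> \bar R) mu : Prop :=
  exists d (T : measurableType d) (lam : {sigma_finite_measure set T -> \bar R})
    (p : T -> borel E) (f : T -> R[i]),
  [/\ represents lam p f mu, forall x, abs1 (f x) <= 1 &
      forall w : borel E -> R, measurable_fun setT w -> (forall x, 0 <= w x) ->
        (\int[v]_x (w x)%:E < +oo)%E -> (\int[lam]_x (w (p x))%:E < +oo)%E].

Lemma dominated_representation_add v mu1 mu2 mu :
  dominated_representation v mu1 -> dominated_representation v mu2 ->
  (forall B, mu B = mu1 B + mu2 B) -> dominated_representation v mu.
Proof.
move=> [d1 [T1 [l1 [p1 [f1 [rep1 f11 w1]]]]]] [d2 [T2 [l2 [p2 [f2 [rep2 f21 w2]]]]]] muE.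
exists _, _, (glue_measure l1 l2), (glue p1 p2), (glue f1 f2); split.
- exact: (represents_glue rep1 rep2).
- by move=> x; rewrite /glue; case: ifP.
- move=> w mw w0 vw; have [mp1 _ _ _] := rep1; have [mp2 _ _ _] := rep2.
  rewrite (_ : (fun x => _) = glue (fun x => (w (p1 x))%:E) (fun x => (w (p2 x))%:E)).
    rewrite ge0_integral_glue//.
    + by apply: lte_add_pinfty; [exact: w1|exact: w2].
    + by apply/measurable_EFinP; exact: (measurableT_comp mw).
    + by apply/measurable_EFinP; exact: (measurableT_comp mw).
    + by move=> x; rewrite lee_fin.
    + by move=> x; rewrite lee_fin.
  by apply/funext => -[? []].
Qed.

Lemma dominated_representation_positive v (m : {measure set (borel E) -> \bar R}) (c : R[i]) mu :
  v set0 = 0%E -> (forall A, measurable (A : set (borel E)) -> (m A <= v A)%E) ->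
  (forall B, bounded_borel B -> m B \is a fin_num) -> abs1 c <= 1 ->
  (forall B, mu B = if `[< bounded_borel B >] then (fine (m B))%:C * c else 0) ->
  dominated_representation v mu.
Proof.
move=> v0 mv mfin c1 muE.
have msf : sigma_finite setT m.
  exists (@nball R E); first by rewrite bigcup_nball.
  move=> n; split; first exact: measurable_nball.
  by rewrite ltey_eq mfin//; exact: bounded_borel_nball.
(* the image by [id] only serves to give HB.pack a transparent set function *)
pose im : {measure set (borel E) -> \bar R} := image_measure m (@measurable_id _ (borel E) setT).
pose ms : {sigma_finite_measure set (borel E) -> \bar R} :=
  HB.pack (Measure.sort im) (Measure.class im) (Measure_isSigmaFinite.Build _ (borel E) R im msf).
exists _, (borel E), ms, id, (fun _ => c); split => //.
  split.
  - exact: measurable_id.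
  - exact: cmeasurable_cst.
  - move=> B bB; split; first exact: cmeasurable_cst.
    apply: measurable_bounded_integrable => //.
    + by case: bB.
    + by rewrite ltey_eq mfin.
    + exists (abs1 c); split; first exact: num_real.
      by move=> x /ltW h y _; rewrite /= ger0_norm ?abs1_ge0.
  - move=> B; rewrite muE; case: asboolP => // bB; have mB := bB.2.
    rewrite preimage_id /Cint !Rintegral_cst//.
    by apply: complex_eqP; rewrite ?cReM ?cImM /= ?mul0r ?subr0 ?addr0 mulrC.
move=> w mw w0; apply: le_lt_trans; exact: le_integral_set_function.
Qed.

Lemma radon_Re mu : radon mu -> real_radon (fun B => Re (mu B)).
Proof.
move=> [_ sig] A bA tA bU; have /cvg_complexP[c _] := sig _ bA tA bU.
apply: cvg_trans c; apply: near_eq_cvg; apply: nearW => n.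
by elim: n => [|n IH]; [rewrite !big_geq|rewrite !big_nat_recr//= cReD IH].
Qed.

Lemma radon_Im mu : radon mu -> real_radon (fun B => Im (mu B)).
Proof.
move=> [_ sig] A bA tA bU; have /cvg_complexP[_ c] := sig _ bA tA bU.
apply: cvg_trans c; apply: near_eq_cvg; apply: nearW => n.
by elim: n => [|n IH]; [rewrite !big_geq|rewrite !big_nat_recr//= cImD IH].
Qed.

(** The Jordan parts of [Re mu] and [Im mu], with the constant densities [1], [-1], [i], [-i], are
    placed on four disjoint copies of the space; each part is at most the variation. This takes the
    place of a polar decomposition. *)
Lemma radon_dominated_representation mu : radon mu ->
  dominated_representation (radon_variation mu) mu.
Proof.
move=> rmu; have [mu0 sig] := rmu.
have rr := radon_Re rmu; have ri := radon_Im rmu.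
have v0 := radon_variation_set0 (radon_set0 rmu).
have key (h : set E -> R) c : real_radon h -> (forall B, h B <= normc (mu B)) ->
    abs1 c <= 1 -> dominated_representation (radon_variation mu)
      (fun B => if `[< bounded_borel B >] then (fine (positive_variation h B))%:C * c else 0).
  move=> rh hmu c1; have [m mE] := positive_variation_measure rh.
  apply: (@dominated_representation_positive _ m c) => //.
  - move=> A mA; rewrite mE; apply: ge_ereal_sup => _ [B [bB BA] <-].
    by apply: le_trans (normc_le_variation mu bB BA mA); rewrite lee_fin.
  - by move=> B bB; rewrite mE; exact: positive_variation_fin.
  - by move=> B; rewrite mE.
have n1 : abs1 (1 : R[i]) <= 1 by rewrite /abs1 /= normr1 normr0 addr0.
have nN1 : abs1 (- 1 : R[i]) <= 1 by rewrite abs1N.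
have ni : abs1 (0 +i* 1 : R[i]) <= 1 by rewrite /abs1 /= normr1 normr0 add0r.
have nNi : abs1 (0 +i* (- 1) : R[i]) <= 1 by rewrite /abs1 /= normrN1 normr0 add0r.
have lerN_norm (x : R) : - x <= `|x| by rewrite -normrN ler_norm.
have K1 := key _ _ rr (fun B => le_trans (ler_norm _) (Re_normc (mu B))) n1.
have K2 := key _ _ (real_radonN rr) (fun B => le_trans (lerN_norm _) (Re_normc (mu B))) nN1.
have K3 := key _ _ ri (fun B => le_trans (ler_norm _) (Im_normc (mu B))) ni.
have K4 := key _ _ (real_radonN ri) (fun B => le_trans (lerN_norm _) (Im_normc (mu B))) nNi.
apply: (dominated_representation_add
  (dominated_representation_add K1 K2 (fun B => erefl))
  (dominated_representation_add K3 K4 (fun B => erefl))) => B /=.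
case: asboolP => [bB|/mu0 ->]; last by rewrite !addr0.
have dec h : real_radon h -> h B = fine (positive_variation h B) -
    fine (positive_variation (fun A => - h A) B).
  move=> rh; rewrite [in RHS]positive_variation_decomp// fineD//=; last first.
    by apply: positive_variation_fin => //; exact: real_radonN.
  by rewrite addrK.
apply: complex_eqP; rewrite ?cReD ?cImD ?cReM ?cImM /=.
  by rewrite (dec _ rr); ring.
by rewrite (dec _ ri); ring.
Qed.

End radon_represented.

(** * Countable covers by balls and determination of a measure *)

Section borel_continuous.
Context (R : realType) (E : normedModType R).

Lemma continuous_borel_measurable (f : E -> R) : continuous (f : E -> R^o) ->
  measurable_fun setT (f : borel E -> R).
Proof.
move=> cf; apply: (measurability (@RGenOInfty.G R) (RGenOInfty.measurableE R)).
move=> _ [_ [x ->] <-]; rewrite setTI; apply: borel_open.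
by apply: open_comp => // y _; exact: cf.
Qed.

Lemma continuous_cmeasurable (f : E -> R[i]) : continuous (f : E -> R[i]^o) ->
  cmeasurable (f : borel E -> R[i]).
Proof.
move=> cf; split; apply: continuous_borel_measurable => x;
  by have /cvg_complexP[] := cf x.
Qed.

End borel_continuous.

Section dense_sequence.
Context (R : realType) (E : normedModType R) (e : nat -> E).
Hypothesis dense_e : forall x (r : R), 0 < r -> exists n, ball x r (e n).

(** Lindelof covering for a local property [P]. With inclusion in [U] for [P] it writes open sets as
    countable unions of balls; with nullity of all bounded Borel subsets it shows that a measure
    vanishes off its support. Balls of the countable base without [P] are replaced by the empty
    set. *)
Lemma lindelof_balls (U : set E) (P : set E -> Prop) :
  (forall A B, A `<=` B -> P B -> P A) ->
  (forall x, U x -> exists r : R, 0 < r /\ P (ball x r)) ->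
  exists F : nat -> set E,
  (forall n, F n = set0 \/ exists x r, [/\ 0 < r, F n = ball x r & P (F n)]) /\
  U `<=` \bigcup_n F n.
Proof.
move=> PS UP.
pose V (k : nat * nat) := ball (e k.1) (k.2.+1%:R^-1 : R).
pose W k := if `[< P (V k) >] then V k else set0.
exists (fun n => if unpickle n is Some k then W k else set0); split.
  move=> n; case: (unpickle n) => [k|]; last by left.
  rewrite /W; case: asboolP => PV; [right|by left].
  by exists (e k.1), k.2.+1%:R^-1; rewrite invr_gt0 ltr0n.
move=> x /UP[r [r0 rP]].
(* A ball of radius below [r / 2] that contains [x] lies in [ball x r]. *)
have r20 : 0 < r / 2 by rewrite divr_gt0.
have [k hk] : exists k : nat, k.+1%:R^-1 < r / 2.
  exists (Num.trunc ((r / 2)^-1)); rewrite invf_plt ?posrE ?ltr0n//.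
  exact: truncnS_gt.
have k0 : 0 < k.+1%:R^-1 :> R by rewrite invr_gt0 ltr0n.
have [n xn] := dense_e x k0.
exists (pickle (n, k)) => //; rewrite pickleK /W asboolT.
  exact: ball_sym.
apply: PS rP => y Vy; rewrite [r]splitr; apply: (@ball_triangle _ _ (e n)).
  by apply: le_ball xn; exact: ltW.
by apply: le_ball Vy; exact: ltW.
Qed.

Lemma open_bigcup_balls (U : set E) : open U -> exists F : nat -> set E,
  (forall n, F n = set0 \/ exists x r, 0 < r /\ F n = ball x r) /\ U = \bigcup_n F n.
Proof.
move=> oU; have [||F [FE UF]] := @lindelof_balls U (fun A => A `<=` U).
- by move=> A B AB; exact: subset_trans.
- move=> x Ux; have /nbhs_ballP[r /= r0 rU] : nbhs x U by exact: open_nbhs_nbhs.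
  by exists r.
exists F; split.
  by move=> n; have [->|[x [r [r0 -> _]]]] := FE n; [left|right; exists x, r].
apply/seteqP; split => // x [n _].
by have [->|[y [r [r0 _ FU]]]] := FE n => // /FU.
Qed.

(** By separability an open set is a countable union of balls, and these belong to [G]. *)
Lemma borel_generated_by (G : set (set E)) :
  (forall A, G A -> open A) -> (forall x r, 0 < r -> G (ball x r)) ->
  measurable = <<s G >> :> set (set (borel E)).
Proof.
move=> Gop Gball; apply/seteqP; split.
  apply: smallest_sub; first exact: smallest_sigma_algebra.
  move=> U oU; have [F [FE ->]] := open_bigcup_balls oU.
  have [s0 sD sU] := smallest_sigma_algebra (setT : set E) G.
  apply: sU => n; have [->|[x [r [r0 ->]]]] := FE n; first exact: s0.
  by apply: sub_sigma_algebra; exact: Gball.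
by apply: sub_smallest2r => // A /Gop oA; exact: borel_open.
Qed.

(** The two Jordan parts agree on the intersection-stable class [G] and are finite on the balls
    around 0, which belong to [G] and exhaust the space. Uniqueness of measures makes them equal. *)
Lemma radon_ext0 (G : set (set E)) (mu : set E -> R[i]) :
  (forall A, G A -> open A) -> (forall x r, 0 < r -> G (ball x r)) ->
  setI_closed G -> (forall A, G A -> bounded_set A) ->
  radon mu -> (forall A, G A -> mu A = 0) -> forall A, mu A = 0.
Proof.
move=> Gop Gball GI Gbd rmu muG.
have real0 (h : set E -> R) : real_radon h -> (forall A, G A -> h A = 0) ->
    forall A, bounded_borel A -> h A = 0.
  move=> rh hG A bA.
  have [m1 m1E] := positive_variation_measure rh.
  have [m2 m2E] := positive_variation_measure (real_radonN rh).
  have bG B : G B -> bounded_borel B.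
    by move=> GB; split; [exact: Gbd|apply: borel_open; exact: Gop].
  have eqG B : G B -> m1 B = m2 B.
    move=> GB; rewrite m1E m2E positive_variation_decomp//; last exact: bG.
    by rewrite hG// add0e.
  have := @measure_unique _ R (borel E) G (fun k => ball (0 : E) k.+1%:R)
    (borel_generated_by Gop Gball) GI.
  move=> /(_ _ _ m1 m2 eqG _ A bA.2) e12.
  have m12 : m1 A = m2 A.
    apply: e12.
    - by move=> i; apply: Gball; rewrite ltr0n.
    - apply/seteqP; split => // x _; have : (\bigcup_n @nball R E n) x by rewrite bigcup_nball.
      move=> [n _ nx]; exists n => //; rewrite -nballE.
      by apply: lt_trans nx _; rewrite ltr_nat.
    - move=> k; rewrite m1E ltey_eq positive_variation_fin//.
      by apply: bG; apply: Gball; rewrite ltr0n.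
  move: m12; rewrite m1E m2E positive_variation_decomp//.
  have /fineK <- := positive_variation_fin (real_radonN rh) bA.
  by rewrite -EFinD => -[]; lra.
have [mu0 sig] := rmu.
have rr : real_radon (fun B => Re (mu B)) by exact: radon_Re.
have ri : real_radon (fun B => Im (mu B)) by exact: radon_Im.
move=> A; have [bA|nA] := pselect (bounded_borel A); last by rewrite mu0.
apply: complex_eqP.
  by apply: (real0 (fun B => Re (mu B))) => // B GB; rewrite muG.
by apply: (real0 (fun B => Im (mu B))) => // B GB; rewrite muG.
Qed.

(** Every point of [A] has a ball whose bounded Borel subsets are all null. Countably many of these
    balls cover [A], and sigma-additivity applies after making them disjoint. *)
Lemma radon_null_outside_support (mu : set E -> R[i]) A : radon mu ->
  bounded_borel A -> A `&` radon_support mu = set0 -> mu A = 0.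
Proof.
move=> rmu bA A0.
have [||F [FE AF]] := @lindelof_balls A
    (fun U => forall B, bounded_borel B -> B `<=` U -> mu B = 0).
- by move=> U V UV h B bB BU; apply: h => //; exact: subset_trans UV.
- move=> x Ax; have : ~ radon_support mu x.
    by move=> sx; have : (A `&` radon_support mu) x by []; rewrite A0.
  move=> /existsNP[U /not_implyP[oU /not_implyP[Ux /negP/negPn/eqP vU]]].
  have /nbhs_ballP[r /= r0 rU] : nbhs x U by exact: open_nbhs_nbhs.
  exists r; split => // B bB Br.
  have := normc_le_variation mu bB (subset_trans Br rU) (borel_open oU).
  rewrite vU lee_fin => h; have {}h : normc (mu B) = 0.
    by apply/eqP; rewrite eq_le h normc_nneg.
  by apply: complex_eqP; apply/eqP; rewrite -normr_le0 -h ?Re_normc ?Im_normc.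
have mF n : measurable (F n : set (borel E)).
  have [->|[x [r [r0 -> _]]]] := FE n; first exact: measurable0.
  by apply: borel_open; exact: ball_open.
have bD n : bounded_borel (A `&` seqDU F n).
  apply: bounded_borelIr => //; apply: measurableD => //.
  by apply: bigsetU_measurable.
have [_ sig] := rmu; have := sig (fun n => A `&` seqDU F n) bD.
have eA : \bigcup_n (A `&` seqDU F n) = A.
  by rewrite -setI_bigcupr -seqDU_bigcup_eq; exact/setIidl.
have tD : trivIset setT (fun n => A `&` seqDU F n).
  by apply: trivIset_setIl; exact: trivIset_seqDU.
rewrite eA => /(_ tD bA) c.
have z n : mu (A `&` seqDU F n) = 0.
  have sF : A `&` seqDU F n `<=` F n by move=> x [_ []].
  have [F0|[x [r [r0 Fr PF]]]] := FE n; last by exact: PF.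
  rewrite (_ : _ `&` _ = set0); first exact: radon_set0.
  by rewrite -subset0 -F0.
have /cvg_complexP[cr ci] := c.
apply: complex_eqP.
  apply: (cvg_unique (@Rhausdorff R) cr); apply: cvg_near_cst.
  by apply: nearW => n; rewrite big1.
apply: (cvg_unique (@Rhausdorff R) ci); apply: cvg_near_cst.
by apply: nearW => n; rewrite big1.
Qed.

End dense_sequence.

(** * Topology and Borel sets of space and space-time *)

Section space_and_spacetime.
Context (R : realType) (d : nat).
Local Notation space := 'rV[R]_d.
Local Notation spacetime := ((('rV[R]_d * R^o)%type : normedModType R)).

Definition rational_point (n : nat) : space :=
  if unpickle n is Some q then map_mx ratr (q : 'rV[rat]_d) else 0.

Lemma rational_point_dense (x : space) (r : R) : 0 < r ->
  exists n, ball x r (rational_point n).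
Proof.
move=> r0.
have h i : {q : rat | `|x ord0 i - ratr q| < r}.
  apply/cid; have [q] := @rat_in_itvoo R (x ord0 i - r) (x ord0 i + r) ltac:(lra).
  by rewrite in_itv /= => /andP[h1 h2]; exists q; rewrite ltr_distlC h1.
exists (pickle (\row_i sval (h i))); rewrite /rational_point pickleK.
split => // i j; rewrite !mxE (ord1 i) -ball_normE /=; exact: (svalP (h j)).
Qed.

Definition rational_event (n : nat) : spacetime :=
  if unpickle n is Some (i, q) then (rational_point i, ratr (q : rat)) else 0.

Lemma rational_event_dense (z : spacetime) (r : R) : 0 < r ->
  exists n, ball z r (rational_event n).
Proof.
move=> r0; have [i hi] := rational_point_dense z.1 r0.
have [q] := @rat_in_itvoo R (z.2 - r) (z.2 + r) ltac:(lra).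
rewrite in_itv /= => /andP[h1 h2].
exists (pickle (i, q)); rewrite /rational_event pickleK; split => //=.
by rewrite -ball_normE /= ltr_distlC h1.
Qed.

Definition box (l u : space) : set space :=
  [set x | forall i, l ord0 i < x ord0 i < u ord0 i].

(** Boxes include the balls of the max norm, are stable under intersection, and are the positivity
    sets of products of bumps. So they serve both to determine a measure and to be approximated by
    smooth functions. *)
Definition boxes : set (set space) := [set A | exists l u, A = box l u].

Lemma open_box l u : open (box l u).
Proof.
rewrite openE => x xlu.
change (\forall y \near x, forall i, l ord0 i < (y : space) ord0 i < u ord0 i).
apply: (@filter_forall space 'I_d
  (fun i => [set y : space | l ord0 i < y ord0 i < u ord0 i]) (nbhs x) _) => i.
have : \forall t \near x ord0 i, t \in `]l ord0 i, u ord0 i[.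
  by apply: near_in_itvoo; rewrite in_itv /=; exact: xlu.
have c : (fun y : space => y ord0 i) @ x --> x ord0 i.
  exact: (@coord_continuous R 1 d ord0 i x).
move=> /c h; apply: (@filterS space (nbhs x) _ _ _ _ h) => y.
by rewrite /= in_itv.
Qed.

Lemma coord_le_norm (x : space) i : `|x ord0 i| <= `|x|.
Proof.
rewrite (_ : `|x| = mx_norm x)// mx_normrE.
exact: (le_bigmax _ (fun ij : 'I_1 * 'I_d => `|x ij.1 ij.2|) (ord0, i)).
Qed.

Lemma norm_le_coord (x : space) M : 0 <= M -> (forall i, `|x ord0 i| <= M) -> `|x| <= M.
Proof.
move=> M0 h; rewrite (_ : `|x| = mx_norm x)// mx_normrE.
by apply: bigmax_le => // -[i j] _ /=; rewrite (ord1 i).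
Qed.

Lemma boxes_open A : boxes A -> open A.
Proof. by move=> [l [u ->]]; exact: open_box. Qed.

Lemma box_bounded l u : bounded_set (box l u).
Proof.
apply/bounded_setP; exists (`|l| + `|u|) => x xlu.
apply: norm_le_coord => [|i]; first by rewrite addr_ge0.
have := xlu i; have := coord_le_norm l i; have := coord_le_norm u i.
rewrite !ler_norml => /andP[u1 u2] /andP[l1 l2] /andP[x1 x2].
have := normr_ge0 l; have := normr_ge0 u; lra.
Qed.

Lemma boxes_ball (x : space) r : 0 < r -> boxes (ball x r).
Proof.
move=> r0; exists (\row_i (x ord0 i - r)), (\row_i (x ord0 i + r)).
apply/seteqP; split => y.
  move=> [_ h] i; rewrite !mxE -ltr_distl distrC.
  by have := h ord0 i; rewrite -ball_normE.
move=> h; split => // i j; rewrite (ord1 i) -ball_normE /= distrC ltr_distl.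
by have := h j; rewrite !mxE.
Qed.

Lemma boxes_setI : setI_closed boxes.
Proof.
move=> _ _ [l [u ->]] [l' [u' ->]].
exists (\row_i Num.max (l ord0 i) (l' ord0 i)), (\row_i Num.min (u ord0 i) (u' ord0 i)).
apply/seteqP; split => x.
  move=> [h h'] i; rewrite !mxE gt_max lt_min.
  by have /andP[-> ->] := h i; have /andP[-> ->] := h' i.
move=> h; split => i; have := h i; rewrite !mxE gt_max lt_min.
  by move=> /andP[/andP[-> _] /andP[-> _]].
by move=> /andP[/andP[_ ->] /andP[_ ->]].
Qed.

Definition spacetime_boxes : set (set spacetime) :=
  [set A | exists l u a b, A = box l u `*` `]a, b[%classic].

Lemma spacetime_boxes_open A : spacetime_boxes A -> open A.
Proof.
move=> [l [u [a [b ->]]]].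
rewrite (_ : _ `*` _ = fst @^-1` box l u `&` snd @^-1` `]a, b[%classic)//.
apply: openI.
  by apply: open_comp => [z _|]; [exact: cvg_fst|exact: open_box].
by apply: open_comp => [z _|]; [exact: cvg_snd|exact: interval_open].
Qed.

Lemma spacetime_norm (z : spacetime) : `|z| = Num.max `|z.1| `|z.2|.
Proof. by []. Qed.

Lemma cvg_time_pair (x : space) (t : R) :
  (fun r : R => (x, r) : spacetime) @ t --> ((x, t) : spacetime).
Proof.
apply/cvgrPdist_lt => e e0.
have : nbhs t (ball t e) by exact: nbhsx_ballx.
apply: filterS => r; rewrite -ball_normE /= => h; rewrite spacetime_norm /= subrr normr0 gt_max e0.
exact: h.
Qed.

Lemma spacetime_boxes_bounded A : spacetime_boxes A -> bounded_set A.
Proof.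
move=> [l [u [a [b ->]]]].
have /bounded_setP[M hM] := box_bounded l u.
apply/bounded_setP; exists (Num.max M (`|a| + `|b|)) => z [/hM h1].
rewrite /= in_itv /= => /andP[h2 h3]; rewrite spacetime_norm.
rewrite ge_max !le_max h1 /=; apply/orP; right; rewrite ler_norml.
have := ler_norm a; have := ler_norm (- a); have := ler_norm b; have := ler_norm (- b).
rewrite !normrN; have := normr_ge0 a; have := normr_ge0 b; lra.
Qed.

Lemma spacetime_boxes_ball (z : spacetime) r : 0 < r -> spacetime_boxes (ball z r).
Proof.
move=> r0; have [l [u lu]] := boxes_ball z.1 r0.
exists l, u, (z.2 - r), (z.2 + r); rewrite -lu.
have e : ball (z.2 : R^o) r = `]z.2 - r, z.2 + r[%classic by exact: ball_itv.
by rewrite -e; apply/seteqP; split => y.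
Qed.

Lemma spacetime_boxes_setI : setI_closed spacetime_boxes.
Proof.
move=> _ _ [l [u [a [b ->]]]] [l' [u' [a' [b' ->]]]].
have [l'' [u'' e]] : boxes (box l u `&` box l' u').
  by apply: boxes_setI; [exists l, u|exists l', u'].
exists l'', u'', (Num.max a a'), (Num.min b b'); rewrite -e.
apply/seteqP; split => -[x t] /=; rewrite !in_itv /= gt_max lt_min.
  by move=> [[h1 /andP[-> ->]] [h2 /andP[-> ->]]].
by move=> [[h1 h2] /andP[/andP[-> ->] /andP[-> ->]]].
Qed.

(** The Borel sets of the product are generated by its open sets. An open set is a countable union
    of balls, and a ball of the max norm is a product of balls. *)
Lemma measurable_to_spacetime d' (T : measurableType d') (p : T -> spacetime) :
  measurable_fun setT (fun x => (p x).1 : borel space) ->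
  measurable_fun setT (fun x => (p x).2 : R) ->
  measurable_fun setT (p : T -> borel spacetime).
Proof.
move=> m1 m2; apply: (@measurability _ _ T (borel spacetime) setT p open) => //.
move=> _ [U oU <-]; have [F [FE ->]] := open_bigcup_balls rational_event_dense oU.
rewrite setTI preimage_bigcup; apply: bigcupT_measurable => n.
have [->|[z [r [r0 ->]]]] := FE n; first by rewrite preimage_set0.
rewrite (_ : _ @^-1` _ = (fun x => (p x).1) @^-1` (ball z.1 r) `&`
  (fun x => (p x).2) @^-1` (ball z.2 r)); last by apply/seteqP; split => x.
apply: measurableI; rewrite -[X in measurable X]setTI.
  by apply: m1 => //; apply: borel_open; exact: ball_open.
by apply: m2 => //; apply: open_measurable; exact: (@ball_open R R^o).
Qed.

Lemma measurable_spacetime_fst : measurable_fun setT (fst : borel spacetime -> borel space).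
Proof.
apply: (@measurability _ _ (borel spacetime) (borel space) setT fst open) => // _ [U oU <-]; rewrite setTI.
by apply: borel_open; apply: open_comp => // z _; exact: cvg_fst.
Qed.

Lemma measurable_spacetime_snd : measurable_fun setT (snd : borel spacetime -> R).
Proof. by apply: continuous_borel_measurable => z; exact: cvg_snd. Qed.

Lemma measurable_halfspace : measurable (@halfspace R d : set (borel spacetime)).
Proof.
rewrite (_ : @halfspace R d = snd @^-1` `[0, +oo[%classic).
  rewrite -[X in measurable X]setTI.
  by apply: measurable_spacetime_snd => //; exact: measurable_itv.
by apply/seteqP; split => z /=; rewrite in_itv /= andbT.
Qed.

Lemma measurable_to_borel_line d' (T : measurableType d') (p : T -> R) :
  measurable_fun setT p -> measurable_fun setT (p : T -> borel R^o).
Proof.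
move=> mp; apply: (@measurability _ _ T (borel R^o) setT p open) => // _ [U oU <-].
by apply: mp => //; exact: open_measurable.
Qed.

Lemma measurable_sq_space : measurable_fun setT (@sq_space R d : borel space -> R).
Proof.
apply: measurable_sum => i; apply: measurable_funX.
apply: continuous_borel_measurable => x.
exact: (@coord_continuous R 1 d ord0 i x).
Qed.

Lemma measurable_sq_spacetime :
  measurable_fun setT (@sq_spacetime R d : borel spacetime -> R).
Proof.
rewrite /sq_spacetime; apply: measurable_funD.
  exact: (measurableT_comp measurable_sq_space measurable_spacetime_fst).
by rewrite /sq_time; apply: measurable_funX; exact: measurable_spacetime_snd.
Qed.

Lemma measurable_sq_time : measurable_fun setT (@sq_time R : borel R^o -> R).
Proof.
by rewrite /sq_time; apply: measurable_funX; apply: continuous_borel_measurable => x; exact: cvg_id.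
Qed.

Lemma sq_space_ge0 (x : space) : 0 <= sq_space x.
Proof. by apply: sumr_ge0 => i _; exact: sqr_ge0. Qed.

Lemma sq_spacetime_ge0 (z : spacetime) : 0 <= sq_spacetime z.
Proof. by rewrite addr_ge0 ?sq_space_ge0 ?sqr_ge0. Qed.

End space_and_spacetime.

(** * Fubini for complex functions under a product bound *)

Section complex_fubini.
Context d1 d2 (T1 : measurableType d1) (T2 : measurableType d2) (R : realType).
Variables (m1 : {sigma_finite_measure set T1 -> \bar R})
  (m2 : {sigma_finite_measure set T2 -> \bar R}).
Variables (H : T1 * T2 -> R[i]) (w : T1 -> R) (v : T2 -> R).
Hypotheses (mH : cmeasurable H) (mw : measurable_fun setT w) (mv : measurable_fun setT v).
Hypotheses (w0 : forall x, 0 <= w x) (v0 : forall x, 0 <= v x).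
Hypotheses (iw : m1.-integrable setT (EFin \o w)) (iv : m2.-integrable setT (EFin \o v)).
Hypothesis Hwv : forall x t, abs1 (H (x, t)) <= w x * v t.

Let m : {measure set (T1 * T2) -> \bar R} := (m1 \x m2)%E.

Lemma integrable_tensor : m.-integrable setT (EFin \o (fun z => w z.1 * v z.2)).
Proof.
have mwv : measurable_fun setT (fun z : T1 * T2 => w z.1 * v z.2).
  by apply: measurable_funM; exact: measurableT_comp.
apply/integrableP; split; first exact/measurable_EFinP.
rewrite fubini_tonelli1//=; last first.
  by apply/measurable_EFinP; apply: measurableT_comp.
rewrite /fubini_F /=.
have fv : (\int[m2]_y (v y)%:E)%E \is a fin_num by exact: integrable_fin_num.
rewrite (_ : (fun x => _) = (fun x => (w x)%:E * (\int[m2]_y (v y)%:E))%E).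
  rewrite ge0_integralZr//.
  - apply: lte_mul_pinfty.
    + by apply: integral_ge0 => x _; rewrite lee_fin.
    + exact: integrable_fin_num.
    + by rewrite ltey_eq fv.
  - exact/measurable_EFinP.
  - by move=> x _; rewrite lee_fin.
  - by apply: integral_ge0 => y _; rewrite lee_fin.
apply/funext => x; rewrite -ge0_integralZl//;
  [|exact/measurable_EFinP|by move=> y _; rewrite lee_fin|by rewrite lee_fin].
by apply: eq_integral => y _; rewrite /= ger0_norm ?mulr_ge0.
Qed.

Lemma cintegrable_tensor : cintegrable m setT H.
Proof.
by apply: (cintegrable_le _ mH integrable_tensor) => // -[x t] _; exact: Hwv.
Qed.

Lemma cmeasurable_slice1 x : cmeasurable (fun t => H (x, t)).
Proof. by apply: (cmeasurable_comp mH); exact: measurable_pair1. Qed.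

Lemma cmeasurable_slice2 t : cmeasurable (fun x => H (x, t)).
Proof. by apply: (cmeasurable_comp mH); exact: measurable_pair2. Qed.

(** The product bound makes every slice integrable, not only almost every one, so no default value
    of an integral enters the iterated integrals. *)
Lemma cintegrable_slice1 x : cintegrable m2 setT (fun t => H (x, t)).
Proof.
apply: (@cintegrable_le _ _ _ _ _ (fun t => w x * v t)) => //.
- exact: cmeasurable_slice1.
- exact: (integrableZl measurableT (w x) iv).
Qed.

Lemma cintegrable_slice2 t : cintegrable m1 setT (fun x => H (x, t)).
Proof.
apply: (@cintegrable_le _ _ _ _ _ (fun x => v t * w x)) => //.
- exact: cmeasurable_slice2.
- exact: (integrableZl measurableT (v t) iw).
- by move=> x _; rewrite mulrC.
Qed.

Lemma Cint_fubini1 : Cint m setT H = Cint m1 setT (fun x => Cint m2 setT (fun t => H (x, t))).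
Proof.
have [ir ii] := cintegrable_ReIm measurableT cintegrable_tensor.
have h x := cintegrable_ReIm measurableT (cintegrable_slice1 x).
apply: complex_eqP; congr fine.
  rewrite -integral12_prod_meas1//; apply: eq_integral => x _ /=.
  by rewrite /fubini_F /= fineK//; apply: integrable_fin_num => //; case: (h x).
rewrite -integral12_prod_meas1//; apply: eq_integral => x _ /=.
by rewrite /fubini_F /= fineK//; apply: integrable_fin_num => //; case: (h x).
Qed.

Lemma Cint_fubini2 : Cint m setT H = Cint m2 setT (fun t => Cint m1 setT (fun x => H (x, t))).
Proof.
have [ir ii] := cintegrable_ReIm measurableT cintegrable_tensor.
have h t := cintegrable_ReIm measurableT (cintegrable_slice2 t).
apply: complex_eqP; congr fine.
  rewrite -integral21_prod_meas1//; apply: eq_integral => x _ /=.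
  by rewrite /fubini_G /= fineK//; apply: integrable_fin_num => //; case: (h x).
rewrite -integral21_prod_meas1//; apply: eq_integral => x _ /=.
by rewrite /fubini_G /= fineK//; apply: integrable_fin_num => //; case: (h x).
Qed.

End complex_fubini.

(** * Complex exponential and integration of derivatives *)

Section cexp.
Variable R : realType.
Implicit Types z : R[i].

Definition cexp z : R[i] := (expR (Re z) * cos (Im z)) +i* (expR (Re z) * sin (Im z)).

Lemma cexp0 : cexp 0 = 1.
Proof. by rewrite /cexp /= expR0 cos0 sin0 mulr1 mulr0. Qed.

(** The factor 2 bounds [|cos| + |sin|]. *)
Lemma abs1_cexp z : abs1 (cexp z) <= 2 * expR (Re z).
Proof.
rewrite /abs1 /= !normrM (ger0_norm (expR_ge0 _)).
have c1 : `|cos (Im z)| <= 1 by rewrite ler_norml cos_geN1 cos_le1.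
have s1 : `|sin (Im z)| <= 1 by rewrite ler_norml sin_geN1 sin_le1.
have := expR_ge0 (Re z); nra.
Qed.

Lemma cmeasurable_cexp d (T : measurableType d) (f : T -> R[i]) :
  cmeasurable f -> cmeasurable (fun x => cexp (f x)).
Proof.
move=> [fr fi]; split => /=; apply: measurable_funM.
- by apply: (measurableT_comp (@measurable_expR R)).
- by apply: (measurableT_comp (continuous_measurable_fun (@continuous_cos R))).
- by apply: (measurableT_comp (@measurable_expR R)).
- by apply: (measurableT_comp (continuous_measurable_fun (@continuous_sin R))).
Qed.

Lemma cvg_cexp (T : Type) (F : set_system T) (FF : Filter F) (f : T -> R[i]) l :
  ((fun x => f x : R[i]^o) @ F --> (l : R[i]^o)) ->
  ((fun x => cexp (f x) : R[i]^o) @ F --> (cexp l : R[i]^o)).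
Proof.
move=> /cvg_complexP[fr fi]; apply/cvg_complexP; split => /=.
  apply: cvgM; [exact: (continuous_cvg _ (@continuous_expR R _) fr)|].
  exact: (continuous_cvg _ (@continuous_cos R _) fi).
apply: cvgM; [exact: (continuous_cvg _ (@continuous_expR R _) fr)|].
exact: (continuous_cvg _ (@continuous_sin R _) fi).
Qed.

Lemma cvg_complexM (T : Type) (F : set_system T) (FF : Filter F) (f h : T -> R[i]) a b :
  ((fun x => f x : R[i]^o) @ F --> (a : R[i]^o)) ->
  ((fun x => h x : R[i]^o) @ F --> (b : R[i]^o)) ->
  ((fun x => (f x * h x) : R[i]^o) @ F --> (a * b : R[i]^o)).
Proof.
move=> /cvg_complexP[fr fi] /cvg_complexP[hr hi]; apply/cvg_complexP; split.
  by under eq_fun do rewrite cReM; rewrite cReM; apply: cvgB; exact: cvgM.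
by under eq_fun do rewrite cImM; rewrite cImM; apply: cvgD; exact: cvgM.
Qed.

Lemma cvg_complexD (T : Type) (F : set_system T) (FF : Filter F) (f h : T -> R[i]) a b :
  ((fun x => f x : R[i]^o) @ F --> (a : R[i]^o)) ->
  ((fun x => h x : R[i]^o) @ F --> (b : R[i]^o)) ->
  ((fun x => (f x + h x) : R[i]^o) @ F --> (a + b : R[i]^o)).
Proof.
move=> /cvg_complexP[fr fi] /cvg_complexP[hr hi]; apply/cvg_complexP; split.
  by under eq_fun do rewrite cReD; rewrite cReD; exact: cvgD.
by under eq_fun do rewrite cImD; rewrite cImD; exact: cvgD.
Qed.

Lemma cvg_complexN (T : Type) (F : set_system T) (FF : Filter F) (f : T -> R[i]) a :
  ((fun x => f x : R[i]^o) @ F --> (a : R[i]^o)) ->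
  ((fun x => - f x : R[i]^o) @ F --> (- a : R[i]^o)).
Proof.
move=> /cvg_complexP[fr fi]; apply/cvg_complexP; split.
  by under eq_fun do rewrite cReN; rewrite cReN; exact: cvgN.
by under eq_fun do rewrite cImN; rewrite cImN; exact: cvgN.
Qed.

Lemma cvg_real_complex (T : Type) (F : set_system T) (FF : Filter F) (f : T -> R) (a : R) :
  f @ F --> a -> ((fun x => (f x)%:C : R[i]^o) @ F --> (a%:C : R[i]^o)).
Proof. by move=> fa; apply/cvg_complexP; split => //=; exact: cvg_cst. Qed.

End cexp.

Section complex_derivative.
Variable R : realType.
Implicit Types (f g : R -> R[i]) (t : R).

Definition cderiv f t (l : R[i]) :=
  is_derive t (1 : R) (fun x => Re (f x) : R) (Re l) /\
  is_derive t (1 : R) (fun x => Im (f x) : R) (Im l).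

Lemma cderivM f g t a b : cderiv f t a -> cderiv g t b ->
  cderiv (fun x => f x * g x) t (a * g t + f t * b).
Proof.
move=> [fr fi] [gr gi]; split.
  have -> : (fun x => Re (f x * g x)) =
      (fun x => Re (f x)) * (fun x => Re (g x)) - (fun x => Im (f x)) * (fun x => Im (g x)).
    by apply/funext => x; rewrite cReM.
  apply: (is_derive_eq (is_deriveB (is_deriveM fr gr) (is_deriveM fi gi))).
  rewrite cReD !cReM /GRing.scale /=; ring.
have -> : (fun x => Im (f x * g x)) =
    (fun x => Re (f x)) * (fun x => Im (g x)) + (fun x => Im (f x)) * (fun x => Re (g x)).
  by apply/funext => x; rewrite cImM.
apply: (is_derive_eq (is_deriveD (is_deriveM fr gi) (is_deriveM fi gr))).
rewrite cImD !cImM /GRing.scale /=; ring.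
Qed.

Lemma cderiv_cexp (c t : R) (z : R[i]) :
  cderiv (fun x => cexp (- ((x - c)%:C * z))) t (- z * cexp (- ((t - c)%:C * z))).
Proof.
case: z => a b; pose u (k x : R) := - ((x - c) * k).
have du k : is_derive t (1 : R) (u k) (- k).
  rewrite (_ : u k = (fun x => (- k) * x + c * k)); last by apply/funext => x; rewrite /u; ring.
  by apply: is_derive_eq; rewrite /GRing.scale /= addr0 mulr1.
have e x : cexp (- ((x - c)%:C * (a +i* b))) =
    (expR (u a x) * cos (u b x)) +i* (expR (u a x) * sin (u b x)).
  by rewrite /cexp cReN cImN cReM cImM /= !mul0r subr0 addr0.
rewrite /cderiv; split.
  have h1 := is_derive1_comp (is_derive_expR (u a t)) (du a).
  have h2 := is_derive1_comp (is_derive_cos (u b t)) (du b).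
  rewrite e (_ : (fun x => _) = (expR \o u a) * (cos \o u b)).
    by apply: (is_derive_eq (is_deriveM h1 h2)); rewrite cReM cReN cImN /GRing.scale /=; ring.
  by apply/funext => x; rewrite e.
have h1 := is_derive1_comp (is_derive_expR (u a t)) (du a).
have h2 := is_derive1_comp (is_derive_sin (u b t)) (du b).
rewrite e (_ : (fun x => _) = (expR \o u a) * (sin \o u b)).
  by apply: (is_derive_eq (is_deriveM h1 h2)); rewrite cImM cReN cImN /GRing.scale /=; ring.
by apply/funext => x; rewrite e.
Qed.

End complex_derivative.

Section ftc_compact.
Variable R : realType.
Local Notation leb := (@lebesgue_measure R).

Lemma integrable_compact_support (f : R -> R) M : continuous f ->
  (forall t, M <= `|t| -> f t = 0) -> leb.-integrable setT (EFin \o f).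
Proof.
move=> cf f0.
have iM : leb.-integrable `[- M, M] (EFin \o f).
  apply: continuous_compact_integrable; first exact: segment_compact.
  exact: continuous_subspaceT.
have mM : measurable (`[- M, M]%classic : set (measurableTypeR R)) by exact: measurable_itv.
have := (integrable_mkcond _ mM).1 iM.
apply: eq_integrable => // t _; rewrite /= patchE; case: ifPn => //.
rewrite notin_setE /= in_itv /= => h; rewrite f0// leNgt; apply/negP => tM; apply: h.
by rewrite -ler_norml ltW.
Qed.

Lemma ftc_compact_support (q dq : R -> R) M : (forall t, is_derive t (1 : R) q (dq t)) ->
  continuous dq -> (forall t, M <= `|t| -> q t = 0) -> (forall t, M <= `|t| -> dq t = 0) ->
  (forall c, \int[leb]_(t in `[c, +oo[) dq t = - q c) /\ \int[leb]_t dq t = 0.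
Proof.
move=> hq cdq q0 dq0.
have cq : continuous q.
  by move=> t; apply: differentiable_continuous; apply/derivable1_diffP; apply: ex_derive.
have ftc a b : a < b -> \int[leb]_(t in `[a, b]) dq t = q b - q a.
  move=> ab; rewrite /Rintegral (@continuous_FTC2 _ dq q a b)//.
  - exact: continuous_subspaceT.
  - split => [x _||]; first exact: ex_derive.
      by apply: cvg_at_right_filter; exact: cq.
    by apply: cvg_at_left_filter; exact: cq.
  - by move=> x _; rewrite derive1E; exact: derive_val.
split=> [c|].
  pose b := Num.max c `|M| + 1.
  have cb : c < b by rewrite ltr_pwDr// le_max lexx.
  have Mb t : b <= t -> M <= `|t|.
    move=> bt; apply: le_trans (ler_norm M) (le_trans _ (ler_norm t)).
    by apply: le_trans bt; rewrite /b ler_wpDr// le_max lexx orbT.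
  rewrite (_ : \int[leb]_(t in `[c, +oo[) dq t = \int[leb]_(t in `[c, b]) dq t).
    by rewrite ftc// q0 ?sub0r//; exact: Mb.
  rewrite [LHS]Rintegral_mkcond [RHS]Rintegral_mkcond; congr Rintegral.
  apply/funext => t; rewrite !patchE !mem_setE !in_itv /= andbT.
  case: (leP c t) => //= ct; case: leP => // /ltW /Mb; exact: dq0.
pose b := `|M| + 1.
have b0 : - b < b by rewrite /b; have := normr_ge0 M; lra.
have Mb t : b <= `|t| -> M <= `|t|.
  by move=> bt; apply: le_trans (ler_norm M) (le_trans _ bt); rewrite /b lerDl.
have nb : `|b| = b by rewrite ger0_norm// /b addr_ge0.
rewrite (_ : \int[leb]_t dq t = \int[leb]_(t in `[- b, b]) dq t).
  by rewrite ftc// !q0 ?subrr//; apply: Mb; rewrite ?normrN nb.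
rewrite [RHS]Rintegral_mkcond; congr Rintegral.
apply/funext => t; rewrite patchE mem_setE in_itv /= -ler_norml.
by case: leP => // /ltW /Mb; exact: dq0.
Qed.

Lemma continuous_cmeasurable_line (f : R -> R[i]) :
  continuous (f : R -> R[i]^o) -> cmeasurable f.
Proof.
by move=> cf; split; apply: continuous_measurable_fun => x; have /cvg_complexP[] := cf x.
Qed.

Lemma cintegrable_compact_support (f : R -> R[i]) M : continuous (f : R -> R[i]^o) ->
  (forall t, M <= `|t| -> f t = 0) -> cintegrable leb setT f.
Proof.
move=> cf f0; split; first exact: continuous_cmeasurable_line.
apply: (@integrable_compact_support _ M) => [t|t /f0 ->]; last first.
  by rewrite /abs1 /= normr0 addr0.
by have /cvg_complexP[fr fi] := cf t; apply: cvgD; exact: cvg_norm.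
Qed.

Lemma complex_ftc_compact_support (q dq : R -> R[i]) M : (forall t, cderiv q t (dq t)) ->
  continuous (dq : R -> R[i]^o) -> (forall t, M <= `|t| -> q t = 0) ->
  (forall t, M <= `|t| -> dq t = 0) ->
  (forall c, Cint leb `[c, +oo[ dq = - q c) /\ Cint leb setT dq = 0.
Proof.
move=> hq cdq q0 dq0.
have cr : continuous (fun t => Re (dq t)) by move=> t; have /cvg_complexP[] := cdq t.
have ci : continuous (fun t => Im (dq t)) by move=> t; have /cvg_complexP[] := cdq t.
have [r1 r2] := @ftc_compact_support (fun t => Re (q t)) (fun t => Re (dq t)) M
  (fun t => (hq t).1) cr
  (fun t h => congr1 (@complex.Re R) (q0 t h)) (fun t h => congr1 (@complex.Re R) (dq0 t h)).
have [i1 i2] := @ftc_compact_support (fun t => Im (q t)) (fun t => Im (dq t)) M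
  (fun t => (hq t).2) ci
  (fun t h => congr1 (@complex.Im R) (q0 t h)) (fun t h => congr1 (@complex.Im R) (dq0 t h)).
split=> [c|]; apply: complex_eqP; rewrite ?cReN ?cImN /=.
- exact: r1.
- exact: i1.
- exact: r2.
- exact: i2.
Qed.

(** Put [E c t = cexp (- (t - c) z)]. The derivative of [E c psi] is [E c (psi' - z psi)], so the
    integrand is, up to signs, a sum of total derivatives. The emitted wave is cut at [t = s] and
    leaves [psi s * a]; the free waves, with coefficients [a] if [s <= 0] and [b], are integrated
    over the whole line and leave nothing. *)
Lemma transport_integral (psi dpsi : R -> R[i]) (z a b : R[i]) (s M : R) :
  (forall t, cderiv psi t (dpsi t)) ->
  continuous (psi : R -> R[i]^o) -> continuous (dpsi : R -> R[i]^o) ->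
  (forall t, M <= `|t| -> psi t = 0) -> (forall t, M <= `|t| -> dpsi t = 0) ->
  Cint leb setT (fun t => (- dpsi t + z * psi t) *
    (cexp (- ((t - s)%:C * z)) * ((s <= t)%R%:R - (s <= 0)%R%:R)%:C * a +
     cexp (- (t%:C * z)) * b)) = psi s * a.
Proof.
move=> hpsi cpsi cdpsi psi0 dpsi0.
pose E c t := cexp (- ((t - c)%:C * z)).
pose q c t := E c t * psi t.
pose dq c t := - z * E c t * psi t + E c t * dpsi t.
have cE c : continuous (E c : R -> R[i]^o).
  move=> t; apply: cvg_cexp; apply: cvg_complexN; apply: cvg_complexM; last exact: cvg_cst.
  by apply: cvg_real_complex; apply: cvgB; [exact: cvg_id|exact: cvg_cst].
have hq c t : cderiv (q c) t (dq c t).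
  by apply: cderivM => //; exact: cderiv_cexp.
have cdq c : continuous (dq c : R -> R[i]^o).
  move=> t; apply: cvg_complexD; last by apply: cvg_complexM; [exact: cE|exact: cdpsi].
  apply: cvg_complexM; last exact: cpsi.
  by apply: cvg_complexM; [exact: cvg_cst|exact: cE].
have q0 c t : M <= `|t| -> q c t = 0 by move=> h; rewrite /q psi0// mulr0.
have dq0 c t : M <= `|t| -> dq c t = 0.
  by move=> h; rewrite /dq psi0// dpsi0// !mulr0 addr0.
have [I1 I2] := complex_ftc_compact_support (hq s) (cdq s) (q0 s) (dq0 s).
have [_ I3] := complex_ftc_compact_support (hq 0) (cdq 0) (q0 0) (dq0 0).
have ids c : cintegrable leb setT (dq c).
  exact: (cintegrable_compact_support (cdq c) (dq0 c)).
have mI : measurable (`[s, +oo[%classic : set (measurableTypeR R)).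
  exact: measurable_itv.
have idI : cintegrable leb setT (fun t => (\1_`[s, +oo[%classic t)%:C * dq s t).
  exact: ((cintegrable_mkcond leb mI (ids s).1).1
    (cintegrableS measurableT mI (@subsetT _ _) (ids s))).
transitivity (Cint leb setT (fun t =>
    (- a) * ((\1_`[s, +oo[%classic t)%:C * dq s t) +
    (((s <= 0)%R%:R)%:C * a * dq s t + (- b) * dq 0 t))).
  apply: eq_Cint => t _; rewrite /dq /E subr0.
  have -> : \1_`[s, +oo[%classic t = (s <= t)%R%:R :> R.
    by rewrite indicE mem_setE in_itv /= andbT.
  have -> : (((s <= t)%R%:R - (s <= 0)%R%:R)%:C : R[i]) =
      ((s <= t)%R%:R)%:C - ((s <= 0)%R%:R)%:C by rewrite rmorphB.
  ring.
rewrite CintD//; last 2 first.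
- exact: cintegrableZ.
- by apply: cintegrableD => //; exact: cintegrableZ.
rewrite CintD//; try exact: cintegrableZ.
rewrite !CintZ// -Cint_mkcond I1 I2 I3 !mulr0 !addr0 /q /E subrr.
by rewrite mul0r oppr0 cexp0 mul1r mulrNN mulrC.
Qed.

End ftc_compact.

(** * One-sided limits and test functions *)

Section one_sided_limits.
Variable R : realType.

(** One-sided limits are reduced to sequences, the form in which dominated convergence is
    available. *)
Lemma cvg_at_right_complex (h : R -> R[i]) (t : R) (l : R[i]) :
  (forall u : nat -> R, (forall n, t < u n) -> u @ \oo --> t ->
    ((h (u n) : R[i]^o) @[n --> \oo] --> (l : R[i]^o))) ->
  ((h r : R[i]^o) @[r --> t^'+] --> (l : R[i]^o)).
Proof.
move=> H; apply/cvg_complexP; split; apply/cvg_at_rightP => u [ut uc];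
  by have /cvg_complexP[] := H u ut uc.
Qed.

Lemma cvg_at_left_complex (h : R -> R[i]) (t : R) (l : R[i]) :
  (forall u : nat -> R, (forall n, u n < t) -> u @ \oo --> t ->
    ((h (u n) : R[i]^o) @[n --> \oo] --> (l : R[i]^o))) ->
  ((h r : R[i]^o) @[r --> t^'-] --> (l : R[i]^o)).
Proof.
move=> H; apply/cvg_complexP; split; apply/cvg_at_leftP => u [ut uc];
  by have /cvg_complexP[] := H u ut uc.
Qed.

Lemma cvg_step_right (c t : R) (u : nat -> R) : (forall n, t < u n) -> u @ \oo --> t ->
  ((c <= u n)%R%:R : R) @[n --> \oo] --> ((c <= t)%R%:R : R).
Proof.
move=> ut uc; apply: cvg_near_cst; have [ct|tc] := leP c t.
  by apply: nearW => n; rewrite (le_trans ct (ltW (ut n))).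
apply: (filterS _ (cvgr_lt _ uc _ tc)) => n /= h.
by rewrite leNgt h.
Qed.

(** From the left the limit is the strict indicator; it differs from the value at [t] when [t = c],
    and this is the jump of the time slices. *)
Lemma cvg_step_left (c t : R) (u : nat -> R) : (forall n, u n < t) -> u @ \oo --> t ->
  ((c <= u n)%R%:R : R) @[n --> \oo] --> ((c < t)%R%:R : R).
Proof.
move=> ut uc; apply: cvg_near_cst; have [tc|ct] := leP t c.
  by apply: nearW => n; rewrite leNgt (lt_le_trans (ut n) tc).
apply: (filterS _ (cvgr_gt _ uc _ ct)) => n /= h.
by rewrite ltW.
Qed.

Lemma cvg_transport (a b u : nat -> R) (A B t s k : R) (z y y0 : R[i]) :
  a @ \oo --> A -> b @ \oo --> B -> u @ \oo --> t ->
  (((a n)%:C * (cexp (- ((u n - s)%:C * z)) * (b n - k)%:C * y +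
     cexp (- ((u n)%:C * z)) * y0) : R[i]^o) @[n --> \oo] -->
   (A%:C * (cexp (- ((t - s)%:C * z)) * (B - k)%:C * y + cexp (- (t%:C * z)) * y0) : R[i]^o)).
Proof.
move=> aA bB ut.
have cst (c : R[i]) : (fun _ : nat => c : R[i]^o) @ \oo --> (c : R[i]^o) by exact: cvg_cst.
have e (v : nat -> R) (r : R) : v @ \oo --> r ->
    (fun n => cexp (- ((v n)%:C * z)) : R[i]^o) @ \oo --> (cexp (- (r%:C * z)) : R[i]^o).
  move=> vr; apply: cvg_cexp; apply: cvg_complexN.
  by apply: cvg_complexM; [exact: cvg_real_complex|exact: cst].
have us : (fun n => u n - s) @ \oo --> t - s by apply: cvgB => //; exact: cvg_cst.
have bk : (fun n => b n - k) @ \oo --> B - k by apply: cvgB => //; exact: cvg_cst.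
apply: cvg_complexM; first exact: cvg_real_complex.
apply: cvg_complexD; apply: cvg_complexM; [|exact: cst|exact: (e _ _ ut)|exact: cst].
by apply: cvg_complexM; [exact: (e _ _ us)|exact: cvg_real_complex].
Qed.

Lemma fast_decreasing_bound (E : normedModType R) (sq : E -> R) (phi : E -> R[i]) (N : nat) :
  (forall x, 0 <= sq x) -> fast_decreasing sq phi ->
  exists C : R, 0 <= C /\ forall x, abs1 (phi x) <= C * (1 + sq x) ^- N.
Proof.
move=> sq0 [_ /(_ N)[M hM]]; exists (2 * `|M|); split; first by rewrite mulr_ge0.
move=> x; apply: le_trans (abs1_normc _) _; rewrite -mulrA ler_pM2l//.
have A0 : 0 < (1 + sq x) ^+ N by rewrite exprn_gt0// ltr_wpDr.
by rewrite ler_pdivlMr// mulrC; apply: le_trans (hM x) (ler_norm _).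
Qed.

End one_sided_limits.

Section test_functions.
Context (R : realType) (d : nat).
Local Notation space := 'rV[R]_d.
Local Notation spacetime := ((('rV[R]_d * R^o)%type : normedModType R)).
Local Notation tdir := (time_direction R d).

Lemma is_derive_time (f : spacetime -> R^o) (x : space) (t : R) :
  derivable f (x, t) tdir ->
  is_derive t (1 : R) (fun r => f (x, r) : R) ('D_tdir f (x, t)).
Proof.
move=> df.
have e : (fun h : R => h^-1 *: ((f \o shift ((x, t) : spacetime)) (h *: (tdir : spacetime)) - f (x, t))) =
    (fun h : R => h^-1 *: (((fun r => f (x, r)) \o shift t) (h *: (1 : R)) - f (x, t))).
  apply/funext => h /=; congr (_ *: (f _ - _)).
  by rewrite /time_direction /shift /=; congr (_, _); rewrite /= scaler0 add0r.
apply: DeriveDef; first by rewrite /derivable -e; exact: df.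
by rewrite /derive -e.
Qed.

Lemma test_function_facts (phi : spacetime -> R[i]) : test_function phi ->
  let dphi := derive_complex tdir phi in
  [/\ continuous (phi : spacetime -> R[i]^o), continuous (dphi : spacetime -> R[i]^o),
    forall x t, cderiv (fun r => phi (x, r)) t (dphi (x, t)) &
    exists M C : R, forall z, abs1 (phi z) <= C /\ abs1 (dphi z) <= C /\
      (M < `|z| -> phi z = 0 /\ dphi z = 0)].
Proof.
move=> [sr si cK] dphi.
have [cr hr] := sr 1%N; have [ci hi] := si 1%N.
have cphi : continuous (phi : spacetime -> R[i]^o).
  by move=> z; apply/cvg_complexP; split; [exact: cr|exact: ci].
have cdphi : continuous (dphi : spacetime -> R[i]^o).
  move=> z; apply/cvg_complexP; split.
    by have [_ [c _]] := hr tdir; exact: c.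
  by have [_ [c _]] := hi tdir; exact: c.
split => //.
  move=> x t; split.
    by apply: (is_derive_time (f := fun z => Re (phi z))); have [h _] := hr tdir; exact: h.
  by apply: (is_derive_time (f := fun z => Im (phi z))); have [h _] := hi tdir; exact: h.
set K := closure _ in cK.
have outK z : ~ K z -> phi z = 0 /\ dphi z = 0.
  move=> nKz; have oK : open (~` K) by apply: closed_openC; exact: closed_closure.
  (* [phi] vanishes on a neighbourhood of [z], so its derivative vanishes at [z] as well. *)
  have nz : \forall y \near z, phi y = 0.
    have : nbhs z (~` K) by exact: open_nbhs_nbhs.
    apply: filterS => y nKy; apply: contrapT => py; apply: nKy.
    by apply: subset_closure; apply/eqP.
  split; first exact: (nbhs_singleton nz).
  apply: complex_eqP => /=.
    rewrite (@near_eq_derive _ _ _ _ (cst (0 : R^o))) ?derive_cst//.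
    by apply: filterS nz => y /= ->.
  rewrite (@near_eq_derive _ _ _ _ (cst (0 : R^o))) ?derive_cst//.
  by apply: filterS nz => y /= ->.
have bdd (f : spacetime -> R[i]) : continuous (f : spacetime -> R[i]^o) ->
    exists C : R, forall z, K z -> abs1 (f z) <= C.
  move=> cf; pose h (z : spacetime) : R^o := abs1 (f z).
  have ch : continuous h.
    by move=> z; have /cvg_complexP[fr fi] := cf z; apply: cvgD; exact: cvg_norm.
  have : compact (h @` K).
    by apply: continuous_compact => //; exact: continuous_subspaceT.
  move=> /compact_bounded /bounded_setP[C hC].
  by exists C => z Kz; apply: le_trans (ler_norm _) _; apply: hC; exists z.
have [C1 hC1] := bdd _ cphi; have [C2 hC2] := bdd _ cdphi.
have /bounded_setP[M hM] : bounded_set K by exact: (@compact_bounded R).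
exists M, (`|C1| + `|C2|) => z.
have n1 := normr_ge0 C1; have n2 := normr_ge0 C2.
have l1 := ler_norm C1; have l2 := ler_norm C2.
have [Kz|nKz] := pselect (K z).
  have h1 := hC1 z Kz; have h2 := hC2 z Kz; split; first lra.
  by split; [lra|rewrite ltNge hM].
have [-> ->] := outK z nKz.
by rewrite /abs1 /= normr0 addr0; split; [lra|split => //; lra].
Qed.

End test_functions.

(** * The Duhamel kernel and its estimates *)

Section duhamel_kernel.
Context (R : realType) (d : nat) (dT : measure_display) (T : measurableType dT).
Local Notation space := 'rV[R]_d.
Local Notation spacetime := ((('rV[R]_d * R^o)%type : normedModType R)).
Local Notation leb := (@lebesgue_measure R).
Variables (lam : {sigma_finite_measure set T -> \bar R}).
Variables (xi : T -> borel space) (s : T -> R) (fY f0 : T -> R[i]).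
Hypotheses (mxi : measurable_fun setT xi) (ms : measurable_fun setT s).
Hypotheses (s0 : forall x, 0 <= s x) (f0s : forall x, f0 x = 0 \/ s x = 0).
Hypotheses (mfY : cmeasurable fY) (mf0 : cmeasurable f0).
Hypotheses (fY1 : forall x, abs1 (fY x) <= 1) (f01 : forall x, abs1 (f0 x) <= 1).
Variable g : space -> R[i].
Hypotheses (cg : continuous (g : space -> R[i]^o)) (g_re : forall xi, 0 <= Re (g xi)).
Hypothesis g_bounded : forall M : R, exists C : R, forall x, `|x| <= M -> abs1 (g x) <= C.
Variable N : nat.

(** The slow-growth weight at the source point [(xi, s)]. The mass of [V0] sits at [s = 0], so one
    weight controls both data. *)
Definition source_weight x : R := (1 + (sq_space (xi x) + s x ^+ 2)) ^- N.
Local Notation w := source_weight.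

Hypothesis iw : lam.-integrable setT (EFin \o w).

(* Duhamel kernel: mass emitted by [Y] at time [s] is damped from [s] on; the
   term [s <= 0] prescribes the value 0 at time 0, which costs a backward wave
   for the mass of [Y] at time 0. The mass of [V0] is damped for all times. *)
Definition kern (z : T * measurableTypeR R) : R[i] :=
  cexp (- ((z.2 - s z.1)%:C * g (xi z.1))) *
    ((s z.1 <= z.2)%R%:R - (s z.1 <= 0)%R%:R)%:C * fY z.1 +
  cexp (- (z.2%:C * g (xi z.1))) * f0 z.1.

Definition kernp (z : T * measurableTypeR R) : R[i] := ((0 <= z.2)%R%:R)%:C * kern z.

Definition event (z : T * measurableTypeR R) : borel spacetime := (xi z.1, z.2).

Lemma measurable_event : measurable_fun setT event.
Proof.
apply: measurable_to_spacetime => /=; last exact: measurable_snd.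
exact: (measurableT_comp mxi measurable_fst).
Qed.

Lemma measurable_ler_indic d' (T' : measurableType d') (a b : T' -> R) :
  measurable_fun setT a -> measurable_fun setT b ->
  measurable_fun setT (fun x => (a x <= b x)%R%:R : R).
Proof.
move=> ma mb.
rewrite (_ : (fun x => _) = fun x => if (a x <= b x)%R then 1 else 0).
  by apply: measurable_fun_ifT => //; exact: measurable_fun_ler.
by apply/funext => x; case: ifP.
Qed.

Lemma cmeasurable_kern : cmeasurable kern.
Proof.
have mg : cmeasurable (fun z : T * measurableTypeR R => g (xi z.1)).
  apply: (cmeasurable_comp (continuous_cmeasurable cg)).
  exact: (measurableT_comp mxi measurable_fst).
have mt : measurable_fun setT (fun z : T * measurableTypeR R => z.2 : R).
  exact: measurable_snd.
have msz : measurable_fun setT (fun z : T * measurableTypeR R => s z.1).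
  exact: (measurableT_comp ms measurable_fst).
apply: cmeasurableD; apply: cmeasurableM.
- apply: cmeasurableM.
    apply: cmeasurable_cexp; apply: cmeasurableN; apply: cmeasurableM => //.
    by apply: cmeasurable_real; exact: measurable_funB.
  apply: cmeasurable_real; apply: measurable_funB; apply: measurable_ler_indic => //.
- exact: (cmeasurable_comp mfY measurable_fst).
- apply: cmeasurable_cexp; apply: cmeasurableN; apply: cmeasurableM => //.
- exact: (cmeasurable_comp mf0 measurable_fst).
Qed.

Lemma cmeasurable_kernp : cmeasurable kernp.
Proof.
apply: cmeasurableM; last exact: cmeasurable_kern.
by apply: cmeasurable_real; apply: measurable_ler_indic.
Qed.

Lemma abs1_cexp_real (r : R) (z : R[i]) :
  abs1 (cexp (- (r%:C * z))) <= 2 * expR (- (r * Re z)).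
Proof. by apply: le_trans (abs1_cexp _) _; rewrite cReN cReM /= mul0r subr0. Qed.

(** At time [t] only sources with [s <= |t|] contribute: for [t >= 0] those already emitted, for
    [t < 0] those at time 0. Since [Re g >= 0], the exponential can grow only for [t < 0]. The
    constant 4 counts two terms, each with the factor 2 of [abs1_cexp]. *)
Lemma abs1_kern x t :
  abs1 (kern (x, t)) <= 4 * expR (Num.max (- t) 0 * Re (g (xi x))) * (s x <= `|t|)%R%:R.
Proof.
set e := expR _; have gx := g_re (xi x).
have E0 r : - (r * Re (g (xi x))) <= Num.max (- t) 0 * Re (g (xi x)) ->
    abs1 (cexp (- (r%:C * g (xi x)))) <= 2 * e.
  by move=> h; apply: le_trans (abs1_cexp_real _ _) _; rewrite ler_pM2l// ler_expR.
have m0 : 0 <= Num.max (- t) 0 by rewrite le_max lexx orbT.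
have mt : - t <= Num.max (- t) 0 by rewrite le_max lexx.
have e0 : 0 <= e by exact: expR_ge0.
have t1 : abs1 (cexp (- ((t - s x)%:C * g (xi x))) *
    ((s x <= t)%R%:R - (s x <= 0)%R%:R)%:C * fY x) <= 2 * e * (s x <= `|t|)%R%:R.
  apply: le_trans (abs1M _ _) _; apply: (@le_trans _ _ (abs1 (cexp (- ((t - s x)%:C * g (xi x))) *
    ((s x <= t)%R%:R - (s x <= 0)%R%:R)%:C) * 1)).
    by apply: ler_wpM2l; rewrite ?abs1_ge0.
  rewrite mulr1; apply: le_trans (abs1M _ _) _; rewrite abs1_real.
  have sx := s0 x.
  have [st|st] := leP (s x) t; have [sz|sz] := leP (s x) 0.
  - by rewrite subrr normr0 mulr0 mulr_ge0// mulr_ge0.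
  - rewrite subr0 normr1 mulr1 (le_trans st (ler_norm t)) mulr1; apply: E0.
    by apply: (@le_trans _ _ 0); [rewrite oppr_le0 mulr_ge0// subr_ge0|rewrite mulr_ge0].
  - rewrite sub0r normrN1 mulr1; have -> : s x = 0 by apply/eqP; rewrite eq_le sz sx.
    rewrite normr_ge0 mulr1 subr0; apply: E0.
    by rewrite -mulNr ler_wpM2r.
  - by rewrite subrr normr0 mulr0 mulr_ge0// mulr_ge0.
have t2 : abs1 (cexp (- (t%:C * g (xi x))) * f0 x) <= 2 * e * (s x <= `|t|)%R%:R.
  have [->|->] := f0s x.
    by rewrite mulr0 /abs1 /= normr0 addr0 mulr_ge0// mulr_ge0.
  rewrite normr_ge0 mulr1; apply: le_trans (abs1M _ _) _.
  apply: (@le_trans _ _ (abs1 (cexp (- (t%:C * g (xi x)))) * 1)).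
    by apply: ler_wpM2l; rewrite ?abs1_ge0.
  by rewrite mulr1; apply: E0; rewrite -mulNr ler_wpM2r.
apply: le_trans (abs1D _ _) _; apply: le_trans (lerD t1 t2) _.
by rewrite le_eqVlt; apply/orP; left; apply/eqP; ring.
Qed.

Lemma abs1_kernp x t : abs1 (kernp (x, t)) <= 4 * (0 <= t)%R%:R * (s x <= `|t|)%R%:R.
Proof.
apply: le_trans (abs1M _ _) _; rewrite abs1_real /=.
case: (leP 0 t) => t0; last by rewrite normr0 mul0r mulr0 mul0r.
rewrite normr1 mul1r mulr1; apply: le_trans (abs1_kern x t) _.
have -> : Num.max (- t) 0 = 0 by apply/max_idPr; rewrite oppr_le0.
by rewrite mul0r expR0 mulr1.
Qed.

Lemma weight_ge0 x : 0 <= w x.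
Proof. by rewrite invr_ge0 exprn_ge0// addr_ge0// addr_ge0// ?sq_space_ge0// sqr_ge0. Qed.

Lemma measurable_weight_source : measurable_fun setT w.
Proof.
apply: measurable_weight.
  apply: measurable_funD; last exact: measurable_funX.
  exact: (measurableT_comp (@measurable_sq_space R d) mxi).
by move=> x; rewrite addr_ge0// ?sq_space_ge0// sqr_ge0.
Qed.

(** For [s <= |t|] one has [1 + |xi|^2 + s^2 <= (1 + |xi|^2) (1 + t^2)]: powers of [1 + t^2] pay for
    passing from the weight in [xi] alone to the weight of the source. *)
Lemma weight_time_le x t (k : nat) : s x <= `|t| ->
  (1 + sq_space (xi x)) ^- N * (1 + t ^+ 2) ^- (N + k) <= w x * (1 + t ^+ 2) ^- k.
Proof.
move=> st; have q0 := sq_space_ge0 (xi x : space); have t0 := sqr_ge0 t.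
have st2 : s x ^+ 2 <= t ^+ 2 by rewrite -[leRHS]real_normK ?num_real// lerXn2r ?nnegrE.
rewrite exprD invfM mulrA -invfM -exprMn; apply: ler_wpM2r.
  by rewrite invr_ge0 exprn_ge0// addr_ge0.
rewrite /w lef_pV2 ?posrE ?exprn_gt0//; last 2 first.
- by rewrite mulr_gt0// ltr_wpDr.
- by rewrite ltr_wpDr// addr_ge0// sqr_ge0.
have s20 := sqr_ge0 (s x).
apply: lerXn2r; rewrite ?nnegrE; nra.
Qed.

(** The exponent is one more than for the source: the additional factor [1 / (1 + t^2)] makes the
    integral over time finite. *)
Lemma spacetime_weight_le x t : s x <= `|t| ->
  (1 + (sq_space (xi x) + t ^+ 2)) ^- N.+1 <= w x * (1 + t ^+ 2)^-1.
Proof.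
move=> st; have q0 := sq_space_ge0 (xi x : space); have t0 := sqr_ge0 t.
have s20 := sqr_ge0 (s x).
have st2 : s x ^+ 2 <= t ^+ 2 by rewrite -[leRHS]real_normK ?num_real// lerXn2r ?nnegrE.
rewrite exprSr invfM; apply: ler_pM.
- by rewrite invr_ge0 exprn_ge0//; lra.
- by rewrite invr_ge0; lra.
- rewrite /w lef_pV2 ?posrE ?exprn_gt0//; try lra.
  by apply: lerXn2r; rewrite ?nnegrE; lra.
- by rewrite lef_pV2 ?posrE; lra.
Qed.

Let m : {measure set (T * measurableTypeR R) -> \bar R} := (lam \x leb)%E.

Definition inverse_square_half (t : R) : R := (0 <= t)%R%:R * (oneDsqr t)^-1.

Lemma inverse_square_half_ge0 t : 0 <= inverse_square_half t.
Proof. by rewrite mulr_ge0// invr_ge0 ltW// (lt_le_trans ltr01)// oneDsqr_ge1. Qed.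

Lemma measurable_inverse_square_half :
  measurable_fun setT (inverse_square_half : measurableTypeR R -> R).
Proof.
apply: measurable_funM; first by apply: measurable_ler_indic.
apply: continuous_measurable_fun; exact: continuous_oneDsqrV.
Qed.

Lemma integrable_inverse_square_half :
  leb.-integrable setT (EFin \o inverse_square_half).
Proof.
apply/integrableP; split; first by apply/measurable_EFinP; exact: measurable_inverse_square_half.
have mI : measurable (`[0, +oo[%classic : set (measurableTypeR R)) by exact: measurable_itv.
rewrite (_ : (\int[leb]_x _)%E = (\int[leb]_(t in `[0%R, +oo[) (oneDsqr t)^-1%:E)%E).
  by rewrite integral0y_oneDsqr ltry.
rewrite [RHS]integral_mkcond; apply: eq_integral => t _.
rewrite patchE mem_setE in_itv /= andbT ger0_norm ?inverse_square_half_ge0//.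
by rewrite /inverse_square_half; case: leP => _; rewrite ?mul1r ?mul0r.
Qed.

Lemma sq_space_bound (x : space) (M : R) : `|x| <= M -> sq_space x <= d%:R * M ^+ 2.
Proof.
move=> xM; have M0 : 0 <= M by exact: le_trans xM.
rewrite /sq_space; apply: (@le_trans _ _ (\sum_(i < d) M ^+ 2)).
  apply: ler_sum => i _; rewrite -real_normK ?num_real//.
  by apply: lerXn2r; rewrite ?nnegrE//; apply: le_trans xM; exact: coord_le_norm.
by rewrite sumr_const card_ord mulr_natl.
Qed.

(** When [xi] and [t] are bounded, so is every contributing [s <= |t|]; the weight of the source is
    then bounded below and the kernel is at most a multiple of it. This gives local finiteness for
    negative times too. *)
Lemma abs1_kern_local (M : R) : exists C : R, 0 <= C /\ forall x t,
  `|xi x : space| <= M -> `|t| <= M -> abs1 (kern (x, t)) <= C * w x.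
Proof.
have [G hG] := g_bounded M.
(* The first factor bounds the exponential for [|t| <= M], the second bounds the inverse of the
   weight of the contributing sources. *)
exists (4 * expR (`|M| * `|G|) * ((1 + d%:R * M ^+ 2) ^+ N * (1 + M ^+ 2) ^+ N)); split.
  have M2 := sqr_ge0 M.
  apply: mulr_ge0; first by apply: mulr_ge0 => //; exact: expR_ge0.
  by apply: mulr_ge0; apply: exprn_ge0; apply: addr_ge0 => //; apply: mulr_ge0.
move=> x t xM tM; apply: le_trans (abs1_kern x t) _.
have wx := weight_ge0 x.
have M0 : 0 <= M by exact: le_trans tM.
rewrite -[leRHS]mulrA.
apply: ler_pM.
- by rewrite mulr_ge0// expR_ge0.
- by [].
- rewrite ler_pM2l// ler_expR; apply: ler_pM => //.
  + by rewrite le_max lexx orbT.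
  + rewrite (ger0_norm M0) ge_max M0 andbT; apply: le_trans tM.
    by rewrite -normrN ler_norm.
  + apply: le_trans (ler_norm _) (le_trans (ler_Re_abs1 _) _).
    by apply: le_trans (hG _ xM) (ler_norm _).
case: (leP (s x) `|t|) => st; last first.
  apply: mulr_ge0 => //; have M2 := sqr_ge0 M.
  by apply: mulr_ge0; apply: exprn_ge0; apply: addr_ge0 => //; apply: mulr_ge0.
have q0 := sq_space_ge0 (xi x : space); have t0 := sqr_ge0 t; have M20 := sqr_ge0 M.
have := weight_time_le 0 st; rewrite addn0 expr0 invr1 mulr1 => h.
have A0 : 0 < (1 + sq_space (xi x)) ^+ N by rewrite exprn_gt0// ltr_wpDr.
have B0 : 0 < (1 + t ^+ 2) ^+ N by rewrite exprn_gt0// ltr_wpDr.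
apply: (@le_trans _ _ ((1 + sq_space (xi x)) ^+ N * (1 + t ^+ 2) ^+ N * w x)).
  by rewrite -ler_pdivrMl ?mulr_gt0// mulr1 invfM.
apply: ler_wpM2r => //; apply: ler_pM; try exact: ltW.
  apply: lerXn2r; rewrite ?nnegrE ?addr_ge0// ?mulr_ge0//.
  by rewrite lerD2l sq_space_bound.
apply: lerXn2r; rewrite ?nnegrE ?addr_ge0//.
by rewrite lerD2l -real_normK ?num_real// lerXn2r ?nnegrE.
Qed.

(** Supplies the product bound on which Fubini rests, with a multiple of the indicator of [[- M, M]]
    as the factor in time. *)
Lemma tensor_local (H : T * measurableTypeR R -> R[i]) (C0 M : R) : 0 <= C0 ->
  (forall x t, abs1 (H (x, t)) <= C0 * abs1 (kern (x, t))) ->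
  (forall x t, M < `|xi x : space| \/ M < `|t| -> H (x, t) = 0) ->
  exists v : measurableTypeR R -> R, [/\ measurable_fun setT v, forall t, 0 <= v t,
    leb.-integrable setT (EFin \o v) & forall x t, abs1 (H (x, t)) <= w x * v t].
Proof.
move=> C00 HC H0; have [C [C1 hC]] := abs1_kern_local M.
have iM := @integrable_indic_itv R (- M) M true false.
exists (fun t => (C0 * C) * \1_[set` Interval (BSide true (- M)) (BSide false M)] t); split.
- by apply: measurable_funM => //; apply: measurable_indic; exact: measurable_itv.
- by move=> t; apply: mulr_ge0 => //; apply: mulr_ge0.
- exact: (integrableZl measurableT (C0 * C) iM).
move=> x t; rewrite indicE mem_setE in_itv /= -ler_norml.
have [xM|xM] := leP `|xi x : space| M; last first.
  by rewrite H0; [rewrite /abs1 /= normr0 addr0 mulr_ge0 ?weight_ge0// mulr_ge0// mulr_ge0|left].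
have [tM|tM] := leP `|t| M; last first.
  by rewrite H0; [rewrite /abs1 /= normr0 addr0 mulr_ge0 ?weight_ge0// mulr_ge0// mulr_ge0|right].
apply: le_trans (HC _ _) _; rewrite mulr1 [leRHS]mulrC -[leRHS]mulrA; apply: ler_wpM2l => //.
exact: hC.
Qed.

Lemma kernp_eq0 x t : ~~ ((0 <= t) && (s x <= `|t|)) -> kernp (x, t) = 0.
Proof.
move=> h; apply: complex_eqP; apply/eqP; rewrite -normr_le0;
  apply: le_trans (le_trans (abs1_kernp x t) _); rewrite ?ler_Re_abs1 ?ler_Im_abs1//;
  by move: h; case: (leP 0 t) => //= _; case: leP => //= _ _; rewrite ?mulr0 ?mul0r.
Qed.

(** * The solution, its equation and its growth *)

Definition solution (B : set spacetime) : R[i] :=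
  if `[< bounded_borel B >] then Cint m (event @^-1` B) kern else 0.

Lemma event_norm (x : T) (t : R) : `|event (x, t) : spacetime| = Num.max `|xi x : space| `|t|.
Proof. by []. Qed.

Lemma represents_solution : represents m event kern solution.
Proof.
split => //; [exact: measurable_event|exact: cmeasurable_kern|].
move=> B bB; have mB : measurable (event @^-1` B).
  by rewrite -[X in measurable X]setTI; apply: measurable_event => //; case: bB.
apply/cintegrable_mkcond => //; first exact: cmeasurable_kern.
have /bounded_setP[M hM] := bB.1.
have [||v [mv v0 iv hv]] := @tensor_local (fun z => (\1_(event @^-1` B) z)%:C * kern z) 1 M ler01.
- move=> x t; rewrite mul1r; apply: le_trans (abs1M _ _) _; rewrite abs1_real.
  by rewrite indicE; case: (_ \in _); rewrite ?normr1 ?mul1r// normr0 mul0r abs1_ge0.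
- move=> x t h; rewrite indicE memNset ?mul0r// => /hM.
  by rewrite event_norm ge_max => /andP[h1 h2]; case: h; rewrite ltNge ?h1 ?h2.
apply: (cintegrable_tensor _ measurable_weight_source mv weight_ge0 v0 iw iv hv).
by apply: cmeasurableM; [exact: cmeasurable_indic|exact: cmeasurable_kern].
Qed.

(** The integrand is compared with [kern] instead of being bounded outright, so that the lemma
    covers both [V] and [g V]. *)
Lemma pairing_local (F : T * measurableTypeR R -> R[i]) (U : set spacetime -> R[i])
    (psi : spacetime -> R[i]) (C0 M : R) : represents m event F U ->
  continuous (psi : spacetime -> R[i]^o) -> 0 <= C0 ->
  (forall x t, abs1 (psi (event (x, t))) * abs1 (F (x, t)) <= C0 * abs1 (kern (x, t))) ->
  (forall z, M < `|z| -> psi z = 0) ->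
  pairing U psi = Cint m setT (fun z => psi (event z) * F z) /\
  cintegrable m setT (fun z => psi (event z) * F z).
Proof.
move=> rep cpsi C00 HC H0; have [mE mF _ _] := rep.
have mpsi : cmeasurable (fun z => psi (event z)).
  exact: (cmeasurable_comp (continuous_cmeasurable cpsi) mE).
have mA : measurable_fun setT (fun z => abs1 (psi (event z)) * abs1 (F z)).
  by apply: measurable_funM; exact: measurable_abs1.
have A0 z : 0 <= abs1 (psi (event z)) * abs1 (F z) by apply: mulr_ge0; exact: abs1_ge0.
have [||v [mv v0 iv hv]] :=
    @tensor_local (fun z => (abs1 (psi (event z)) * abs1 (F z))%:C) C0 M C00.
- by move=> x t; rewrite abs1_real ger0_norm.
- move=> x t h; rewrite H0 ?event_norm ?lt_max.
    by rewrite {1}/abs1 /= normr0 addr0 mul0r.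
  by case: h => ->; rewrite ?orbT.
have [_ iA] := cintegrable_tensor (cmeasurable_real mA)
  measurable_weight_source mv weight_ge0 v0 iw iv hv.
have {}iA : m.-integrable setT (EFin \o (fun z => abs1 (psi (event z)) * abs1 (F z))).
  by apply: eq_integrable iA => // z _; rewrite /= abs1_real ger0_norm.
split; last first.
  apply: (cintegrable_le _ _ iA) => //; first exact: cmeasurableM.
  by move=> z _; exact: abs1M.
rewrite /pairing (represents_integral rep)//.
exact: continuous_cmeasurable.
Qed.

(** Fubini is used with time inside: for each source, [transport_integral] leaves the value of the
    test function at the source point times [fY], and the remaining integral is the pairing with
    [Y]. *)
Lemma solution_evolution (Y : set spacetime -> R[i]) :
  represents lam (fun x => (xi x, s x) : borel spacetime) fY Y ->
  evolution_equation g solution Y.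
Proof.
move=> repY phi tphi.
have [cphi cdphi hcd [M [C hMC]]] := test_function_facts tphi.
set dphi := derive_complex (time_direction R d) phi in cdphi hcd hMC *.
have C0 : 0 <= C by apply: le_trans (abs1_ge0 (phi 0)) _; case: (hMC 0).
have phiC z : abs1 (phi z) <= C by case: (hMC z).
have dphiC z : abs1 (dphi z) <= C by case: (hMC z) => _ [].
have phi0 z : M < `|z| -> phi z = 0 by case: (hMC z) => _ [_ h] /h[].
have dphi0 z : M < `|z| -> dphi z = 0 by case: (hMC z) => _ [_ h] /h[].
have [G hG] := g_bounded M.
have cgz : continuous ((fun z : spacetime => g z.1) : spacetime -> R[i]^o).
  by move=> z; apply: (@continuous_comp _ _ _ fst (g : space -> R[i]^o)); [exact: cvg_fst|exact: cg].
have repgV : represents m event (fun z => g (event z).1 * kern z)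
    (radon_density (fun z => g z.1) solution).
  apply: (represents_density represents_solution (phi := fun z => g z.1)).
    exact: continuous_cmeasurable.
  move=> B /bounded_setP[M' hM']; have [C' hC'] := g_bounded M'.
  exists C' => z /hM' h; apply: hC'; apply: le_trans h.
  by rewrite spacetime_norm le_max lexx.
have [e1 i1] := pairing_local represents_solution cdphi C0
  (fun x t => ler_wpM2r (abs1_ge0 _) (dphiC _)) dphi0.
have [e2 i2] : pairing (radon_density (fun z => g z.1) solution) phi =
    Cint m setT (fun z => phi (event z) * (g (event z).1 * kern z)) /\
    cintegrable m setT (fun z => phi (event z) * (g (event z).1 * kern z)).
  apply: (@pairing_local _ _ phi (C * `|G|) M repgV cphi) => //; first exact: mulr_ge0.
  move=> x t; have [xM|xM] := leP `|xi x : space| M; last first.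
    rewrite phi0 ?event_norm ?lt_max ?xM// {1}/abs1 /= normr0 addr0 mul0r.
    by apply: mulr_ge0; [exact: mulr_ge0|exact: abs1_ge0].
  rewrite -mulrA; apply: ler_pM => //; rewrite ?abs1_ge0//.
  apply: le_trans (abs1M _ _) _; apply: ler_wpM2r; first exact: abs1_ge0.
  exact: le_trans (hG _ xM) (ler_norm _).
rewrite /derive_distribution -/dphi e1 e2 -CintN// -CintD//; last exact: cintegrableN.
pose H z := (- dphi (event z) + g (xi z.1) * phi (event z)) * kern z.
have mH : cmeasurable H.
  apply: cmeasurableM; last exact: cmeasurable_kern.
  have mE := measurable_event.
  apply: cmeasurableD; first by apply: cmeasurableN; exact: (cmeasurable_comp (continuous_cmeasurable cdphi) mE).
  apply: cmeasurableM; last exact: (cmeasurable_comp (continuous_cmeasurable cphi) mE).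
  apply: (cmeasurable_comp (continuous_cmeasurable cg)).
  exact: (measurableT_comp mxi measurable_fst).
rewrite (_ : Cint m setT _ = Cint m setT H); last first.
  by apply: eq_Cint => z _; rewrite /H /=; ring.
have [|||v [mv v0 iv hv]] := @tensor_local H (C + `|G| * C) M.
- by rewrite addr_ge0// mulr_ge0.
- move=> x t; apply: le_trans (abs1M _ _) _; apply: ler_wpM2r; first exact: abs1_ge0.
  have [xM|xM] := leP `|xi x : space| M; last first.
    rewrite phi0 ?event_norm ?lt_max ?xM// dphi0 ?event_norm ?lt_max ?xM//.
    by rewrite oppr0 mulr0 addr0 /abs1 /= normr0 addr0 addr_ge0// mulr_ge0.
  apply: le_trans (abs1D _ _) _; rewrite abs1N; apply: lerD => //.
  apply: le_trans (abs1M _ _) _; apply: ler_pM; rewrite ?abs1_ge0//.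
  exact: le_trans (hG _ xM) (ler_norm _).
- move=> x t h; have h' : M < `|event (x, t) : spacetime|.
    by rewrite event_norm lt_max; case: h => ->; rewrite ?orbT.
  by rewrite /H phi0// dphi0// oppr0 mulr0 addr0 mul0r.
rewrite (Cint_fubini1 mH measurable_weight_source mv weight_ge0 v0 iw iv hv).
have inner x : Cint leb setT (fun t => H (x, t)) = phi (xi x, s x) * fY x.
  have ev t : `|M| + 1 <= `|t| -> M < `|(xi x : space, t) : spacetime|.
    move=> h; rewrite spacetime_norm lt_max; apply/orP; right => /=.
    by have := ler_norm M; move: h => /=; lra.
  have cpair t : (fun r : R => (xi x : space, r) : spacetime) @ t --> ((xi x : space, t) : spacetime).
    exact: cvg_time_pair.
  have cont (f : spacetime -> R[i]) : continuous (f : spacetime -> R[i]^o) ->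
      continuous ((fun r => f (xi x, r)) : R -> R[i]^o).
    by move=> cf t; apply: (cvg_comp _ _ (cpair t) (cf _)).
  exact: (transport_integral (g (xi x)) (fY x) (f0 x) (s x) (hcd (xi x)) (cont _ cphi) (cont _ cdphi)
    (fun t h => phi0 _ (ev t h)) (fun t h => dphi0 _ (ev t h))).
transitivity (Cint lam setT (fun x => phi (xi x, s x) * fY x)).
  by apply: eq_Cint => x _; exact: inner.
have [mp _ _ _] := repY.
rewrite /pairing (represents_integral repY measurableT (continuous_cmeasurable cphi)).
  by rewrite preimage_setT.
(* [Q] bounds [1 + |xi|^2 + s^2] on the ball that carries [phi], so [Q ^ N] times the weight is at
   least 1 there. *)
pose Q := 1 + (d%:R * M ^+ 2 + M ^+ 2).
have M20 := sqr_ge0 M.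
have dM : 0 <= d%:R * M ^+ 2 by rewrite mulr_ge0.
rewrite preimage_setT; have iB := integrableZl measurableT (C * Q ^+ N) iw.
apply: (le_integrable measurableT) iB.
  apply/measurable_EFinP; apply: measurable_funM; last exact: measurable_abs1.
  exact: (measurable_abs1 (cmeasurable_comp (continuous_cmeasurable cphi) mp)).
move=> x _ /=; rewrite lee_fin ger0_norm; last by apply: mulr_ge0; exact: abs1_ge0.
have QN : 0 <= Q ^+ N by rewrite exprn_ge0// /Q; lra.
have wx := weight_ge0 x.
rewrite ger0_norm; last by apply: mulr_ge0 => //; exact: mulr_ge0.
have [zM|zM] := leP `|(xi x : space, s x) : spacetime| M; last first.
  by rewrite phi0// {1}/abs1 /= normr0 addr0 mul0r; apply: mulr_ge0 => //; exact: mulr_ge0.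
rewrite -[leLHS]mulr1 -[leRHS]mulrA; apply: (@le_trans _ _ (C * 1)).
  rewrite mulr1 mulr1 -[leRHS]mulr1; apply: ler_pM; rewrite ?abs1_ge0//.
apply: ler_wpM2l => //.
move: zM; rewrite spacetime_norm ge_max => /andP[/= xM sM].
have qx := sq_space_bound xM; have q0 := sq_space_ge0 (xi x : space).
have sq : s x ^+ 2 <= M ^+ 2.
  rewrite lerXn2r ?nnegrE//; first exact: le_trans sM.
  by apply: le_trans sM; exact: ler_norm.
have s20 := sqr_ge0 (s x).
rewrite /w ler_pdivlMr ?mul1r.
  by apply: lerXn2r; rewrite ?nnegrE /Q; lra.
by apply: exprn_gt0; lra.
Qed.

Lemma represents_positive_part :
  represents m event kernp (radon_density (@indicator_halfspace R d) solution).
Proof.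
have mhalf : measurable_fun setT (fun z : borel spacetime => (\1_(@halfspace R d) z : R)).
  apply: measurable_indic.
  rewrite (_ : @halfspace R d = snd @^-1` `[0, +oo[%classic).
    rewrite -[X in measurable X]setTI.
    by apply: (@measurable_spacetime_snd R d) => //; exact: measurable_itv.
  by apply/seteqP; split => z /=; rewrite in_itv /= andbT.
have := represents_density represents_solution (phi := @indicator_halfspace R d)
  (cmeasurable_real mhalf).
rewrite (_ : (fun z => indicator_halfspace _ * _) = kernp).
  apply => B _; exists 1 => z _; rewrite abs1_real indicE.
  by case: (_ \in _); rewrite ?normr1 ?normr0.
apply/funext => z; rewrite /kernp /indicator_halfspace indicE.
by rewrite (_ : (_ \in _) = (0 <= z.2)%R)//; apply/idP/idP; rewrite !inE.
Qed.

Lemma positive_part_slow_growing :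
  slow_growing_halfspace (radon_density (@indicator_halfspace R d) solution).
Proof.
split.
  apply: (represents_slow_growing represents_positive_part (N := N.+1)).
  - exact: measurable_sq_spacetime.
  - exact: sq_spacetime_ge0.
  have iv := integrableZl measurableT 4 integrable_inverse_square_half.
  have mv : measurable_fun setT (fun t : measurableTypeR R => 4 * inverse_square_half t).
    by apply: measurable_funM => //; exact: measurable_inverse_square_half.
  have iwv := integrable_tensor measurable_weight_source mv weight_ge0
    (fun t => mulr_ge0 (ler0n _ 4) (inverse_square_half_ge0 t)) iw iv.
  have mq : measurable_fun setT (fun z : T * measurableTypeR R => sq_spacetime (event z : spacetime)).
    exact: (measurableT_comp (@measurable_sq_spacetime R d) measurable_event).
  apply: (le_integrable measurableT) iwv.
    apply/measurable_EFinP; apply: measurable_funM; last exact: (measurable_abs1 cmeasurable_kernp).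
    by apply: measurable_weight => // z; exact: sq_spacetime_ge0.
  move=> [x t] _ /=; rewrite lee_fin.
  have A0 : 0 <= (1 + sq_spacetime (event (x, t) : spacetime)) ^- N.+1.
    by rewrite invr_ge0 exprn_ge0// addr_ge0// sq_spacetime_ge0.
  rewrite ger0_norm; last by apply: mulr_ge0 => //; exact: abs1_ge0.
  rewrite ger0_norm; last by apply: mulr_ge0; [exact: weight_ge0|apply: mulr_ge0 => //; exact: inverse_square_half_ge0].
  have [/andP[t0 st]|/kernp_eq0 ->] := boolP ((0 <= t) && (s x <= `|t|)); last first.
    rewrite [abs1 0]/abs1 /= normr0 addr0 mulr0.
    by apply: mulr_ge0; [exact: weight_ge0|apply: mulr_ge0 => //; exact: inverse_square_half_ge0].
  apply: (@le_trans _ _ ((w x * (1 + t ^+ 2)^-1) * 4)).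
    apply: ler_pM => //; first exact: abs1_ge0.
      exact: spacetime_weight_le.
    by apply: le_trans (abs1_kernp x t) _; rewrite t0 st !mulr1.
  by rewrite /inverse_square_half t0 mul1r mulrAC -mulrA mulrA mulrAC.
move=> z hz; apply: contrapT => /negP; rewrite -ltNge => z2.
(* The open set [t < 0] is null for the restricted measure, because [kernp] vanishes on it. *)
pose U : set spacetime := snd @^-1` `]-oo, 0[%classic.
have oU : open U.
  by apply: open_comp => [y _|]; [exact: cvg_snd|exact: interval_open].
have := hz U oU; rewrite /U /= in_itv /= => /(_ z2) /eqP; apply.
apply/eqP; rewrite eq_le radon_variation_ge0 ?andbT; last exact: borel_open.
apply: le_trans (represents_variation_le represents_positive_part (borel_open oU)) _.
rewrite integral0_eq// => -[x t]; rewrite /U /= in_itv /= => t0.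
by rewrite kernp_eq0 ?leNgt ?t0// /abs1 /= normr0 addr0.
Qed.

(** * Time slices of the solution *)

Definition solution_at (t : R) (B : set space) : R[i] :=
  if `[< bounded_borel B >] then Cint lam (xi @^-1` B) (fun x => kernp (x, t)) else 0.

Lemma cmeasurable_kernp_at t : cmeasurable (fun x => kernp (x, t)).
Proof. by apply: (cmeasurable_comp cmeasurable_kernp); exact: measurable_pair2. Qed.

Lemma represents_solution_at t : represents lam xi (fun x => kernp (x, t)) (solution_at t).
Proof.
split => //; first exact: cmeasurable_kernp_at.
move=> B bB; have mB : measurable (xi @^-1` B).
  by rewrite -[X in measurable X]setTI; apply: mxi => //; case: bB.
have /bounded_setP[M hM] := bB.1.
have [C [C0 hC]] := abs1_kern_local (Num.max M `|t|).
have iwB : lam.-integrable (xi @^-1` B) (EFin \o (fun x => C * w x)).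
  exact: (integrableZl mB C (integrableS measurableT mB (@subsetT _ _) iw)).
apply: (cintegrable_le mB (cmeasurable_kernp_at t) iwB) => x Bx.
apply: (@le_trans _ _ (abs1 (kern (x, t)))).
  apply: le_trans (abs1M _ _) _; rewrite abs1_real.
  by case: (0 <= _)%R; rewrite ?normr1 ?mul1r// normr0 mul0r abs1_ge0.
by apply: hC; rewrite le_max ?lexx ?orbT// hM.
Qed.

(** The weight of the source is recovered from that of [xi] at the price of [(1 + t^2) ^ N], which
    is only polynomial in time. *)
Lemma abs1_kernp_at x t : (1 + sq_space (xi x)) ^- N * abs1 (kernp (x, t)) <=
  4 * (1 + t ^+ 2) ^+ N * w x.
Proof.
have q0 := sq_space_ge0 (xi x : space); have t0 := sqr_ge0 t.
have t2 : 0 < (1 + t ^+ 2) ^+ N by rewrite exprn_gt0// ltr_wpDr.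
have [/andP[tp st]|/kernp_eq0 ->] := boolP ((0 <= t) && (s x <= `|t|)); last first.
  rewrite /abs1 /= normr0 addr0 mulr0; apply: mulr_ge0; last exact: weight_ge0.
  by apply: mulr_ge0 => //; exact: ltW.
have k4 : abs1 (kernp (x, t)) <= 4.
  by apply: le_trans (abs1_kernp x t) _; rewrite tp st !mulr1.
have := weight_time_le 0 st; rewrite addn0 expr0 invr1 mulr1 => h.
rewrite mulrC -mulrA; apply: ler_pM => //; first exact: abs1_ge0.
  by rewrite invr_ge0 exprn_ge0// addr_ge0.
by rewrite -ler_pdivrMl// mulrC.
Qed.

Lemma solution_at_slow_growing t : slow_growing (@sq_space R d) (solution_at t).
Proof.
apply: (represents_slow_growing (represents_solution_at t) (N := N)).
- exact: measurable_sq_space.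
- exact: sq_space_ge0.
have iB := integrableZl measurableT (4 * (1 + t ^+ 2) ^+ N) iw.
have mq : measurable_fun setT (fun x => sq_space (xi x : space)).
  exact: (measurableT_comp (@measurable_sq_space R d) mxi).
apply: (le_integrable measurableT) iB.
  apply/measurable_EFinP; apply: measurable_funM; last exact: (measurable_abs1 (cmeasurable_kernp_at t)).
  by apply: measurable_weight => // x; exact: sq_space_ge0.
move=> x _ /=; rewrite lee_fin ger0_norm.
  by apply: le_trans (abs1_kernp_at x t) (ler_norm _).
apply: mulr_ge0; last exact: abs1_ge0.
by rewrite invr_ge0 exprn_ge0// addr_ge0// sq_space_ge0.
Qed.

Lemma pairing_at_bound (phi : space -> R[i]) (C : R) x t : 0 <= C ->
  (forall y, abs1 (phi y) <= C * (1 + sq_space y) ^- N) ->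
  abs1 (phi (xi x)) * abs1 (kernp (x, t)) <= C * (4 * (1 + t ^+ 2) ^+ N) * w x.
Proof.
move=> C0 hC; apply: (@le_trans _ _ (C * (1 + sq_space (xi x)) ^- N * abs1 (kernp (x, t)))).
  by apply: ler_wpM2r; [exact: abs1_ge0|exact: hC].
by rewrite -!mulrA; apply: ler_wpM2l => //; rewrite mulrA; exact: abs1_kernp_at.
Qed.

Lemma pairing_solution_at (phi : space -> R[i]) t :
  fast_decreasing (@sq_space R d) phi ->
  pairing (solution_at t) phi = Cint lam setT (fun x => phi (xi x) * kernp (x, t)) /\
  cintegrable lam setT (fun x => phi (xi x) * kernp (x, t)).
Proof.
move=> fphi; have [C [C0 hC]] := fast_decreasing_bound N (@sq_space_ge0 R d) fphi.
have cphi := continuous_cmeasurable fphi.1.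
have mphi : cmeasurable (fun x => phi (xi x)) by exact: (cmeasurable_comp cphi mxi).
have iB := integrableZl measurableT (C * (4 * (1 + t ^+ 2) ^+ N)) iw.
split.
  rewrite /pairing (represents_integral (represents_solution_at t) measurableT cphi).
    by rewrite preimage_setT.
  rewrite preimage_setT; apply: (le_integrable measurableT) iB.
    apply/measurable_EFinP; apply: measurable_funM; first exact: (measurable_abs1 mphi).
    exact: (measurable_abs1 (cmeasurable_kernp_at t)).
  move=> x _ /=; rewrite lee_fin ger0_norm; last by apply: mulr_ge0; exact: abs1_ge0.
  by apply: le_trans (ler_norm _); exact: pairing_at_bound.
apply: (cintegrable_le measurableT _ iB).
  by apply: cmeasurableM => //; exact: cmeasurable_kernp_at.
by move=> x _; apply: le_trans (abs1M _ _) _; exact: pairing_at_bound.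
Qed.

(** Dominated convergence along sequences of times. From the right the kernel tends to its value;
    from the left it tends to the same expression [L] with strict indicators. *)
Lemma solution_at_cadlag (phi : space -> R[i]) :
  fast_decreasing (@sq_space R d) phi -> cadlag (fun t => pairing (solution_at t) phi).
Proof.
move=> fphi; have [C [C0 hC]] := fast_decreasing_bound N (@sq_space_ge0 R d) fphi.
have mphi : cmeasurable (fun x => phi (xi x)).
  exact: (cmeasurable_comp (continuous_cmeasurable fphi.1) mxi).
have eh : (fun t => pairing (solution_at t) phi) =
    (fun t => Cint lam setT (fun x => phi (xi x) * kernp (x, t))).
  by apply/funext => t; case: (pairing_solution_at t fphi).
have dct (u : nat -> R) (t : R) (L : T -> R[i]) : u @ \oo --> t -> cmeasurable L ->
    (forall x, (kernp (x, u n) : R[i]^o) @[n --> \oo] --> (L x : R[i]^o)) ->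
    (Cint lam setT (fun x => phi (xi x) * kernp (x, u n)) : R[i]^o) @[n --> \oo] -->
    (Cint lam setT (fun x => phi (xi x) * L x) : R[i]^o).
  move=> ut mL hL.
  (* A convergent sequence of times is bounded, which makes the polynomial factor in time uniform in
     [n]. *)
  have [B hB] : exists B : R, forall n, `|u n| <= B.
    have : cvgn u by apply/cvg_ex; exists t.
    move=> /cvg_seq_bounded[M [_ hM]]; exists (M + 1) => n.
    by apply: hM => //; rewrite ltrDl.
  have iB := integrableZl measurableT (C * (4 * (1 + B ^+ 2) ^+ N)) iw.
  apply: (@Cint_dominated _ _ _ lam setT (fun n x => phi (xi x) * kernp (x, u n))
    (fun x => phi (xi x) * L x) _ measurableT _ _ _ iB).
  - by move=> n; apply: cmeasurableM => //; exact: cmeasurable_kernp_at.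
  - exact: cmeasurableM.
  - by move=> x _; apply: cvg_complexM; [exact: cvg_cst|exact: hL].
  - move=> n x _; apply: le_trans (abs1M _ _) _.
    apply: le_trans (pairing_at_bound x (u n) C0 hC) _.
    apply: ler_wpM2r; first exact: weight_ge0.
    apply: ler_wpM2l => //; rewrite ler_pM2l//; apply: lerXn2r; rewrite ?nnegrE ?addr_ge0 ?sqr_ge0//.
    rewrite lerD2l -real_normK ?num_real// lerXn2r ?nnegrE//.
    exact: le_trans (hB 0%N).
rewrite eh => t; split.
  apply: cvg_at_right_complex => u ut uc.
  apply: (dct u t (fun x => kernp (x, t))) => //; first exact: cmeasurable_kernp_at.
  move=> x; exact: (@cvg_transport R (fun n => (0 <= u n)%R%:R) (fun n => (s x <= u n)%R%:R) u
    _ _ t (s x) (s x <= 0)%R%:R (g (xi x)) (fY x) (f0 x)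
    (cvg_step_right (c := 0) ut uc) (cvg_step_right (c := s x) ut uc) uc).
apply/cvg_ex; pose L x := ((0 < t)%R%:R)%:C *
  (cexp (- ((t - s x)%:C * g (xi x))) * ((s x < t)%R%:R - (s x <= 0)%R%:R)%:C * fY x +
   cexp (- (t%:C * g (xi x))) * f0 x).
have hL u : (forall n, u n < t) -> u @ \oo --> t -> forall x,
    (kernp (x, u n) : R[i]^o) @[n --> \oo] --> (L x : R[i]^o).
  move=> ut uc x; exact: (@cvg_transport R (fun n => (0 <= u n)%R%:R) (fun n => (s x <= u n)%R%:R) u
    _ _ t (s x) (s x <= 0)%R%:R (g (xi x)) (fY x) (f0 x)
    (cvg_step_left (c := 0) ut uc) (cvg_step_left (c := s x) ut uc) uc).
exists (Cint lam setT (fun x => phi (xi x) * L x)).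
apply: cvg_at_left_complex => u ut uc; apply: (dct u t L) => //; last exact: hL.
(* [L] is measurable as a pointwise limit of the kernels along the sequence. *)
have mLr (h : R[i] -> R) : (forall n, measurable_fun setT (fun x => h (kernp (x, u n)))) ->
    (forall x, h (kernp (x, u n)) @[n --> \oo] --> h (L x)) ->
    measurable_fun setT (fun x => h (L x)).
  move=> mh hh; apply: (@measurable_fun_cvg _ _ _ _ (fun n x => h (kernp (x, u n)))) => //.
split; apply: mLr => [n|x].
- by case: (cmeasurable_kernp_at (u n)).
- by have /cvg_complexP[] := hL u ut uc x.
- by case: (cmeasurable_kernp_at (u n)).
- by have /cvg_complexP[] := hL u ut uc x.
Qed.

(** Of the [N + 1] powers of [1 + t^2], [N] pay for the weight of the source and one is left to
    integrate over time. *)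
Lemma pairing_spacetime_bound (phi : space -> R[i]) (C : R) x t : 0 <= C ->
  (forall y, abs1 (phi y) <= C * (1 + sq_space y) ^- N) ->
  abs1 (phi (xi x)) * (1 + t ^+ 2) ^- (N + 1) * abs1 (kernp (x, t)) <=
  w x * (4 * C * inverse_square_half t).
Proof.
move=> C0 hC; have t20 := sqr_ge0 t.
have [/andP[t0 st]|/kernp_eq0 ->] := boolP ((0 <= t) && (s x <= `|t|)); last first.
  rewrite [abs1 0]/abs1 /= normr0 addr0 mulr0; apply: mulr_ge0; first exact: weight_ge0.
  by apply: mulr_ge0; [exact: mulr_ge0|exact: inverse_square_half_ge0].
have k4 : abs1 (kernp (x, t)) <= 4.
  by apply: le_trans (abs1_kernp x t) _; rewrite t0 st !mulr1.
have T0 : 0 <= (1 + t ^+ 2) ^- (N + 1) by rewrite invr_ge0 exprn_ge0// addr_ge0.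
apply: (@le_trans _ _ (C * ((1 + sq_space (xi x)) ^- N * (1 + t ^+ 2) ^- (N + 1)) * 4)).
  apply: ler_pM => //; try exact: abs1_ge0.
    by apply: mulr_ge0 => //; exact: abs1_ge0.
  by rewrite mulrA; apply: ler_wpM2r.
have h := weight_time_le 1 st; rewrite expr1 in h.
rewrite /inverse_square_half t0 mul1r.
apply: (@le_trans _ _ (C * (w x * (1 + t ^+ 2)^-1) * 4)).
  by apply: ler_wpM2r => //; apply: ler_wpM2l.
by rewrite le_eqVlt; apply/orP; left; apply/eqP; rewrite /oneDsqr; ring.
Qed.

Lemma solution_cadlag_representation :
  cadlag_representation (radon_density (@indicator_halfspace R d) solution) solution_at.
Proof.
split; first by case: positive_part_slow_growing.
split; first exact: solution_at_slow_growing.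
move=> phi fphi h.
have [C [C0 hC]] := fast_decreasing_bound N (@sq_space_ge0 R d) fphi.
have cphi := continuous_cmeasurable fphi.1.
have hE t : h t = Cint lam setT (fun x => phi (xi x) * kernp (x, t)).
  by case: (pairing_solution_at t fphi).
have mphi : cmeasurable (fun z : T * measurableTypeR R => phi (xi z.1)).
  exact: (cmeasurable_comp cphi (measurableT_comp mxi measurable_fst)).
pose H (z : T * measurableTypeR R) := phi (xi z.1) * kernp z.
have mH : cmeasurable H by apply: cmeasurableM => //; exact: cmeasurable_kernp.
have iv4 := integrableZl measurableT (4 * C) integrable_inverse_square_half.
have mv4 : measurable_fun setT (fun t : measurableTypeR R => 4 * C * inverse_square_half t).
  by apply: measurable_funM => //; exact: measurable_inverse_square_half.
have v40 t : 0 <= 4 * C * inverse_square_half t.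
  by apply: mulr_ge0; [exact: mulr_ge0|exact: inverse_square_half_ge0].
have iwv := integrable_tensor measurable_weight_source mv4 weight_ge0 v40 iw iv4.
have mabsH : measurable_fun setT (fun z => abs1 (phi (xi z.1)) * abs1 (kernp z)).
  by apply: measurable_funM; apply: measurable_abs1 => //; exact: cmeasurable_kernp.
split; first exact: solution_at_cadlag.
  (* By Fubini the density [h dt] is the image of [H] times the product measure under the projection
     to time, so its slow growth is again a case of [represents_slow_growing]. *)
  have rep : represents m (fun z => z.2 : borel R^o) H (Defs.lebesgue_density h).
    have m2 : measurable_fun setT (fun z : T * measurableTypeR R => z.2 : borel R^o).
      by apply: measurable_to_borel_line; exact: measurable_snd.
    have tens B : bounded_borel B -> exists v : measurableTypeR R -> R,
        [/\ measurable_fun setT v, forall t, 0 <= v t, leb.-integrable setT (EFin \o v) &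
        forall x t, abs1 ((\1_((fun z : T * measurableTypeR R => z.2) @^-1` B) (x, t))%:C * H (x, t)) <= w x * v t].
      move=> bB; have /bounded_setP[M hM] := bB.1.
      pose K := C * (4 * (1 + M ^+ 2) ^+ N).
      have K0 : 0 <= K.
        by apply: mulr_ge0 => //; apply: mulr_ge0 => //; apply: exprn_ge0; rewrite addr_ge0 ?sqr_ge0.
      have iM := @integrable_indic_itv R (- M) M true false.
      exists (fun t => K * \1_[set` Interval (BSide true (- M)) (BSide false M)] t); split.
      - by apply: measurable_funM => //; apply: measurable_indic; exact: measurable_itv.
      - by move=> t; apply: mulr_ge0.
      - exact: (integrableZl measurableT K iM).
      move=> x t; apply: le_trans (abs1M _ _) _; rewrite abs1_real indicE.
      have [Bt|nBt] := boolP ((x, t) \in (fun z : T * measurableTypeR R => z.2) @^-1` B); last first.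
        rewrite normr0 mul0r; apply: mulr_ge0; first exact: weight_ge0.
        exact: mulr_ge0.
      rewrite normr1 mul1r indicE mem_setE in_itv /= -ler_norml.
      have tM : `|t| <= M by apply: hM; move: Bt; rewrite inE.
      rewrite tM mulr1 mulrC; apply: le_trans (abs1M _ _) _.
      apply: le_trans (pairing_at_bound x t C0 hC) _.
      apply: ler_wpM2r; first exact: weight_ge0.
      apply: ler_wpM2l => //; rewrite ler_pM2l//; apply: lerXn2r; rewrite ?nnegrE ?addr_ge0 ?sqr_ge0//.
      by rewrite lerD2l -real_normK ?num_real// lerXn2r ?nnegrE//; apply: le_trans tM.
    have mB2 B : bounded_borel B -> measurable ((fun z : T * measurableTypeR R => z.2) @^-1` B).
      by move=> bB; rewrite -[X in measurable X]setTI; apply: m2 => //; case: bB.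
    have mHB B : bounded_borel B -> cmeasurable
        (fun z => (\1_((fun z : T * measurableTypeR R => z.2) @^-1` B) z)%:C * H z).
      by move=> bB; apply: cmeasurableM => //; apply: cmeasurable_indic; exact: mB2.
    split => //.
      move=> B bB; have [v [mv v0 iv hv]] := tens B bB.
      apply/(cintegrable_mkcond _ (mB2 B bB) mH).
      exact: (cintegrable_tensor (mHB B bB) measurable_weight_source mv weight_ge0 v0 iw iv hv).
    move=> B; rewrite /Defs.lebesgue_density; case: asboolP => // bB.
    have [v [mv v0 iv hv]] := tens B bB.
    rewrite Cint_mkcond (Cint_fubini2 (mHB B bB) measurable_weight_source mv weight_ge0 v0 iw iv hv).
    transitivity (Cint leb B h) => //; rewrite [LHS]Cint_mkcond; apply: eq_Cint => t _.
    rewrite hE -CintZ//; last by case: (pairing_solution_at t fphi).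
  apply: (represents_slow_growing rep (N := N + 1)).
  - exact: measurable_sq_time.
  - by move=> t; exact: sqr_ge0.
  apply: (le_integrable measurableT) iwv.
    apply/measurable_EFinP; apply: measurable_funM; last exact: measurable_abs1.
    apply: measurable_weight => [|z]; last exact: sqr_ge0.
    by apply: measurable_funX; exact: measurable_snd.
  move=> [x t] _ /=; rewrite lee_fin.
  have A0 : 0 <= (1 + sq_time t) ^- (N + 1) by rewrite invr_ge0 exprn_ge0// addr_ge0// sqr_ge0.
  rewrite ger0_norm; last by apply: mulr_ge0 => //; exact: abs1_ge0.
  rewrite ger0_norm; last by apply: mulr_ge0 => //; exact: weight_ge0.
  apply: le_trans (pairing_spacetime_bound x t C0 hC).
  rewrite mulrAC mulrC; apply: ler_wpM2r => //; exact: abs1M.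
move=> theta ftheta.
have [D [D0 hD]] := fast_decreasing_bound (N + 1) (fun t : R^o => sqr_ge0 t) ftheta.
have ctheta := continuous_cmeasurable_line ftheta.1.
have mtheta : cmeasurable (fun z : T * measurableTypeR R => theta z.2).
  exact: (cmeasurable_comp ctheta measurable_snd).
pose v t := D * (4 * C * inverse_square_half t).
have mv : measurable_fun setT (v : measurableTypeR R -> R) by exact: measurable_funM.
have v0 t : 0 <= v t by exact: mulr_ge0.
have iv : leb.-integrable setT (EFin \o v) := integrableZl measurableT D iv4.
have bound x t : abs1 (phi (xi x) * theta t) * abs1 (kernp (x, t)) <= w x * v t.
  apply: (@le_trans _ _ (D * (abs1 (phi (xi x)) * (1 + t ^+ 2) ^- (N + 1) * abs1 (kernp (x, t))))).
    rewrite mulrA; apply: ler_wpM2r; first exact: abs1_ge0.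
    apply: le_trans (abs1M _ _) _; rewrite mulrCA; apply: ler_wpM2l; first exact: abs1_ge0.
    exact: hD.
  rewrite /v [leRHS]mulrCA; apply: ler_wpM2l => //.
  exact: pairing_spacetime_bound.
have mpt : cmeasurable (fun z : T * measurableTypeR R => phi (xi z.1) * theta z.2).
  exact: cmeasurableM.
have mF : cmeasurable (fun z : T * measurableTypeR R => phi (xi z.1) * theta z.2 * kernp z).
  by apply: cmeasurableM => //; exact: cmeasurable_kernp.
have boundF x t : abs1 (phi (xi x) * theta t * kernp (x, t)) <= w x * v t.
  by apply: le_trans (abs1M _ _) _; exact: bound.
have mbox : cmeasurable (boxtimes phi theta : borel spacetime -> R[i]).
  apply: cmeasurableM; first exact: (cmeasurable_comp cphi (@measurable_spacetime_fst R d)).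
  exact: (cmeasurable_comp ctheta (@measurable_spacetime_snd R d)).
have iwv2 := integrable_tensor measurable_weight_source mv weight_ge0 v0 iw iv.
rewrite /pairing (represents_integral represents_positive_part measurableT mbox); last first.
  rewrite preimage_setT; apply: (le_integrable measurableT) iwv2.
    apply/measurable_EFinP; apply: measurable_funM; first exact: (measurable_abs1 mpt).
    exact: (measurable_abs1 cmeasurable_kernp).
  move=> [x t] _ /=; rewrite lee_fin ger0_norm; last by apply: mulr_ge0; exact: abs1_ge0.
  by apply: le_trans (ler_norm _); exact: bound.
rewrite preimage_setT.
transitivity (Cint m setT (fun z => phi (xi z.1) * theta z.2 * kernp z)) => //.
rewrite (Cint_fubini2 mF measurable_weight_source mv weight_ge0 v0 iw iv boundF).
transitivity (Cint leb setT (fun t => h t * theta t)) => //.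
apply: eq_Cint => t _; rewrite hE mulrC -CintZ//; last by case: (pairing_solution_at t fphi).
by apply: eq_Cint => x _ /=; ring.
Qed.

(** At [t = 0] the two indicators of the kernel cancel, also for sources at [s = 0], and the
    exponential in front of [f0] equals 1. *)
Lemma solution_at0 (V0 : set space -> R[i]) : represents lam xi f0 V0 -> solution_at 0 = V0.
Proof.
move=> [_ _ _ V0E]; apply/funext => B; rewrite V0E /solution_at; case: asboolP => // _.
apply: eq_Cint => x _; rewrite /kernp /kern /= lexx subrr mulr0 mul0r add0r.
by rewrite mul0r oppr0 cexp0 !mul1r.
Qed.

Lemma duhamel_exists (Y : set spacetime -> R[i]) (V0 : set space -> R[i]) :
  represents lam (fun x => (xi x, s x) : borel spacetime) fY Y ->
  represents lam xi f0 V0 ->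
  exists V : set spacetime -> R[i],
    [/\ radon V, evolution_equation g V Y,
        slow_growing_halfspace (radon_density (@indicator_halfspace R d) V) &
        exists2 Vt : R -> set space -> R[i],
          cadlag_representation (radon_density (@indicator_halfspace R d) V) Vt & Vt 0 = V0].
Proof.
move=> repY repV0; exists solution; split.
- exact: (represents_radon represents_solution).
- exact: solution_evolution.
- exact: positive_part_slow_growing.
- by exists solution_at; [exact: solution_cadlag_representation|exact: solution_at0].
Qed.

End duhamel_kernel.

(** * Existence *)

Section existence.
Context (R : realType) (d : nat).
Local Notation space := 'rV[R]_d.
Local Notation spacetime := ((('rV[R]_d * R^o)%type : normedModType R)).

Lemma radonU (E : normedModType R) (mu : set E -> R[i]) A B : radon mu ->
  bounded_borel A -> bounded_borel B -> A `&` B = set0 -> mu (A `|` B) = mu A + mu B.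
Proof.
move=> rmu bA bB AB; apply: complex_eqP; rewrite ?cReD ?cImD.
  exact: (real_radonU (radon_Re rmu)).
exact: (real_radonU (radon_Im rmu)).
Qed.

Lemma represents0 dT (T : measurableType dT) (lam : {measure set T -> \bar R})
    (E : normedModType R) (p : T -> borel E) : measurable_fun setT p ->
  represents lam p (fun _ => 0) (fun _ => 0).
Proof.
move=> mp; have c0 : cmeasurable (fun _ : T => 0 : R[i]) by exact: cmeasurable_cst.
split => //.
  move=> B bB; split; first exact: cmeasurable_cst.
  by rewrite (_ : EFin \o _ = cst 0%E)//; [exact: integrable0|apply/funext => x /=; rewrite /abs1 /= normr0 addr0].
move=> B; case: asboolP => // _; apply: complex_eqP => /=; rewrite /Rintegral integral0//.
Qed.

(** Where the density vanishes the position may be changed freely; this makes all source times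
    nonnegative. *)
Lemma represents_reparam dT (T : measurableType dT) (lam : {measure set T -> \bar R})
    (E : normedModType R) (p q : T -> borel E) (f : T -> R[i]) (mu : set E -> R[i]) :
  represents lam p f mu -> measurable_fun setT q -> (forall x, f x = 0 \/ q x = p x) ->
  represents lam q f mu.
Proof.
move=> rep mq pq; have [mp mf fi muE] := rep.
have mqB B : bounded_borel B -> measurable (q @^-1` B).
  by move=> bB; rewrite -[X in measurable X]setTI; apply: mq => //; case: bB.
have mpB B : bounded_borel B -> measurable (p @^-1` B).
  by move=> bB; apply: (represents_preimage rep); case: bB.
have e B : (fun x => (\1_(q @^-1` B) x)%:C * f x) = (fun x => (\1_(p @^-1` B) x)%:C * f x).
  apply/funext => x; have [->|qp] := pq x; first by rewrite !mulr0.
  rewrite !indicE (_ : (x \in q @^-1` B) = (x \in p @^-1` B))//.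
  by apply/idP/idP; rewrite !inE /= qp.
split => //.
  move=> B bB; apply/(cintegrable_mkcond _ (mqB B bB) mf); rewrite e.
  by apply/(cintegrable_mkcond _ (mpB B bB) mf); exact: fi.
by move=> B; rewrite muE; case: asboolP => // bB; rewrite Cint_mkcond [RHS]Cint_mkcond e.
Qed.

Lemma symbol_function_bounded (g : space -> R[i]) : symbol_function g ->
  forall M : R, exists C : R, forall x, `|x| <= M -> abs1 (g x) <= C.
Proof.
move=> [_ [M0 [N0 hg]] _ _] M; exists (2 * (`|M0| * (1 + d%:R * M ^+ 2) ^+ N0)) => x xM.
apply: le_trans (abs1_normc _) _; rewrite ler_pM2l//; apply: le_trans (hg x) _.
have q0 := sq_space_ge0 x; have qM := sq_space_bound xM.
have A0 : 0 <= (1 + sq_space x) ^+ N0 by apply: exprn_ge0; lra.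
apply: (@le_trans _ _ (`|M0| * (1 + sq_space x) ^+ N0)).
  by apply: ler_wpM2r => //; exact: ler_norm.
by apply: ler_wpM2l => //; apply: lerXn2r; rewrite ?nnegrE; lra.
Qed.

Lemma weight_exponent_le (a : R) (m n : nat) : 0 <= a -> (m <= n)%N ->
  (1 + a) ^- n <= (1 + a) ^- m.
Proof.
move=> a0 mn; rewrite lef_pV2 ?posrE ?exprn_gt0 ?ltr_wpDr//.
by apply: ler_weXn2l => //; rewrite lerDl.
Qed.

Lemma existence_of_solution (Y : set spacetime -> R[i]) (hY : slow_growing_halfspace Y)
    (g : space -> R[i]) (hg : symbol_function g)
    (g_cont : continuous (g : space -> R[i]^o))
    (g_re : forall xi, 0 <= Re (g xi))
    (V0 : set space -> R[i]) (hV0 : slow_growing (@sq_space R d) V0) :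
  exists V : set spacetime -> R[i],
    [/\ radon V, evolution_equation g V Y,
        slow_growing_halfspace (radon_density (@indicator_halfspace R d) V) &
        exists2 Vt : R -> set space -> R[i],
          cadlag_representation (radon_density (@indicator_halfspace R d) V) Vt & Vt 0 = V0].
Proof.
have [[rY /= [N1 iY]] suppY] := hY; have [rV0 /= [N2 iV0]] := hV0.
have [d1 [T1 [l1 [p1 [f1 [rep1 f11 w1]]]]]] := radon_dominated_representation rY.
have [d2 [T2 [l2 [p2 [f2 [rep2 f21 w2]]]]]] := radon_dominated_representation rV0.
have [mp1 mf1 if1 YE] := rep1; have [mp2 mf2 if2 V0E] := rep2.
have mp11 : measurable_fun setT (fun x => (p1 x : spacetime).1 : borel space).
  exact: (measurableT_comp (@measurable_spacetime_fst R d) mp1).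
have mp12 : measurable_fun setT (fun x => (p1 x : spacetime).2 : R).
  exact: (measurableT_comp (@measurable_spacetime_snd R d) mp1).
have mhalf := @measurable_halfspace R d.
(* The Duhamel kernel asks for nonnegative source times. By the support condition, cutting the
   density off at negative times does not change [Y], and after that the time can be replaced by its
   absolute value. *)
pose s1 x := `|(p1 x : spacetime).2|.
have ms1 : measurable_fun setT s1 by exact: measurableT_comp.
pose h1 x := (\1_(@halfspace R d) (p1 x))%:C * f1 x.
have mi1 : cmeasurable (fun x => (\1_(@halfspace R d) (p1 x) : R)%:C).
  have mi := @cmeasurable_indic _ (borel spacetime) R (@halfspace R d) mhalf.
  exact: (@cmeasurable_comp _ _ _ (borel spacetime) _ _ _ mi mp1).
have mh1 : cmeasurable h1 by exact: cmeasurableM.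
have h11 x : abs1 (h1 x) <= 1.
  apply: le_trans (abs1M _ _) _; rewrite abs1_real indicE.
  by case: (_ \in _); rewrite ?normr1 ?mul1r// normr0 mul0r.
have repY1 : represents l1 p1 h1 Y.
  split => //.
    move=> B bB; apply: (@cintegrableM_bounded _ _ _ _ _ _ _ 1) => //; last exact: if1.
      by apply: (represents_preimage rep1); case: bB.
    by move=> x _; rewrite abs1_real indicE; case: (_ \in _); rewrite ?normr1 ?normr0.
  move=> B; case: asboolP => [bB|nB]; last by case: rY => ->.
  have bH := bounded_borelIr bB mhalf.
  have mC : measurable (~` @halfspace R d : set (borel spacetime)) by exact: measurableC.
  have bC := bounded_borelIr bB mC.
  have BE : B = (B `&` @halfspace R d) `|` (B `&` ~` @halfspace R d).
    by rewrite -setIUr setUv setIT.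
  rewrite [in LHS]BE radonU//; last by rewrite setIACA setICr setI0.
  rewrite (radon_null_outside_support (@rational_event_dense R d) rY bC) ?addr0; last first.
    by apply/seteqP; split => // z [[_ nH] /suppY].
  rewrite (representsE rep1 bH) Cint_mkcond [RHS]Cint_mkcond; apply: eq_Cint => x _.
  rewrite /h1 mulrA -rmorphM; congr (_%:C * _).
  rewrite !indicE -natrM mulnb; congr ((nat_of_bool _)%:R).
  by apply/idP/andP => [|[]]; rewrite !inE.
have repY2 : represents l1 (fun x => ((p1 x : spacetime).1, s1 x) : borel spacetime) h1 Y.
  apply: (represents_reparam repY1); first exact: measurable_to_spacetime.
  move=> x; rewrite /h1 /s1 indicE.
  have [|] := boolP (p1 x \in @halfspace R d); last by left; rewrite mul0r.
  by rewrite inE => hx; right; rewrite ger0_norm//; case: (p1 x) hx.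
pose zero1 (_ : T1) : R[i] := 0; pose zero2 (_ : T2) : R[i] := 0.
pose lam := glue_measure l1 l2.
pose xi : T1 * T2 * bool -> borel space := glue (fun x => (p1 x : spacetime).1) p2.
(* The component that carries [V0] has source time 0; on the other one the density of [V0] is
   zero. *)
pose s : T1 * T2 * bool -> R := glue s1 (fun _ : T2 => 0).
have repY : represents lam (fun x => (xi x, s x) : borel spacetime) (glue h1 zero2) Y.
  have mq : measurable_fun setT (fun y : T2 => (p2 y, 0) : borel spacetime).
    by apply: measurable_to_spacetime => //=; exact: measurable_cst.
  have := represents_glue repY2 (represents0 l2 mq) (fun B => esym (addr0 (Y B))).
  by congr (represents _ _ _ _); apply/funext => -[[? ?] []].
have repV0 : represents lam xi (glue zero1 f2) V0.
  exact: (represents_glue (represents0 l1 mp11) rep2 (fun B => esym (add0r (V0 B)))).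
(* A larger exponent makes the weights smaller, so [N1 + N2] serves for both data. *)
apply: (@duhamel_exists R d _ _ lam xi s (glue h1 zero2) (glue zero1 f2) _ _ _ _ _ _ _ _ g _ _ _ (N1 + N2)%N _ Y V0 repY repV0) => //.
- exact: measurable_glue.
- by apply: measurable_glue => //; exact: measurable_cst.
- by move=> -[[x y] []] /=; rewrite /s /glue //= /s1.
- by move=> -[[x y] []]; [left|right].
- by apply: cmeasurable_glue => //; exact: cmeasurable_cst.
- by apply: cmeasurable_glue => //; exact: cmeasurable_cst.
- by move=> -[[x y] []]; rewrite /glue /=; [exact: h11|rewrite /zero2 /abs1 /= normr0 addr0].
- by move=> -[[x y] []]; rewrite /glue /=; [rewrite /zero1 /abs1 /= normr0 addr0|exact: f21].
- exact: symbol_function_bounded.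
pose w1' x := (1 + (sq_space (p1 x : spacetime).1 + s1 x ^+ 2)) ^- (N1 + N2).
pose w2' y := (1 + (sq_space (p2 y : space) + 0 ^+ 2)) ^- (N1 + N2).
have q1 x : 0 <= sq_space (p1 x : spacetime).1 + s1 x ^+ 2.
  by rewrite addr_ge0 ?sq_space_ge0 ?sqr_ge0.
have q2 y : 0 <= sq_space (p2 y : space) + 0 ^+ 2 by rewrite addr_ge0 ?sq_space_ge0 ?sqr_ge0.
have mw1 : measurable_fun setT w1'.
  apply: measurable_weight => //; apply: measurable_funD; last exact: measurable_funX.
  exact: (measurableT_comp (@measurable_sq_space R d) mp11).
have mw2 : measurable_fun setT w2'.
  apply: measurable_weight => //; apply: measurable_funD; last exact: measurable_cst.
  exact: (measurableT_comp (@measurable_sq_space R d) mp2).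
have w1'0 x : 0 <= w1' x by rewrite invr_ge0 exprn_ge0// addr_ge0.
have w2'0 x : 0 <= w2' x by rewrite invr_ge0 exprn_ge0// addr_ge0.
have we : (fun x => `|(source_weight xi s (N1 + N2) x)%:E|%E) =
    glue (fun x => (w1' x)%:E) (fun y => (w2' y)%:E).
  by apply/funext => -[[x y] []]; rewrite /source_weight /glue /= ger0_norm// ?w1'0 ?w2'0.
apply/integrableP; split.
  apply/measurable_EFinP; rewrite (_ : source_weight _ _ _ = glue w1' w2').
    exact: measurable_glue.
  by apply/funext => -[[x y] []].
rewrite we ge0_integral_glue//; try exact/measurable_EFinP; try by move=> x; rewrite lee_fin.
apply: lte_add_pinfty.
  have mw : measurable_fun setT (fun z : borel spacetime => (1 + sq_spacetime z) ^- N1).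
    by apply: measurable_weight; [exact: measurable_sq_spacetime|exact: sq_spacetime_ge0].
  have w0 (z : spacetime) : 0 <= (1 + sq_spacetime z) ^- N1.
    by rewrite invr_ge0 exprn_ge0// addr_ge0// sq_spacetime_ge0.
  apply: le_lt_trans (w1 _ mw w0 iY).
  apply: ge0_le_integral => //.
  - by move=> x _; rewrite lee_fin.
  - exact/measurable_EFinP.
  - by apply/measurable_EFinP; exact: (measurableT_comp mw mp1).
  move=> x _; rewrite lee_fin /w1' /s1 -normrX ger0_norm ?sqr_ge0//.
  by apply: weight_exponent_le; rewrite ?leq_addr//; exact: sq_spacetime_ge0.
have mw : measurable_fun setT (fun z : borel space => (1 + sq_space z) ^- N2).
  by apply: measurable_weight; [exact: measurable_sq_space|exact: sq_space_ge0].
have w0 (z : space) : 0 <= (1 + sq_space z) ^- N2.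
  by rewrite invr_ge0 exprn_ge0// addr_ge0// sq_space_ge0.
apply: le_lt_trans (w2 _ mw w0 iV0).
apply: ge0_le_integral => //.
- by move=> x _; rewrite lee_fin.
- exact/measurable_EFinP.
- by apply/measurable_EFinP; exact: (measurableT_comp mw mp2).
move=> x _; rewrite lee_fin /w2' expr0n addr0.
by apply: weight_exponent_le; rewrite ?leq_addl//; exact: sq_space_ge0.
Qed.

End existence.

(** * A calculus of smooth functions *)

Section line_smooth.
Context (R : realType).
Implicit Types f g : R -> R.

(** Smoothness in coinductive form, as membership in some class of functions closed under
    differentiation; no iterated derivative has to be named. *)
Definition line_smooth f := exists S : set (R -> R), S f /\
  forall g, S g -> exists2 dg, S dg & forall t, is_derive t (1 : R) g (dg t).

Lemma line_smooth_derive f : line_smooth f ->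
  exists2 df, line_smooth df & forall t, is_derive t (1 : R) f (df t).
Proof.
by move=> [S [Sf HS]]; have [df Sdf hf] := HS _ Sf; exists df => //; exists S.
Qed.

Lemma line_smooth_primitive f df : line_smooth df ->
  (forall t, is_derive t (1 : R) f (df t)) -> line_smooth f.
Proof.
move=> [S [Sdf HS]] hf; exists (S `|` [set f]); split; first by right.
move=> g [Sg|->]; last by exists df => //; left.
by have [dg Sdg hg] := HS _ Sg; exists dg => //; left.
Qed.

Lemma line_smooth_differentiable f t : line_smooth f -> differentiable (f : R^o -> R^o) t.
Proof.
by move=> /line_smooth_derive[df _ hf]; apply/derivable1_diffP; exact: ex_derive.
Qed.

Lemma line_smooth_continuous f : line_smooth f -> continuous f.
Proof.
by move=> sf t; apply: differentiable_continuous; exact: line_smooth_differentiable.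
Qed.

Lemma line_smooth_expR : line_smooth (@expR R).
Proof.
by exists [set @expR R]; split => // _ ->; exists (@expR R) => // t; exact: is_derive_expR.
Qed.

End line_smooth.

Section smooth_algebra.
Context (R : realType).

(** A class of expressions closed under directional derivatives. Differentiability of its members
    then gives all orders at once, without a calculus of higher derivatives in several variables. *)
Inductive smooth_algebra (E : normedModType R) : (E -> R^o) -> Prop :=
| smooth_algebra_cst c : smooth_algebra (fun _ => c)
| smooth_algebra_linear (l : E -> R^o) : linear l -> continuous l -> smooth_algebra l
| smooth_algebraD f g : smooth_algebra f -> smooth_algebra g ->
    smooth_algebra (fun x => f x + g x)
| smooth_algebraM f g : smooth_algebra f -> smooth_algebra g ->
    smooth_algebra (fun x => f x * g x)
| smooth_algebra_comp psi f : line_smooth psi -> smooth_algebra f ->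
    smooth_algebra (fun x => psi (f x)).

Context (E : normedModType R).

Lemma linear_functional_differentiable (l : E -> R^o) x : linear l -> continuous l ->
  differentiable l x /\ forall v, 'D_v l x = l v.
Proof.
move=> ll cl; pose aux := GRing.isLinear.Build R E R^o _ l ll.
pose L : {linear E -> R^o} := HB.pack l aux.
have dL : differentiable L x by exact: linear_differentiable.
by split => // v; rewrite (deriveE v dL) (diff_lin x (f := L)).
Qed.

Lemma smooth_algebra_differentiable (f : E -> R^o) : smooth_algebra f ->
  forall x, differentiable f x.
Proof.
elim => {f}.
- by move=> c x; exact: differentiable_cst.
- by move=> l ll cl x; have [] := linear_functional_differentiable x ll cl.
- by move=> f g _ df _ dg x; exact: differentiableD.
- by move=> f g _ df _ dg x; exact: differentiableM.
move=> psi f sp _ df x; apply: (@differentiable_comp _ _ _ _ f (psi : R^o -> R^o)) => //.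
exact: line_smooth_differentiable.
Qed.

Lemma smooth_algebra_continuous (f : E -> R^o) : smooth_algebra f -> continuous f.
Proof.
by move=> sf x; apply: differentiable_continuous; exact: smooth_algebra_differentiable.
Qed.

Lemma smooth_algebra_derive (f : E -> R^o) v : smooth_algebra f -> smooth_algebra ('D_v f).
Proof.
have df := smooth_algebra_differentiable.
elim => {f}.
- move=> c; rewrite (_ : 'D_v _ = fun _ => 0 : R^o); first exact: smooth_algebra_cst.
  by apply/funext => x; exact: derive_cst.
- move=> l ll cl; rewrite (_ : 'D_v _ = fun _ => l v); first exact: smooth_algebra_cst.
  by apply/funext => x; have [_ ->] := linear_functional_differentiable x ll cl.
- move=> f g sf Sf sg Sg; rewrite (_ : 'D_v _ = fun x => 'D_v f x + 'D_v g x).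
    exact: smooth_algebraD.
  by apply/funext => x; apply: deriveD; apply: diff_derivable; exact: df.
- move=> f g sf Sf sg Sg.
  rewrite (_ : 'D_v _ = fun x => f x * 'D_v g x + g x * 'D_v f x).
    by apply: smooth_algebraD; exact: smooth_algebraM.
  by apply/funext => x; apply: (@deriveM R E f g); apply: diff_derivable; exact: df.
move=> psi f sp sf Sf; have [dpsi sdp hp] := line_smooth_derive sp.
rewrite (_ : 'D_v _ = fun x => dpsi (f x) * 'D_v f x).
  by apply: smooth_algebraM => //; exact: smooth_algebra_comp.
apply/funext => x.
have dp : differentiable (psi : R^o -> R^o) (f x) by exact: line_smooth_differentiable.
have dfx := df _ sf x.
rewrite deriveE; last exact: (@differentiable_comp _ _ _ _ f (psi : R^o -> R^o)).
rewrite (@diff_comp _ _ _ _ f (psi : R^o -> R^o))//= deriveE//.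
rewrite diff1E// derive1E (@derive_val _ _ _ _ _ _ _ (hp (f x))) /GRing.scale /=.
by rewrite mulrC.
Qed.

Lemma smooth_algebra_smooth (f : E -> R^o) : smooth_algebra f -> smooth f.
Proof.
move=> sf k; elim: k f sf => [|k IH] f sf; split => //; try exact: smooth_algebra_continuous.
move=> v; split => [x|]; first by apply: diff_derivable; exact: smooth_algebra_differentiable.
by apply: IH; exact: smooth_algebra_derive.
Qed.

Lemma smooth_algebra_linear_comp (E' : normedModType R) (L : E' -> E) (f : E -> R^o) :
  linear L -> continuous L -> smooth_algebra f -> smooth_algebra (fun x => f (L x)).
Proof.
move=> lL cL; elim => {f}.
- by move=> c; exact: smooth_algebra_cst.
- move=> l ll cl; apply: smooth_algebra_linear.
    by move=> a x y; rewrite lL ll.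
  by move=> x; apply: (@continuous_comp _ _ _ L l); [exact: cL|exact: cl].
- by move=> f g _ sf _ sg; exact: smooth_algebraD.
- by move=> f g _ sf _ sg; exact: smooth_algebraM.
by move=> psi f sp _ sf; exact: smooth_algebra_comp.
Qed.

Lemma smooth_algebra_prod (I : Type) (r : seq I) (f : I -> E -> R^o) :
  (forall i, smooth_algebra (f i)) -> smooth_algebra (fun x => \prod_(i <- r) f i x).
Proof.
move=> sf; elim: r => [|i r IH].
  rewrite (_ : (fun _ => _) = fun=> 1); first exact: smooth_algebra_cst.
  by apply/funext => x; rewrite big_nil.
rewrite (_ : (fun _ => _) = fun x => f i x * \prod_(j <- r) f j x).
  exact: smooth_algebraM.
by apply/funext => x; rewrite big_cons.
Qed.

End smooth_algebra.

Section smooth_algebra_line.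
Context (R : realType).

(** The algebra on the line is itself a class closed under differentiation. Conversely, composition
    with the identity puts a smooth function into it, so closure properties transfer to
    [line_smooth]. *)
Lemma smooth_algebra_line (f : R -> R) : smooth_algebra (f : R^o -> R^o) <-> line_smooth f.
Proof.
split => [sf|sf].
  exists (@smooth_algebra R R^o); split => // g sg.
  exists ('D_1 (g : R^o -> R^o)); first exact: smooth_algebra_derive.
  move=> t; apply: DeriveDef => //; apply: diff_derivable.
  exact: (smooth_algebra_differentiable sg).
apply: (@smooth_algebra_comp R R^o f id) => //.
by apply: smooth_algebra_linear => // t; exact: cvg_id.
Qed.

Lemma line_smoothD (f g : R -> R) : line_smooth f -> line_smooth g ->
  line_smooth (fun t => f t + g t).
Proof.
by move=> /smooth_algebra_line sf /smooth_algebra_line sg; apply/smooth_algebra_line/smooth_algebraD.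
Qed.

Lemma line_smoothM (f g : R -> R) : line_smooth f -> line_smooth g ->
  line_smooth (fun t => f t * g t).
Proof.
by move=> /smooth_algebra_line sf /smooth_algebra_line sg; apply/smooth_algebra_line/smooth_algebraM.
Qed.

Lemma line_smooth_cst (c : R) : line_smooth (fun _ => c).
Proof. by apply/smooth_algebra_line; exact: (@smooth_algebra_cst R R^o). Qed.

Lemma line_smooth_comp (f g : R -> R) : line_smooth f -> line_smooth g ->
  line_smooth (fun t => f (g t)).
Proof. by move=> sf /smooth_algebra_line sg; apply/smooth_algebra_line/smooth_algebra_comp. Qed.

Lemma line_smooth_scale (c : R) : line_smooth (fun t => c * t).
Proof.
apply/smooth_algebra_line; apply: smooth_algebra_linear.
  by move=> a x y; rewrite mulrDr /GRing.scale /= mulrCA.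
by move=> t; apply: cvgM; [exact: cvg_cst|exact: cvg_id].
Qed.

End smooth_algebra_line.

(** * Bump functions and smooth approximation of indicators *)

Section bump.
Context (R : realType).
Implicit Types (t x : R).

(** The powers of [t] are included because all derivatives of [exp (- 1 / t)] are combinations of
    these functions. *)
Definition flat (m : nat) t : R := if 0 < t then t ^- m * expR (- t^-1) else 0.

(** For positive [m] and [y = m z], this is the [m]-th power of [z exp (- z) <= 1], multiplied by
    [m ^ m]. *)
Lemma expr_expRN_le (m : nat) (y : R) : 0 <= y -> y ^+ m * expR (- y) <= m%:R ^+ m.
Proof.
case: m => [|m] y0; first by rewrite !expr0 mul1r -[leRHS]expR0 ler_expR oppr_le0.
set k := m.+1; have k0 : 0 < k%:R :> R by rewrite ltr0n.
set z := y / k%:R; have z0 : 0 <= z by rewrite divr_ge0// ltW.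
have -> : y = k%:R * z by rewrite mulrC divfK ?gt_eqF.
rewrite -mulrN expRM_natl exprMn -mulrA -exprMn.
apply: ler_piMr; first by rewrite exprn_ge0// ltW.
apply: exprn_ile1; first by rewrite mulr_ge0 ?expR_ge0.
rewrite expRN ler_pdivrMr ?expR_gt0// mul1r.
by apply: le_trans (expR_ge1Dx _); rewrite lerDr.
Qed.

(** Two additional powers of [1 / t] are absorbed by the exponential and turned into [t ^ 2], which
    makes the derivative at the origin zero. *)
Lemma flat_le m t : `|flat m t| <= (m + 2)%:R ^+ (m + 2) * t ^+ 2.
Proof.
rewrite /flat; case: ifPn => [t0|_]; last by rewrite normr0; apply: mulr_ge0; [exact: exprn_ge0|exact: sqr_ge0].
rewrite ger0_norm; last by apply: mulr_ge0; rewrite ?expR_ge0// invr_ge0 exprn_ge0// ltW.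
rewrite -ler_pdivrMr ?exprn_gt0//.
have ti : 0 <= t^-1 by rewrite invr_ge0 ltW.
have := @expr_expRN_le (m + 2) _ ti.
by apply: le_trans; rewrite exprVn [t ^+ (m + 2)]exprD mulrAC -invfM.
Qed.

Lemma is_derive_quadratic (f : R -> R) (C : R) : (forall t, `|f t| <= C * t ^+ 2) ->
  is_derive (0 : R) (1 : R) f 0.
Proof.
move=> fC.
have f0 : f 0 = 0.
  by apply/eqP; rewrite -normr_le0; apply: le_trans (fC 0) _; rewrite expr0n mulr0.
have H : h^-1 *: ((f \o shift 0) (h *: (1 : R)) - f 0) @[h --> 0^'] --> (0 : R).
  apply: (@cvg_trans _ ((h^-1 * f h) @[h --> 0^'])).
    by apply: near_eq_cvg; near=> h; rewrite /= /GRing.scale /= mulr1 addr0 f0 subr0.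
  apply/cvgr0Pnorm_le => e e0.
  have C0 : 0 <= C.
    by have := fC 1; rewrite expr1n mulr1; apply: le_trans.
  near=> h.
  have h0 : 0 < `|h| by rewrite normr_gt0; near: h; exact: nbhs_dnbhs_neq.
  rewrite normrM normfV ler_pdivrMl//; apply: le_trans (fC h) _.
  rewrite -[h ^+ 2]real_normK ?num_real// expr2 mulrA mulrC ler_pM2l//.
  have : `|h| <= e / (C + 1).
    near: h; apply: dnbhs0_le; apply: divr_gt0 => //; lra.
  move=> he; apply: le_trans (_ : C * (e / (C + 1)) <= _); first exact: ler_wpM2l.
  have C1 : 0 < C + 1 by lra.
  rewrite mulrCA; apply: ler_piMr; first exact: ltW.
  by rewrite ler_pdivrMr// mul1r; lra.
apply: DeriveDef; first by apply/cvg_ex; exists 0.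
exact: cvg_lim H.
Unshelve. all: by end_near. Qed.

Lemma is_derive_flat m t : is_derive t (1 : R) (flat m) (- m%:R * flat m.+1 t + flat m.+2 t).
Proof.
have [t0|t0|->] := ltgtP t 0; last first.
- rewrite /flat !ltxx mulr0 addr0; apply: is_derive_quadratic; exact: flat_le.
- have i1 : is_derive t (1 : R) (fun y : R => y^-1) (- t ^- 2 *: (1 : R)).
    by apply: (@is_deriveV R id); rewrite gt_eqF.
  have i2 := is_deriveX m i1.
  have i4 : is_derive t (1 : R) (fun y : R => - y^-1) (- (- t ^- 2 *: (1 : R))) := is_deriveN i1.
  have i3 := @is_derive1_comp R expR (fun y => - y^-1) t _ _ (is_derive_expR (- t^-1)) i4.
  apply: (near_eq_is_derive _ (is_derive_eq (is_deriveM i2 i3) _)).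
    near=> x; have x0 : 0 < x by near: x; exact: lt_nbhsr.
    (rewrite /flat x0 -exprVn exprfctE; reflexivity).
  rewrite /flat t0 exprfctE /GRing.scale /= /GRing.scale /= !mulr1 -!exprVn.
  set e := expR _; set y := t^-1; move: (m) e y => k e y.
  rewrite mulNr; case: k => [|k] /=.
    by rewrite !mul0r oppr0 add0r mulr0 addr0 expr0 mul1r opprK mulrC.
  rewrite (exprS y k.+2) (exprS y k.+1) (exprS y k) expr2; move: (y ^+ k) (k.+1%:R) => a c; ring.
have -> : - m%:R * flat m.+1 t + flat m.+2 t = 0 by rewrite /flat !ltNge (ltW t0) /= mulr0 addr0.
apply: (near_eq_is_derive _ (is_derive_cst (0 : R) t (1 : R))).
near=> x; have x0 : x < 0 by near: x; exact: lt_nbhsl.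
by rewrite /flat ltNge (ltW x0).
Unshelve. all: by end_near. Qed.

Lemma line_smooth_flat : line_smooth (flat 0).
Proof.
(* The class closed under differentiation: finite combinations of the functions [flat m], listed by
   coefficient and index. *)
pose S := fun f : R -> R => exists s : seq (R * nat), f = fun t => \sum_(p <- s) p.1 * flat p.2 t.
exists S; split.
  by exists [:: (1, 0%N)]; apply/funext => t; rewrite big_seq1 mul1r.
move=> _ [s ->].
exists (fun t => \sum_(p <- s) p.1 * (- p.2%:R * flat p.2.+1 t + flat p.2.+2 t)).
  exists (flatten [seq [:: (- p.2%:R * p.1, p.2.+1); (p.1, p.2.+2)] | p <- s]).
  apply/funext => t; rewrite big_flatten big_map; apply: eq_bigr => p _.
  by rewrite big_cons big_seq1 /=; ring.
move=> t; elim: s => [|p s IH].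
  rewrite big_nil (_ : (fun _ => _) = cst 0); first exact: is_derive_cst.
  by apply/funext => x; rewrite big_nil.
rewrite big_cons (_ : (fun _ => _) =
  (fun x => p.1 * flat p.2 x) + (fun x => \sum_(j <- s) j.1 * flat j.2 x)); last first.
  by apply/funext => x; rewrite big_cons.
apply: is_deriveD => //; exact: (is_deriveZ p.1 (is_derive_flat p.2 t)).
Qed.

Lemma flat0_gt0 t : (0 < flat 0 t) = (0 < t).
Proof. by rewrite /flat; case: ifP => [t0|]; rewrite ?ltxx// expr0 invr1 mul1r expR_gt0. Qed.

Lemma flat0_ge0 t : 0 <= flat 0 t.
Proof. by rewrite /flat; case: ifP => // t0; rewrite expr0 invr1 mul1r expR_ge0. Qed.

Lemma flat0_le1 t : flat 0 t <= 1.
Proof.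
rewrite /flat; case: ifP => // t0; rewrite expr0 invr1 mul1r -expR0 ler_expR oppr_le0.
by rewrite invr_ge0 ltW.
Qed.

Definition bump (l u t : R) : R := flat 0 (t - l) * flat 0 (u - t).

Lemma bump_gt0 l u t : (0 < bump l u t) = (l < t < u).
Proof.
rewrite /bump -[l < t]subr_gt0 -[t < u]subr_gt0 -(flat0_gt0 (t - l)) -(flat0_gt0 (u - t)).
have := flat0_ge0 (t - l); have := flat0_ge0 (u - t).
rewrite !le_eqVlt => /orP[/eqP <-|h1] /orP[/eqP <-|h2]; rewrite ?mul0r ?mulr0 ?ltxx ?andbF//.
by rewrite h1 h2 mulr_gt0.
Qed.

Lemma bump_ge0 l u t : 0 <= bump l u t.
Proof. by rewrite mulr_ge0 ?flat0_ge0. Qed.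

Lemma bump_le1 l u t : bump l u t <= 1.
Proof. by rewrite mulr_ile1 ?flat0_ge0 ?flat0_le1. Qed.

Lemma line_smooth_bump l u : line_smooth (bump l u).
Proof.
have sid : line_smooth (fun t : R => 1 * t) := line_smooth_scale 1.
have sN : line_smooth (fun t : R => -1 * t) := line_smooth_scale (-1).
apply: line_smoothM; (apply: (line_smooth_comp line_smooth_flat)).
  rewrite (_ : (fun _ => _) = fun t => 1 * t + - l); last by apply/funext => t; rewrite mul1r.
  by apply: line_smoothD => //; exact: line_smooth_cst.
rewrite (_ : (fun _ => _) = fun t => u + -1 * t); last by apply/funext => t; rewrite mulN1r.
by apply: line_smoothD => //; exact: line_smooth_cst.
Qed.

(** Turns a smooth [k >= 0] into smooth functions that stay below the indicator of the set where
    [k > 0] and converge to it everywhere. *)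
Definition saturate (n : nat) (k : R) : R := 1 - expR (- (n%:R * k)).

Lemma saturate0 n : saturate n 0 = 0.
Proof. by rewrite /saturate mulr0 oppr0 expR0 subrr. Qed.

Lemma saturate_bounds n k : 0 <= k -> 0 <= saturate n k <= 1.
Proof.
move=> k0; have e1 : expR (- (n%:R * k)) <= 1.
  by rewrite -[leRHS]expR0 ler_expR oppr_le0 mulr_ge0.
by have e0 := expR_ge0 (- (n%:R * k)); rewrite /saturate; apply/andP; split; lra.
Qed.

Lemma cvg_saturate k : 0 <= k -> saturate n k @[n --> \oo] --> ((0 < k)%R%:R : R).
Proof.
rewrite le_eqVlt => /orP[/eqP <-|k0].
  by rewrite ltxx; under eq_fun do rewrite saturate0; exact: cvg_cst.
rewrite k0; have -> : (true%:R : R) = 1 - 0 by rewrite subr0.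
apply: cvgB; first exact: cvg_cst.
have : ((expR (- k)) ^+ n) @[n --> \oo] --> (0 : R).
  by apply: cvg_expr; rewrite ger0_norm ?expR_ge0// -expR0 ltr_expR oppr_lt0.
apply: cvg_trans; apply: near_eq_cvg; apply: nearW => n.
by rewrite -expRM_natl mulrN.
Qed.

Lemma line_smooth_saturate n : line_smooth (saturate n).
Proof.
rewrite (_ : saturate n = fun t => 1 + -1 * expR (- n%:R * t)); last first.
  by apply/funext => t; rewrite /saturate mulN1r mulNr.
apply: line_smoothD; first exact: line_smooth_cst.
apply: line_smoothM; first exact: line_smooth_cst.
by apply: (line_smooth_comp (@line_smooth_expR R)); exact: line_smooth_scale.
Qed.

End bump.

(** * The weak equation for tensor products *)

Section bounded_supported.
Context (R : realType) (E : normedModType R).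

(** The integrands used for uniqueness: they are integrable against every represented measure, and
    measurable locally bounded factors such as [g] preserve the class. *)
Definition bounded_supported (v : E -> R[i]) := cmeasurable (v : borel E -> R[i]) /\
  exists M C : R, forall z, abs1 (v z) <= C /\ (M < `|z| -> v z = 0).

Lemma bounded_supportedM (h v : E -> R[i]) : cmeasurable (h : borel E -> R[i]) ->
  (forall M : R, exists C : R, forall z, `|z| <= M -> abs1 (h z) <= C) ->
  bounded_supported v -> bounded_supported (fun z => h z * v z).
Proof.
move=> mh hb [mv [M [C vC]]]; split; first exact: cmeasurableM.
have [D hD] := hb M; have [v0 _] := vC 0.
exists M, (`|D| * C) => z; have [vz vz0] := vC z; split; last by move=> /vz0 ->; rewrite mulr0.
have C0 : 0 <= C := le_trans (abs1_ge0 _) vz.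
have [zM|/vz0 ->] := leP `|z| M; last by rewrite mulr0 /abs1 /= normr0 addr0 mulr_ge0.
apply: le_trans (abs1M _ _) _; apply: ler_pM => //; try exact: abs1_ge0.
by apply: le_trans (hD z zM) _; exact: ler_norm.
Qed.

Lemma bounded_supportedM_bounded (h v : E -> R[i]) (C : R) :
  cmeasurable (h : borel E -> R[i]) -> (forall z, abs1 (h z) <= C) ->
  bounded_supported v -> bounded_supported (fun z => h z * v z).
Proof. by move=> mh hC; apply: bounded_supportedM => // M; exists C. Qed.

Lemma bounded_supportedD (u v : E -> R[i]) : bounded_supported u -> bounded_supported v ->
  bounded_supported (fun z => u z + v z).
Proof.
move=> [mu [M [C uC]]] [mv [M' [C' vC]]]; split; first exact: cmeasurableD.
exists (Num.max M M'), (C + C') => z; have [u1 u2] := uC z; have [v1 v2] := vC z; split.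
  by apply: le_trans (abs1D _ _) _; exact: lerD.
by rewrite gt_max => /andP[/u2 -> /v2 ->]; rewrite addr0.
Qed.

Context dT (T : measurableType dT) (lam : {measure set T -> \bar R}).
Context (p : T -> borel E) (f : T -> R[i]) (mu : set E -> R[i]).
Hypothesis rep : represents lam p f mu.

Lemma bounded_borel_ball (M : R) : bounded_borel [set z : E | `|z| <= M].
Proof.
split; first by apply/bounded_setP; exists M.
rewrite (_ : [set z : E | `|z| <= M] = (fun z : E => `|z|) @^-1` `]-oo, M]%classic).
  rewrite -[X in measurable X]setTI.
  apply: (@continuous_borel_measurable R E (fun z => `|z|)) => //.
  by move=> z; exact: norm_continuous.
by apply/seteqP; split => z /=; rewrite in_itv.
Qed.

Lemma cintegrable_bounded_supported v : bounded_supported v ->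
  cintegrable lam setT (fun x => v (p x) * f x).
Proof.
move=> [mv [M [C vC]]]; have [mp mf fi _] := rep.
have mvp : cmeasurable (fun x => v (p x)) by exact: (cmeasurable_comp mv mp).
have bB := bounded_borel_ball M; have mB := represents_preimage rep bB.2.
rewrite (_ : (fun x => _) = (fun x => (\1_(p @^-1` [set z : E | `|z| <= M]) x)%:C * (v (p x) * f x))).
  apply/(cintegrable_mkcond _ mB); first exact: cmeasurableM.
  apply: (@cintegrableM_bounded _ _ _ _ _ _ _ C) => //; last exact: fi.
  by move=> x _; case: (vC (p x)).
apply/funext => x; rewrite indicE; case: (boolP (x \in _)); first by rewrite mul1r.
rewrite notin_setE /= => /negP; rewrite -ltNge => h.
by have [_ ->] := vC (p x); rewrite ?mul0r ?mulr0.
Qed.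

Lemma integral_bounded_supported v : bounded_supported v ->
  pairing mu v = Cint lam setT (fun x => v (p x) * f x).
Proof.
move=> bv; have [mp mf fi _] := rep; have [mv [M [C vC]]] := bv.
rewrite /pairing (represents_integral rep measurableT mv) ?preimage_setT//.
have [_ ] : cintegrable lam setT (fun x => (abs1 (v (p x)))%:C * f x).
  apply: (@cintegrable_bounded_supported (fun z => (abs1 (v z))%:C)); split.
    by apply: cmeasurable_real; exact: (measurable_abs1 mv).
  exists M, C => z; have [vz vz0] := vC z; rewrite abs1_real ger0_norm ?abs1_ge0//.
  by split=> // /vz0 ->; rewrite /abs1 /= normr0 addr0.
apply: eq_integrable => // x _ /=; congr (_%:E).
by rewrite abs1Z ?abs1_ge0.
Qed.

End bounded_supported.

Section test_identity.
Context (R : realType) (d : nat).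
Local Notation space := 'rV[R]_d.
Local Notation spacetime := ((('rV[R]_d * R^o)%type : normedModType R)).
Local Notation tdir := (time_direction R d).

Definition tensor_test (a : space -> R) (chi : R -> R) : spacetime -> R[i] :=
  fun z => (a z.1 * chi z.2)%:C.

Lemma smooth_tensor (a : space -> R^o) (chi : R -> R) : smooth_algebra a -> line_smooth chi ->
  smooth_algebra ((fun z => a z.1 * chi z.2) : spacetime -> R^o).
Proof.
move=> sa sc; apply: smooth_algebraM.
  apply: (@smooth_algebra_linear_comp R space spacetime fst) => //.
  by move=> z; exact: cvg_fst.
apply: (@smooth_algebra_linear_comp R R^o spacetime snd (chi : R^o -> R^o)) => //.
  by move=> z; exact: cvg_snd.
exact/smooth_algebra_line.
Qed.

Lemma test_function_tensor (a : space -> R) (chi : R -> R) (M : R) :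
  smooth_algebra (a : space -> R^o) -> line_smooth chi ->
  (forall x, M < `|x| -> a x = 0) -> (forall t, M < `|t| -> chi t = 0) ->
  test_function (tensor_test a chi).
Proof.
move=> sa sc a0 c0; split.
- exact: (smooth_algebra_smooth (smooth_tensor sa sc)).
- by apply: smooth_algebra_smooth; exact: smooth_algebra_cst.
pose K : set spacetime := [set x : space | `|x| <= M] `*` `[- M, M]%classic.
have cK : compact K.
  apply: compact_setX; last exact: segment_compact.
  apply: bounded_closed_compact.
    by apply/bounded_setP; exists M.
  rewrite (_ : [set x : space | `|x| <= M] = (fun x : space => `|x|) @^-1` `]-oo, M]%classic).
    by apply: closed_comp => [x _|]; [exact: norm_continuous|exact: lray_closed].
  by apply/seteqP; split => z /=; rewrite in_itv.
have clK : closed K by apply: compact_closed => //; exact: norm_hausdorff.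
apply: (@subclosed_compact _ _ K) => //; first exact: closed_closure.
rewrite [X in _ `<=` X]((closure_id K).1 clK); apply: closure_subset => z /= /eqP nz; split => /=.
  by rewrite leNgt; apply/negP => /a0 h; apply: nz; rewrite /tensor_test h mul0r.
rewrite in_itv /= -ler_norml leNgt; apply/negP => /c0 h; apply: nz.
by rewrite /tensor_test h mulr0.
Qed.

Lemma derive_tensor (a : space -> R) (chi dchi : R -> R) :
  smooth_algebra (a : space -> R^o) -> line_smooth chi ->
  (forall t, is_derive t (1 : R) chi (dchi t)) ->
  derive_complex tdir (tensor_test a chi) = tensor_test a dchi.
Proof.
move=> sa sc hc; apply/funext => -[x t]; rewrite /derive_complex /tensor_test /=.
have sm := smooth_tensor sa sc.
have h := is_derive_time (diff_derivable (v := tdir) (smooth_algebra_differentiable sm (x, t))).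
have h' : is_derive t (1 : R) (fun r => a x * chi r) (a x * dchi t).
  exact: (is_deriveZ (a x) (hc t)).
congr (_ +i* _); last exact: derive_cst.
by rewrite -(@derive_val _ _ _ _ _ _ _ h'); rewrite (@derive_val _ _ _ _ _ _ _ h).
Qed.

Lemma cmeasurable_space (u : space -> R[i]) : cmeasurable (u : borel space -> R[i]) ->
  cmeasurable ((fun z => u z.1) : borel spacetime -> R[i]).
Proof. by move=> mu; exact: (cmeasurable_comp mu (@measurable_spacetime_fst R d)). Qed.

Lemma cmeasurable_time (h : R -> R[i]) : cmeasurable h ->
  cmeasurable ((fun z => h z.2) : borel spacetime -> R[i]).
Proof. by move=> mh; exact: (cmeasurable_comp mh (@measurable_spacetime_snd R d)). Qed.

Lemma bounded_supported_tensor (u : space -> R[i]) (h : R -> R[i]) (M C D : R) :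
  cmeasurable (u : borel space -> R[i]) -> cmeasurable h ->
  (forall x, abs1 (u x) <= C) -> (forall t, abs1 (h t) <= D) ->
  (forall x, M < `|x| -> u x = 0) -> (forall t, M < `|t| -> h t = 0) ->
  bounded_supported ((fun z => u z.1 * h z.2) : spacetime -> R[i]).
Proof.
move=> mu mh uC hD u0 h0; split.
  by apply: cmeasurableM; [exact: cmeasurable_space|exact: cmeasurable_time].
exists M, (C * D) => z; split.
  by apply: le_trans (abs1M _ _) _; apply: ler_pM; rewrite ?abs1_ge0.
by rewrite spacetime_norm lt_max => /orP[/u0 ->|/h0 ->]; rewrite ?mul0r ?mulr0.
Qed.

Section transport.
Variable g : space -> R[i].
Hypothesis mg : cmeasurable (g : borel space -> R[i]).
Hypothesis g_bounded : forall M : R, exists C : R, forall x, `|x| <= M -> abs1 (g x) <= C.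

Lemma symbol_bounded (M : R) : exists C : R, forall z : spacetime, `|z| <= M -> abs1 (g z.1) <= C.
Proof.
have [C hC] := g_bounded M; exists C => z zM; apply: hC; apply: le_trans zM.
by rewrite spacetime_norm le_max lexx.
Qed.

(** On tensor products the time derivative acts on [chi] alone, so the equation becomes a single
    integral over the base space. *)
Lemma evolution_equation_represented dT (T : measurableType dT) (lam : {measure set T -> \bar R})
    (p : T -> borel spacetime) (f : T -> R[i]) (V Y : set spacetime -> R[i])
    (a : space -> R) (chi dchi : R -> R) (M : R) :
  represents lam p f V -> evolution_equation g V Y ->
  smooth_algebra (a : space -> R^o) -> line_smooth chi -> line_smooth dchi ->
  (forall t, is_derive t (1 : R) chi (dchi t)) ->
  (forall x, M < `|x| -> a x = 0) -> (forall t, M < `|t| -> chi t = 0) ->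
  Cint lam setT (fun x => ((a (p x).1)%:C *
    (- (dchi (p x).2)%:C + g (p x).1 * (chi (p x).2)%:C)) * f x) =
  pairing Y (tensor_test a chi).
Proof.
move=> rep ev sa sc sdc hc a0 c0.
have tst := test_function_tensor sa sc a0 c0.
have [cphi cdphi _ [M' [C bnd]]] := test_function_facts tst.
rewrite -(ev _ tst) /derive_distribution.
have dE := derive_tensor sa sc hc.
have bphi : bounded_supported (tensor_test a chi).
  split; first exact: continuous_cmeasurable.
  by exists M', C => z; have [h1 [_ h2]] := bnd z; split => // /h2[].
have bdphi : bounded_supported (tensor_test a dchi).
  split; first by rewrite -dE; exact: continuous_cmeasurable.
  by exists M', C => z; have [_ [h1 h2]] := bnd z; split; rewrite -dE // => /h2[].
have repg : represents lam p (fun x => g (p x).1 * f x) (radon_density (fun z => g z.1) V).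
  apply: (represents_density rep (phi := fun z => g z.1)); first exact: cmeasurable_space.
  by move=> B /bounded_setP[N hN]; have [C' hC'] := symbol_bounded N; exists C' => z /hN /hC'.
rewrite dE (integral_bounded_supported rep bdphi) (integral_bounded_supported repg bphi).
have i1 := cintegrable_bounded_supported rep bdphi.
have i2 := cintegrable_bounded_supported repg bphi.
rewrite -CintN// -CintD//; last exact: cintegrableN.
apply: eq_Cint => x _; rewrite /tensor_test !rmorphM /=; ring.
Qed.

End transport.

End test_identity.

Section box_approximation.
Context (R : realType) (d : nat).
Local Notation space := 'rV[R]_d.

Definition box_bump (l u x : space) : R :=
  \prod_(i < d) bump (l ord0 i) (u ord0 i) (x ord0 i).

Lemma box_bump_ge0 l u x : 0 <= box_bump l u x.
Proof. by apply: prodr_ge0 => i _; exact: bump_ge0. Qed.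

Lemma box_bump_gt0 l u x : (0 < box_bump l u x) = (x \in box l u).
Proof.
apply/idP/idP => [h|]; rewrite inE.
  move=> i; rewrite -bump_gt0 lt_def bump_ge0 andbT; apply: contraL h => /eqP h.
  by rewrite /box_bump (bigD1 i)//= h mul0r ltxx.
by move=> h; apply: prodr_gt0 => i _; rewrite bump_gt0.
Qed.

Lemma smooth_algebra_box_bump l u : smooth_algebra (box_bump l u : space -> R^o).
Proof.
apply: (@smooth_algebra_prod R space _ (index_enum 'I_d)
  (fun i x => bump (l ord0 i) (u ord0 i) (x ord0 i))) => i.
apply: smooth_algebra_comp; first exact: line_smooth_bump.
apply: smooth_algebra_linear; first by move=> a x y; rewrite !mxE.
by move=> x; exact: (@coord_continuous R 1 d ord0 i x).
Qed.

Lemma saturate_indic (T : Type) (k : T -> R) (A : set T) (n : nat) (x : T) :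
  (forall x, 0 <= k x) -> (forall x, (0 < k x) = (x \in A)) ->
  0 <= saturate n (k x) <= \1_A x.
Proof.
move=> k0 kA; have := saturate_bounds n (k0 x); rewrite indicE -kA.
case: (ltP 0 (k x)) => // kx; have -> : k x = 0 by apply/eqP; rewrite eq_le kx k0.
by rewrite saturate0 lexx.
Qed.

Lemma cvg_saturate_indic (T : Type) (k : T -> R) (A : set T) (x : T) :
  (forall x, 0 <= k x) -> (forall x, (0 < k x) = (x \in A)) ->
  saturate n (k x) @[n --> \oo] --> (\1_A x : R).
Proof. by move=> k0 kA; rewrite indicE -kA; exact: cvg_saturate. Qed.

End box_approximation.

Section line_support.
Context (R : realType).

Lemma derive_outside_support (f df : R -> R) (P : set R) : open P ->
  (forall t, is_derive t (1 : R) f (df t)) ->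
  (forall t, P t -> f t = 0) -> forall t, P t -> df t = 0.
Proof.
move=> oP hf f0 t Pt; have nP : \forall s \near t, cst (0 : R) s = f s.
  have : nbhs t P by exact: open_nbhs_nbhs.
  by apply: filterS => s /f0 ->.
rewrite -(@derive_val _ _ _ _ _ _ _ (hf t)).
exact: (@derive_val _ _ _ _ _ _ _ (near_eq_is_derive nP (is_derive_cst (0 : R) t (1 : R)))).
Qed.

Lemma bounded_compact_support (f : R -> R) (a b : R) : continuous f ->
  (forall t, ~~ (a <= t <= b) -> f t = 0) -> exists C : R, 0 <= C /\ forall t, `|f t| <= C.
Proof.
move=> cf f0; have : compact (f @` `[a, b]%classic).
  by apply: continuous_compact; [exact: continuous_subspaceT|exact: segment_compact].
move=> /(@compact_bounded R R^o) /bounded_setP[C hC]; exists `|C|; split => // t.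
have [h|/f0 ->] := boolP (a <= t <= b); last by rewrite normr0.
by apply: le_trans (hC _ _) (ler_norm _); exists t => //=; rewrite in_itv.
Qed.

Lemma open_norm_gt (M : R) : open [set t : R | M < `|t|].
Proof.
rewrite (_ : [set t : R | M < `|t|] = (fun t : R => `|t|) @^-1` [set t | M < t]) //.
by apply: open_comp => [t _|]; [exact: norm_continuous|exact: open_gt].
Qed.

End line_support.

(** * The adjoint identity for measurable functions of space *)

Section transport_identity.
Context (R : realType) (d : nat).
Local Notation space := 'rV[R]_d.
Local Notation spacetime := ((('rV[R]_d * R^o)%type : normedModType R)).
Variable g : space -> R[i].
Hypothesis mg : cmeasurable (g : borel space -> R[i]).
Hypothesis g_bounded : forall M : R, exists C : R, forall x, `|x| <= M -> abs1 (g x) <= C.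
Context dT (T : measurableType dT) (lam : {measure set T -> \bar R}).
Variables (p : T -> borel spacetime) (f1 f2 : T -> R[i]) (V1 V2 Y : set spacetime -> R[i]).
Hypotheses (rep1 : represents lam p f1 V1) (rep2 : represents lam p f2 V2).
Hypotheses (ev1 : evolution_equation g V1 Y) (ev2 : evolution_equation g V2 Y).

(** The adjoint operator [- d/dt + g] applied to [chi], with [dchi] standing for the derivative of
    [chi]. *)
Definition transport (chi dchi : R -> R) (z : spacetime) : R[i] :=
  - (dchi z.2)%:C + g z.1 * (chi z.2)%:C.

Let f x := f1 x - f2 x.

Lemma represents_difference : represents lam p f (fun B => V1 B - V2 B).
Proof.
have [mp mf1 if1 V1E] := rep1; have [_ mf2 if2 V2E] := rep2.
split => //; first exact: cmeasurableB.
  by move=> B bB; apply: cintegrableB (if1 B bB) (if2 B bB); exact: (represents_preimage rep1 bB.2).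
move=> B; rewrite V1E V2E; case: asboolP => [bB|]; last by rewrite subr0.
by rewrite CintB//; [exact: (represents_preimage rep1 bB.2)|exact: if1|exact: if2].
Qed.

Definition action (v : spacetime -> R[i]) : R[i] := Cint lam setT (fun x => v (p x) * f x).

Lemma action_integrable v : bounded_supported v -> cintegrable lam setT (fun x => v (p x) * f x).
Proof. exact: (cintegrable_bounded_supported represents_difference). Qed.

Lemma actionD u v : bounded_supported u -> bounded_supported v ->
  action (fun z => u z + v z) = action u + action v.
Proof.
move=> bu bv; rewrite /action -CintD//; try exact: action_integrable.
by apply: eq_Cint => x _; rewrite mulrDl.
Qed.

Lemma action_difference v : bounded_supported v ->
  action v = Cint lam setT (fun x => v (p x) * f1 x) - Cint lam setT (fun x => v (p x) * f2 x).
Proof.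
move=> bv; rewrite -CintB//.
- by apply: eq_Cint => x _; rewrite mulrBr.
- exact: (cintegrable_bounded_supported rep1).
- exact: (cintegrable_bounded_supported rep2).
Qed.

Lemma line_cmeasurable (h : R -> R) : continuous h -> cmeasurable (fun t : R => (h t)%:C).
Proof. by move=> ch; apply: cmeasurable_real; exact: continuous_measurable_fun. Qed.

Variables (chi dchi : R -> R) (M : R).
Hypotheses (schi : line_smooth chi) (sdchi : line_smooth dchi).
Hypothesis hchi : forall t, is_derive t (1 : R) chi (dchi t).
Hypothesis chi0 : forall t, M < `|t| -> chi t = 0.

Lemma dchi0 t : M < `|t| -> dchi t = 0.
Proof. by move=> h; apply: (derive_outside_support (@open_norm_gt R M) hchi chi0). Qed.

Lemma bounded_supported_transport (u : space -> R[i]) (C : R) :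
  cmeasurable (u : borel space -> R[i]) -> (forall x, abs1 (u x) <= C) ->
  (forall x, M < `|x| -> u x = 0) ->
  bounded_supported (fun z => u z.1 * transport chi dchi z).
Proof.
move=> mu uC u0.
have nM (h : R -> R) : (forall t, M < `|t| -> h t = 0) -> forall t, ~~ (- M <= t <= M) -> h t = 0.
  by move=> h0 t; rewrite -ler_norml -ltNge => /h0.
have [D [_ hD]] := bounded_compact_support (line_smooth_continuous schi) (nM _ chi0).
have [D' [_ hD']] := bounded_compact_support (line_smooth_continuous sdchi) (nM _ dchi0).
rewrite (_ : (fun z => _) = fun z => - (u z.1 * (dchi z.2)%:C) + g z.1 * (u z.1 * (chi z.2)%:C)).
  apply: bounded_supportedD; last first.
    apply: (@bounded_supportedM R spacetime (fun z => g z.1)); first exact: cmeasurable_space.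
      exact: symbol_bounded.
    apply: (@bounded_supported_tensor R d u (fun t => (chi t)%:C) M C D) => //.
    - exact: line_cmeasurable (line_smooth_continuous schi).
    - by move=> t; rewrite abs1_real.
    - by move=> t /chi0 ->.
  rewrite (_ : (fun z => _) = fun z : spacetime => u z.1 * - (dchi z.2)%:C); last first.
    by apply/funext => z; rewrite mulrN.
  apply: (@bounded_supported_tensor R d u (fun t => - (dchi t)%:C) M C D') => //.
  - by apply: cmeasurableN; exact: line_cmeasurable (line_smooth_continuous sdchi).
  - by move=> t; rewrite abs1N abs1_real.
  - by move=> t /dchi0 ->; rewrite oppr0.
by apply/funext => z; rewrite /transport mulrDr mulrN mulrCA.
Qed.

Lemma transport_smooth (a : space -> R) (C : R) : smooth_algebra (a : space -> R^o) ->
  (forall x, `|a x| <= C) -> (forall x, M < `|x| -> a x = 0) ->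
  action (fun z => (a z.1)%:C * transport chi dchi z) = 0.
Proof.
move=> sa aC a0.
have ma : cmeasurable ((fun x => (a x)%:C) : borel space -> R[i]).
  apply: cmeasurable_real; apply: continuous_borel_measurable.
  exact: smooth_algebra_continuous.
have b : bounded_supported (fun z => (a z.1)%:C * transport chi dchi z).
  apply: (@bounded_supported_transport (fun x => (a x)%:C) C) => //.
    by move=> x; rewrite abs1_real.
  by move=> x /a0 ->.
rewrite action_difference//.
rewrite (evolution_equation_represented mg g_bounded rep1 ev1 sa schi sdchi hchi a0 chi0).
by rewrite (evolution_equation_represented mg g_bounded rep2 ev2 sa schi sdchi hchi a0 chi0) subrr.
Qed.

End transport_identity.

Lemma Cint0 dT (T : measurableType dT) (R : realType) (m : {measure set T -> \bar R}) D :
  Cint m D (fun _ => 0) = 0.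
Proof. by apply: complex_eqP => /=; rewrite /Rintegral integral0. Qed.

Section transport_measurable.
Context (R : realType) (d : nat).
Local Notation space := 'rV[R]_d.
Local Notation spacetime := ((('rV[R]_d * R^o)%type : normedModType R)).
Variable g : space -> R[i].
Hypothesis mg : cmeasurable (g : borel space -> R[i]).
Hypothesis g_bounded : forall M : R, exists C : R, forall x, `|x| <= M -> abs1 (g x) <= C.
Context dT (T : measurableType dT) (lam : {measure set T -> \bar R}).
Variables (p : T -> borel spacetime) (f1 f2 : T -> R[i]) (V1 V2 Y : set spacetime -> R[i]).
Hypotheses (rep1 : represents lam p f1 V1) (rep2 : represents lam p f2 V2).
Hypotheses (ev1 : evolution_equation g V1 Y) (ev2 : evolution_equation g V2 Y).

Let L := action lam p f1 f2.

(* For fixed chi, the integral of [1_A(xi) (- chi' + g chi)] is a complex measure in A. It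
   vanishes on boxes, the limits of smooth functions of xi, hence vanishes. *)
Lemma transport_identity (chi dchi : R -> R) (M : R) (u : space -> R[i]) (C : R) :
  line_smooth chi -> line_smooth dchi -> (forall t, is_derive t (1 : R) chi (dchi t)) ->
  (forall t, M < `|t| -> chi t = 0) -> cmeasurable (u : borel space -> R[i]) ->
  (forall x, abs1 (u x) <= C) -> (forall x, M < `|x| -> u x = 0) ->
  L (fun z => u z.1 * transport g chi dchi z) = 0.
Proof.
move=> sc sdc hc c0 mu uC u0.
pose f x := f1 x - f2 x.
pose xi x : borel space := (p x : spacetime).1.
pose G x := transport g chi dchi (p x) * f x.
have [mp mf _ _] := represents_difference rep1 rep2.
have mxi : measurable_fun setT xi by exact: (measurableT_comp (@measurable_spacetime_fst R d) mp).
have mG : cmeasurable G.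
  apply: cmeasurableM => //; apply: (cmeasurable_comp _ mp).
  apply: cmeasurableD.
    apply: cmeasurableN; apply: (@cmeasurable_time R d (fun t => (dchi t)%:C)).
    exact: line_cmeasurable (line_smooth_continuous sdc).
  apply: cmeasurableM; first exact: cmeasurable_space.
  apply: (@cmeasurable_time R d (fun t => (chi t)%:C)).
  exact: line_cmeasurable (line_smooth_continuous sc).
have mxiB (B : set space) : measurable (B : set (borel space)) -> measurable (xi @^-1` B).
  by move=> mB; rewrite -[X in measurable X]setTI; exact: mxi.
have iG (B : set space) : bounded_borel B ->
    cintegrable lam setT (fun x => (\1_B (xi x))%:C * G x).
  move=> [/bounded_setP[N hN] mB]; under eq_fun do rewrite mulrA.
  apply: (action_integrable rep1 rep2 (v := fun z => (\1_B z.1)%:C * transport g chi dchi z)).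
  apply: (@bounded_supported_transport _ _ _ mg g_bounded chi dchi (Num.max M N) sc sdc hc _
    (fun x => (\1_B x)%:C) 1) => //.
  - by move=> t; rewrite gt_max => /andP[/c0].
  - exact: (@cmeasurable_indic _ (borel space) R B).
  - by move=> x; rewrite abs1_real indicE; case: (_ \in _); rewrite ?normr1 ?normr0.
  - move=> x; rewrite gt_max => /andP[_ xN]; rewrite indicE (_ : _ \in _ = false)//.
    by apply/negbTE; rewrite notin_setE => /hN; rewrite leNgt xN.
pose nu (B : set space) : R[i] := if `[< bounded_borel B >] then Cint lam (xi @^-1` B) G else 0.
have repnu : represents lam xi G nu.
  split => // B bB; apply/(cintegrable_mkcond _ (mxiB _ bB.2) mG).
  exact: iG.
have nu0 : forall B, nu B = 0.
  apply: (radon_ext0 (@rational_point_dense R d) (@boxes_open R d) (@boxes_ball R d)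
    (@boxes_setI R d) _ (represents_radon repnu)) => [_ [l [w ->]]|_ [l [w ->]]].
    exact: box_bounded.
  have bb : bounded_borel (box l w).
    by split; [exact: box_bounded|apply: borel_open; exact: open_box].
  rewrite (representsE repnu bb) Cint_mkcond.
  have k0 := box_bump_ge0 l w; have kA := box_bump_gt0 l w.
  pose a n x := saturate n (box_bump l w x).
  have aE n x : 0 <= a n x <= \1_(box l w) x by exact: saturate_indic.
  have sa n : smooth_algebra (a n : space -> R^o).
    by apply: smooth_algebra_comp; [exact: line_smooth_saturate|exact: smooth_algebra_box_bump].
  have ma n : cmeasurable (fun x => (a n (xi x))%:C).
    apply: cmeasurable_real; apply: (measurableT_comp _ mxi).
    by apply: continuous_borel_measurable; exact: smooth_algebra_continuous.
  have lim : ((Cint lam setT (fun x => (a n (xi x))%:C * G x) : R[i]^o) @[n --> \oo] -->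
      (Cint lam setT (fun x => (\1_(box l w) (xi x))%:C * G x) : R[i]^o)).
    apply: (@Cint_dominated _ _ _ lam setT _ _
      (fun x => abs1 ((\1_(box l w) (xi x))%:C * G x))) => //.
    - by move=> n; exact: cmeasurableM.
    - by have [] := iG _ bb.
    - move=> x _; apply: (@cvg_complexM R _ _ _ (fun n => (a n (xi x))%:C) (fun _ => G x)).
        by apply: cvg_real_complex; exact: cvg_saturate_indic.
      exact: cvg_cst.
    - by have [_] := iG _ bb.
    - move=> n x _; have /andP[a0 a1] := aE n (xi x).
      rewrite !abs1Z// ?(le_trans a0)//; apply: ler_wpM2r => //; exact: abs1_ge0.
  have /bounded_setP[N hN] := bb.1.
  have lim0 : ((Cint lam setT (fun x => (a n (xi x))%:C * G x) : R[i]^o) @[n --> \oo] -->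
      (0 : R[i]^o)).
    rewrite (_ : (fun n => _) = fun _ => 0 : R[i]^o); first exact: cvg_cst.
    apply/funext => n.
    have := @transport_smooth _ _ _ mg g_bounded _ _ lam _ _ _ _ _ _ rep1 rep2 ev1 ev2
      chi dchi (Num.max M N) sc sdc hc _ (a n) 1 (sa n) _ _.
    rewrite /action => <- //.
    + by apply: eq_Cint => x _; rewrite mulrA.
    + by move=> t; rewrite gt_max => /andP[/c0].
    + move=> x; have /andP[a0 a1] := aE n x; rewrite ger0_norm//; apply: le_trans a1 _.
      by rewrite indicE; case: (_ \in _).
    + move=> x; rewrite gt_max => /andP[_ xN]; have /andP[a0] := aE n x.
      rewrite indicE (_ : _ \in _ = false); first by move=> a1; apply/eqP; rewrite eq_le a1 a0.
      by apply/negbTE; rewrite notin_setE => /hN; rewrite leNgt xN.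
  exact: (cvg_unique (@norm_hausdorff _ _) lim lim0).
have bu : bounded_supported u by split => //; exists M, C => x; split => //; exact: u0.
(* Integrating [u] against the zero measure [nu] gives the identity for [u]. *)
have nuE : nu = fun _ => 0 by apply/funext.
have := integral_bounded_supported repnu bu.
rewrite nuE (integral_bounded_supported (represents0 lam mxi) bu).
rewrite (_ : Cint _ _ _ = 0); last first.
  rewrite -[RHS](Cint0 lam setT); apply: eq_Cint => x _; exact: mulr0.
move=> E; rewrite /L /action E; apply: eq_Cint => x _; exact: (esym (mulrA _ _ _)).
Qed.

End transport_measurable.

(** * Primitives and smooth steps *)

Section monotone_primitive.
Context (R : realType).
Local Notation leb := (@lebesgue_measure R).
Implicit Types f df : R -> R.

Lemma le_of_derive_le0 f df a b : (forall t, is_derive t (1 : R) f (df t)) ->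
  (forall t, a < t < b -> df t <= 0) -> a <= b -> f b <= f a.
Proof.
move=> hf df0 ab; have dv t : derivable f t 1 by exact: ex_derive.
apply: (@ler0_derive1_nincr R f a b) => //.
- by move=> x; rewrite in_itv /= derive1E (@derive_val _ _ _ _ _ _ _ (hf x)) => /df0.
- apply: continuous_subspaceT => t; apply: differentiable_continuous.
  exact/derivable1_diffP.
Qed.

Lemma le_of_derive_ge0 f df a b : (forall t, is_derive t (1 : R) f (df t)) ->
  (forall t, a < t < b -> 0 <= df t) -> a <= b -> f a <= f b.
Proof.
move=> hf df0 ab; rewrite -lerN2.
apply: (@le_of_derive_le0 (fun t => - f t) (fun t => - df t)) => // t.
by move=> /df0; rewrite oppr_le0.
Qed.

(** Integrating from minus infinity instead of from [a] lets one formula serve on both sides of [a];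
    the integral is finite because [f] vanishes to the left. *)
Lemma primitive_left (f : R -> R) a : continuous f -> (forall t, t <= a -> f t = 0) ->
  exists F, (forall t, is_derive t (1 : R) F (f t)) /\ forall t, t <= a -> F t = 0.
Proof.
move=> cf f0; pose F x := \int[leb]_(t in `]-oo, x]) f t.
have fi u : leb.-integrable `]-oo, u] (EFin \o f).
  have ms (I : interval R) : measurable ([set` I] : set (measurableTypeR R)).
    exact: measurable_itv.
  apply/(integrable_mkcond _ (ms _)).
  have : leb.-integrable `[a, u] (EFin \o f).
    apply: continuous_compact_integrable; first exact: segment_compact.
    exact: continuous_subspaceT.
  move/(integrable_mkcond _ (ms _)); apply: eq_integrable => // t _.
  rewrite !patchE !mem_setE !in_itv /=; case: (leP t u) => tu; rewrite ?andbF// andbT.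
  by case: (leP a t) => // ta; rewrite /= f0// ltW.
exists F; split => t.
  have tt1 : t < t + 1 by rewrite ltrDl.
  have [d1 d2] : derivable F t 1 /\ derive1 F t = f t.
    by apply: (@continuous_FTC1 R f -oo%O t (t + 1) tt1 (fi _)); [rewrite ltNyr|exact: cf].
  by apply: DeriveDef d1 _; rewrite -derive1E; exact: d2.
move=> ta; rewrite /F /Rintegral.
rewrite (eq_integral (fun _ => 0%E)) ?integral0// => s; rewrite mem_setE in_itv /= => st.
by rewrite f0// (le_trans st ta).
Qed.

Lemma is_derive_reflect f df : (forall t, is_derive t (1 : R) f (df t)) ->
  forall t, is_derive t (1 : R) (fun s => f (- s)) (- df (- t)).
Proof.
move=> hf t.
have h : is_derive t (1 : R) (fun s : R => - s) (-1) by exact: (is_deriveN (is_derive_id t 1)).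
by have := @is_derive1_comp R f (fun s => - s) t _ _ (hf (- t)) h; rewrite mulrN1.
Qed.

Lemma primitive_right (f : R -> R) a : continuous f -> (forall t, a <= t -> f t = 0) ->
  exists F, (forall t, is_derive t (1 : R) F (f t)) /\ forall t, a <= t -> F t = 0.
Proof.
move=> cf f0; have [||F [hF F0]] := @primitive_left (fun t => - f (- t)) (- a).
- by move=> t; apply: cvgN; apply: continuous_comp; [exact: opp_continuous|exact: cf].
- by move=> t ta; rewrite f0 ?oppr0// lerNr.
exists (fun t => F (- t)); split => [t|t ta]; last by rewrite F0// lerN2.
by have := is_derive_reflect hF t; rewrite !opprK.
Qed.

(** The primitive [B] of a bump on []0, 1[]. Its height [c] is the mass of the bump, left
    unnormalised, as a positive factor can be divided out at the end. *)
Lemma smooth_step : exists B b : R -> R, exists2 c : R, 0 < c &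
  [/\ line_smooth B, line_smooth b, forall t, is_derive t (1 : R) B (b t),
      forall t, 0 <= b t <= 1 /\ 0 <= B t <= c &
      [/\ forall t, t <= 0 -> B t = 0, forall t, 1 <= t -> B t = c &
          forall t, ~~ (0 < t < 1) -> b t = 0]].
Proof.
pose b : R -> R := bump 0 1; have sb : line_smooth b by exact: line_smooth_bump.
have b0 t : ~~ (0 < t < 1) -> b t = 0.
  by rewrite -bump_gt0 -leNgt => h; apply/eqP; rewrite eq_le h bump_ge0.
have [||B [hB B0]] := @primitive_left b 0.
- exact: line_smooth_continuous.
- by move=> t t0; apply: b0; rewrite ltNge t0.
have B1 t : 1 <= t -> B t = B 1.
  move=> t1; have bt s : 1 < s < t -> b s = 0 by move=> /andP[s1 _]; apply: b0; rewrite (ltNge s 1) (ltW s1) andbF.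
  apply/eqP; rewrite eq_le (le_of_derive_le0 hB _ t1) ?(le_of_derive_ge0 hB _ t1)// => s /bt ->//.
have mono s t : s <= t -> B s <= B t.
  by move=> st; apply: (le_of_derive_ge0 hB) => // r _; exact: bump_ge0.
have Bge t : 0 <= B t.
  have [t0|t0] := leP t 0; first by rewrite B0.
  by rewrite -(B0 0)//; apply: mono; exact: ltW.
have Ble t : B t <= B 1.
  by have [t1|/ltW t1] := leP 1 t; [rewrite B1|exact: mono].
exists B, b, (B 1); last split => //.
(* If [B 1 = 0], then [B] vanishes identically and so does its derivative, whereas [b] is positive
   at [1 / 2]. *)
- rewrite lt_def Bge andbT; apply/eqP => B10.
  have Bz t : B t = 0 by apply/eqP; rewrite eq_le Bge -B10 Ble.
  have := @derive_outside_support R B b setT openT hB (fun t _ => Bz t) (2^-1) I.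
  have : 0 < b (2^-1) by rewrite bump_gt0; apply/andP; split; lra.
  by move=> + e; rewrite e ltxx.
- exact: (line_smooth_primitive sb hB).
- by move=> t; rewrite bump_ge0 bump_le1 Bge Ble.
Qed.

End monotone_primitive.

(** * Mollification to the right of time 0 and the initial trace *)

Section right_continuous.
Context (R : realType).

(** For [t >= 0], the first point strictly to the right of [t] in the grid of mesh [1 / (n + 1)]. *)
Definition step_right (n : nat) (t : R) : R := (Num.truncn (n.+1%:R * t)).+1%:R / n.+1%:R.

Lemma step_right_bounds n t : 0 <= t -> t < step_right n t <= t + n.+1%:R^-1.
Proof.
move=> t0; have n0 : 0 < n.+1%:R :> R by rewrite ltr0n.
have nt0 : 0 <= n.+1%:R * t by rewrite mulr_ge0// ltW.
have /andP[h1 h2] := truncn_itv nt0; apply/andP; split.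
  by rewrite /step_right ltr_pdivlMr// mulrC.
rewrite /step_right ler_pdivrMr// mulrDl mulVf ?gt_eqF// mulrC.
by rewrite -natr1 mulrC lerD2r.
Qed.

Lemma cvg_step_right_point t : 0 <= t -> step_right n t @[n --> \oo] --> t.
Proof.
move=> t0; apply: (@squeeze_cvgr _ _ _ _ (fun _ => t) (fun n => t + n.+1%:R^-1)).
- by apply: nearW => n; have /andP[/ltW -> ->] := step_right_bounds n t0.
- exact: cvg_cst.
- by rewrite -[X in _ --> X]addr0; apply: cvgD; [exact: cvg_cst|exact: cvg_harmonic].
Qed.

(** The function is the pointwise limit of its values at the next grid point, and these are step
    functions. *)
Lemma measurable_right_continuous (h : R -> R) :
  (forall t, h s @[s --> t^'+] --> h t) -> measurable_fun (`[0, +oo[%classic : set (measurableTypeR R)) h.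
Proof.
move=> rc; apply: (@measurable_fun_cvg _ _ _ _ (fun n t => h (step_right n t))) => [n|t].
  move=> mD Y mY.
  pose A k : set R := if `[< Y (h (k.+1%:R / n.+1%:R)) >]
    then `[k%:R / n.+1%:R, k.+1%:R / n.+1%:R[%classic else set0.
  rewrite (_ : _ `&` _ = \bigcup_k A k).
    apply: bigcupT_measurable => k; rewrite /A; case: ifP => _; [exact: measurable_itv|exact: measurable0].
  have n0 : 0 < n.+1%:R :> R by rewrite ltr0n.
  apply/seteqP; split => t /=.
    rewrite in_itv /= andbT => -[t0 Yt]; exists (Num.truncn (n.+1%:R * t)) => //.
    have nt0 : 0 <= n.+1%:R * t by rewrite mulr_ge0// ltW.
    rewrite /A; case: asboolP => // _; rewrite /= in_itv /= ler_pdivrMr// ltr_pdivlMr//.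
    by rewrite (mulrC t); exact: truncn_itv.
  move=> [k _]; rewrite /A; case: asboolP => // Yk; rewrite /= in_itv /= ler_pdivrMr// ltr_pdivlMr// => kt.
  have t0 : 0 <= t.
    have /andP[h1 _] := kt; have : 0 <= t * n.+1%:R by apply: le_trans h1.
    by rewrite pmulr_lge0.
  split; first by rewrite in_itv /= t0.
  by rewrite /step_right (mulrC n.+1%:R t) (truncn_def kt).
rewrite /= in_itv /= andbT => t0; have /cvg_at_rightP := rc t; apply; split.
  by move=> n; have /andP[] := step_right_bounds n t0.
exact: cvg_step_right_point.
Qed.

End right_continuous.

Section mollification.
Context (R : realType).
Local Notation leb := (@lebesgue_measure R).

Lemma continuous_fast_decreasing (E : normedModType R) (sq : E -> R) (u : E -> R[i]) (M C S : R) :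
  continuous (u : E -> R[i]^o) -> (forall x, 0 <= sq x) ->
  (forall x, `|x| <= M -> sq x <= S) -> (forall x, abs1 (u x) <= C) ->
  (forall x, M < `|x| -> u x = 0) -> fast_decreasing sq u.
Proof.
move=> cu sq0 sqS uC u0; split => // N; exists ((1 + `|S|) ^+ N * C) => x.
have C0 : 0 <= C := le_trans (abs1_ge0 _) (uC x).
have [xM|/u0 ->] := leP `|x| M; last by rewrite normc0 mulr0 mulr_ge0// exprn_ge0// addr_ge0.
have h0 := sq0 x; apply: ler_pM; rewrite ?normc_nneg ?exprn_ge0 ?addr_ge0//.
  apply: lerXn2r; rewrite ?nnegrE ?addr_ge0// lerD2l.
  by apply: le_trans (sqS _ xM) _; exact: ler_norm.
exact: le_trans (normc_abs1 _) (uC x).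
Qed.

Lemma continuous_real_complex (T : topologicalType) (f : T -> R) : continuous f ->
  continuous ((fun t => (f t)%:C) : T -> R[i]^o).
Proof. by move=> cf t; apply: cvg_real_complex; exact: cf. Qed.

Lemma cvg_complex0 (v : nat -> R[i]) :
  (forall e : R, 0 < e -> \forall n \near \oo, abs1 (v n) <= e) ->
  ((v n : R[i]^o) @[n --> \oo] --> (0 : R[i]^o)).
Proof.
move=> H; apply/cvg_complexP; split; apply/cvgr0Pnorm_le => e /H; apply: filterS => n.
  by apply: le_trans; exact: ler_Re_abs1.
by apply: le_trans; exact: ler_Im_abs1.
Qed.

(** The term that appears when the cut-off in [B ((n + 1) t) psi t] is differentiated: an
    approximate point mass at 0, up to a factor. It lives on [0 < t < 1 / (n + 1)] because [h] is
    continuous from the right only. *)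
Definition mollifier (b psi : R -> R) (n : nat) (t : R) : R :=
  n.+1%:R * b (n.+1%:R * t) * psi t.

Variables (b psi : R -> R).
Hypotheses (cb : continuous b) (cpsi : continuous psi).
Hypotheses (b01 : forall t, 0 <= b t <= 1) (b0 : forall t, ~~ (0 < t < 1) -> b t = 0).

Lemma continuous_mollifier n : continuous (mollifier b psi n).
Proof.
have cs : continuous (fun s : R => n.+1%:R * s).
  by move=> s; apply: (@cvgM _ _ _ _ (fun _ => n.+1%:R) id); [exact: cvg_cst|exact: cvg_id].
have cbs : continuous (fun s : R => b (n.+1%:R * s)).
  by move=> s; apply: continuous_comp; [exact: cs|exact: cb].
move=> t; apply: (@cvgM _ _ _ _ (fun s => n.+1%:R * b (n.+1%:R * s)) psi); last exact: cpsi.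
by apply: (@cvgM _ _ _ _ (fun _ => n.+1%:R) (fun s => b (n.+1%:R * s))); [exact: cvg_cst|exact: cbs].
Qed.

Lemma mollifier_out n t : ~~ (0 < t < n.+1%:R^-1) -> mollifier b psi n t = 0.
Proof.
move=> h; rewrite /mollifier b0 ?mulr0 ?mul0r//; apply: contra h => /andP[h1 h2].
have n0 : 0 < n.+1%:R :> R by rewrite ltr0n.
by rewrite -(pmulr_rgt0 _ n0) h1 /= -[ltRHS]mul1r ltr_pdivlMr// mulrC.
Qed.

(** By right continuity [h] is close to [h 0] where the mollifier lives. The mass of the mollifier
    is kept as an integral: for two solutions with the same initial value it cancels. *)
Lemma mollified_value (h : R -> R[i]) :
  (forall t, (h s : R[i]^o) @[s --> t^'+] --> (h t : R[i]^o)) ->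
  ((Cint leb setT (fun t => h t * (mollifier b psi n t)%:C) -
    h 0 * Cint leb setT (fun t => (mollifier b psi n t)%:C) : R[i]^o) @[n --> \oo] --> (0 : R[i]^o)).
Proof.
move=> rc; have rcR t : (fun s => Re (h s)) @ t^'+ --> Re (h t) by have /cvg_complexP[] := rc t.
have rcI t : (fun s => Im (h s)) @ t^'+ --> Im (h t) by have /cvg_complexP[] := rc t.
have mD : measurable (`[0, +oo[%classic : set (measurableTypeR R)) by exact: measurable_itv.
(* Right continuity gives measurability on [t >= 0]; the extension by zero agrees with [h] where the
   mollifier lives. *)
pose hp (t : R) : R[i] := ((fun s => Re (h s)) \_ `[0, +oo[%classic) t +i*
  ((fun s => Im (h s)) \_ `[0, +oo[%classic) t.
have mhp : @cmeasurable _ (measurableTypeR R) R hp.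
  by split; apply/(measurable_restrictT _ mD); exact: measurable_right_continuous.
have hpE t : 0 <= t -> hp t = h t.
  move=> t0; have Dt : t \in (`[0, +oo[%classic : set R) by rewrite mem_setE in_itv /= t0.
  by rewrite /hp !patchE Dt; case: (h t).
have /(@compact_bounded R R^o) /bounded_setP[C0 hC0] : compact (psi @` `[0, 1]%classic).
  by apply: continuous_compact; [exact: continuous_subspaceT|exact: segment_compact].
pose C : R := `|C0|; have C_ge0 : 0 <= C := normr_ge0 C0.
have hC t : 0 < t < 1 -> `|psi t| <= C.
  move=> /andP[t0 t1]; have it : (psi @` `[0, 1]%classic) (psi t).
    by exists t => //; rewrite /= in_itv /= (ltW t0) (ltW t1).
  exact: le_trans (hC0 _ it) (ler_norm _).
apply: cvg_complex0 => e e0.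
(* The difference is at most [2 e'] in [abs1] and the mollifier at most [(n + 1) C], on an interval
   of length [1 / (n + 1)]; the product [2 e' C] is below [e]. *)
pose e' := e / (2 * (C + 1)); have e'0 : 0 < e' by apply: divr_gt0 => //; lra.
have near0 : \forall t \near 0^'+, abs1 (h t - h 0) <= 2 * e'.
  have /cvgrPdist_le /(_ _ e'0) h1 := rcR 0; have /cvgrPdist_le /(_ _ e'0) h2 := rcI 0.
  near=> t; rewrite /abs1 cReD cReN cImD cImN distrC [X in _ + X]distrC mulr_natl mulr2n.
  by apply: lerD; near: t.
move: near0; rewrite /at_right /within /= => /nbhs_ballP[del /= del0 hdel].
near=> n.
have n0 : 0 < n.+1%:R :> R by rewrite ltr0n.
have nd : n.+1%:R^-1 < del by near: n; exact: (near_infty_natSinv_lt (PosNum del0)).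
pose D : set (measurableTypeR R) := `]0, n.+1%:R^-1[%classic.
have mDn : measurable D by exact: measurable_itv.
pose th t := (mollifier b psi n t)%:C.
pose v t := (h t - h 0) * th t.
have th0 t : ~ D t -> th t = 0.
  by rewrite /D /= in_itv /= => /negP /mollifier_out; rewrite /th => ->.
have mth : @cmeasurable _ (measurableTypeR R) R th.
  by apply: continuous_cmeasurable_line; apply: continuous_real_complex; exact: continuous_mollifier.
have mv : @cmeasurable _ (measurableTypeR R) R v.
  rewrite (_ : v = fun t => (hp t - h 0) * th t).
    by apply: cmeasurableM => //; apply: cmeasurableB => //; exact: cmeasurable_cst.
  apply/funext => t; rewrite /v; have [Dt|/th0 ->] := pselect (D t); last by rewrite !mulr0.
  by rewrite hpE//; move: Dt; rewrite /D /= in_itv /= => /andP[/ltW].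
pose K := 2 * e' * (n.+1%:R * C).
have vK t : D t -> abs1 (v t) <= K.
  rewrite /D /= in_itv /= => tD; have /andP[t0 tn] := tD.
  apply: le_trans (abs1M _ _) _; apply: ler_pM; rewrite ?abs1_ge0//.
    apply: hdel => //; rewrite /ball /= sub0r normrN gtr0_norm//; exact: lt_trans nd.
  rewrite abs1_real /mollifier normrM ler_pM// ?normrM.
    rewrite (ger0_norm (ltW n0)) ger_pMr//; have /andP[b1 b2] := b01 (n.+1%:R * t).
    by rewrite ger0_norm.
  apply: hC; rewrite t0 /=; apply: lt_le_trans tn _; rewrite invf_le1// ler1n.
  by [].
have iK' : leb.-integrable `[0, n.+1%:R^-1] (EFin \o cst K).
  apply: continuous_compact_integrable; first exact: segment_compact.
  by apply: continuous_subspaceT => t; exact: cvg_cst.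
have iK : leb.-integrable D (EFin \o cst K).
  by apply: integrableS iK' => //; exact: subset_itv_oo_cc.
have iv : cintegrable leb D v by exact: (@cintegrable_le _ _ _ leb D (cst K)).
have vE : (fun t => (\1_D t)%:C * v t) = v.
  apply/funext => t; rewrite indicE; case: (boolP (t \in D)); first by rewrite mul1r.
  by rewrite notin_setE => /th0 h0; rewrite /v h0 !mulr0.
have ivT : cintegrable leb setT v by have := (cintegrable_mkcond leb mDn mv).1 iv; rewrite vE.
have ith : cintegrable leb setT th.
  apply: (@cintegrable_compact_support R th 1).
    by apply: continuous_real_complex; exact: continuous_mollifier.
  move=> t t1; apply: th0; rewrite /D /= in_itv /= => /andP[t0 tn].
  move: t1; rewrite gtr0_norm// leNgt; apply/negP/negPn; apply: lt_le_trans tn _.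
  by rewrite invf_le1// ler1n.
have -> : Cint leb setT (fun t => h t * th t) - h 0 * Cint leb setT th = Cint leb D v.
  rewrite -CintZ// [RHS]Cint_mkcond vE.
  rewrite (_ : Cint leb setT (fun t => h t * th t) = Cint leb setT (fun t => v t + h 0 * th t)); last first.
    by apply: eq_Cint => t _; rewrite /v mulrBl subrK.
  by rewrite CintD// ?addrK//; exact: cintegrableZ.
apply: le_trans (abs1_Cint mDn iv) _.
apply: (@le_trans _ _ (\int[leb]_(t in D) cst K t)).
  apply: le_Rintegral => //; first by have [] := iv.
have muD : leb D = (n.+1%:R^-1)%:E.
  by rewrite [LHS](lebesgue_measure_itv `]0, n.+1%:R^-1[) /= lte_fin invr_gt0 n0 oppr0 adde0.
rewrite Rintegral_cst// (_ : fine _ = n.+1%:R^-1); last exact: (congr1 fine muD).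
rewrite /K (mulrC n.+1%:R) mulrA mulfK ?gt_eqF//.
have E : e' * (2 * (C + 1)) = e by rewrite divfK// gt_eqF//; lra.
by rewrite -[leRHS]E; lra.
Unshelve. all: by end_near. Qed.

End mollification.

Section half_transport.
Context (R : realType) (d : nat).
Local Notation space := 'rV[R]_d.
Local Notation spacetime := ((('rV[R]_d * R^o)%type : normedModType R)).
Local Notation leb := (@lebesgue_measure R).
Variable g : space -> R[i].
Hypothesis mg : cmeasurable (g : borel space -> R[i]).
Hypothesis g_bounded : forall M : R, exists C : R, forall x, `|x| <= M -> abs1 (g x) <= C.
Context dT (T : measurableType dT) (lam : {measure set T -> \bar R}).
Variables (p : T -> borel spacetime).

(** As [th] vanishes at negative times, the restriction to the half-space does not change the
    integral, and the cadlag representation computes an integral against [V] itself. *)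
Lemma representation_at_time (f : T -> R[i]) (V : set spacetime -> R[i])
    (Vt : R -> set space -> R[i]) (u : space -> R[i]) (th : R -> R) (M C D : R) :
  represents lam p f V ->
  cadlag_representation (radon_density (@indicator_halfspace R d) V) Vt ->
  continuous (u : space -> R[i]^o) -> (forall x, abs1 (u x) <= C) ->
  (forall x, M < `|x| -> u x = 0) ->
  continuous th -> (forall t, `|th t| <= D) -> (forall t, M < `|t| -> th t = 0) ->
  (forall t, t < 0 -> th t = 0) ->
  Cint lam setT (fun x => (u (p x).1 * (th (p x).2)%:C) * f x) =
  Cint leb setT (fun t => pairing (Vt t) u * (th t)%:C).
Proof.
move=> rep cr cu uC u0 cth thD th0 thneg.
have fu : fast_decreasing (@sq_space R d) u.
  apply: (@continuous_fast_decreasing R space _ u M C (d%:R * M ^+ 2)) => //.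
    exact: sq_space_ge0.
  by move=> x xM; apply: sq_space_bound.
have cthc := continuous_real_complex cth.
have fth : fast_decreasing (@sq_time R) (fun t => (th t)%:C).
  apply: (@continuous_fast_decreasing R R^o _ (fun t => (th t)%:C) M D (M ^+ 2)) => //.
  - by move=> t; exact: sqr_ge0.
  - move=> t tM; rewrite /sq_time -(real_normK (num_real t)).
    by apply: lerXn2r; rewrite ?nnegrE//; exact: le_trans tM.
  - by move=> t; rewrite abs1_real.
  - by move=> t /th0 ->.
have [_ _ /(_ _ fth) E] := cr.2.2 u fu.
have mu : cmeasurable (u : borel space -> R[i]) by exact: continuous_cmeasurable.
have bv : bounded_supported (boxtimes u (fun t => (th t)%:C) : spacetime -> R[i]).
  apply: (@bounded_supported_tensor R d u (fun t => (th t)%:C) M C D) => //.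
  - exact: line_cmeasurable.
  - by move=> t; rewrite abs1_real.
  - by move=> t /th0 ->.
have mhalf := @measurable_halfspace R d.
have mi := @cmeasurable_indic _ (borel spacetime) R (@halfspace R d) mhalf.
have repT : represents lam p (fun x => indicator_halfspace (p x) * f x)
    (radon_density (@indicator_halfspace R d) V).
  apply: (represents_density rep mi) => B _; exists 1 => z _.
  by rewrite /indicator_halfspace abs1_real indicE; case: (_ \in _); rewrite ?normr1 ?normr0.
transitivity (pairing (radon_density (@indicator_halfspace R d) V)
    (boxtimes u (fun t => (th t)%:C))); last exact: E.
rewrite (integral_bounded_supported repT bv); apply: eq_Cint => x _.
rewrite /boxtimes mulrA; congr (_ * _); rewrite -mulrA; congr (_ * _).
rewrite /indicator_halfspace indicE; case: (boolP (p x \in @halfspace R d)) => [_|].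
  by rewrite mulr1.
by rewrite notin_setE /halfspace /= => /negP; rewrite -ltNge => /thneg ->; rewrite mul0r.
Qed.

Variables (f1 f2 : T -> R[i]) (V1 V2 Y : set spacetime -> R[i]).
Hypotheses (rep1 : represents lam p f1 V1) (rep2 : represents lam p f2 V2).
Hypotheses (ev1 : evolution_equation g V1 Y) (ev2 : evolution_equation g V2 Y).
Variables (Vt1 Vt2 : R -> set space -> R[i]).
Hypothesis cr1 : cadlag_representation (radon_density (@indicator_halfspace R d) V1) Vt1.
Hypothesis cr2 : cadlag_representation (radon_density (@indicator_halfspace R d) V2) Vt2.
Hypothesis initial : Vt1 0 = Vt2 0.

Let L := action lam p f1 f2.

Section fixed_function.
Variables (u : space -> R[i]) (M C : R).
Hypotheses (cu : continuous (u : space -> R[i]^o)) (uC : forall x, abs1 (u x) <= C).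
Hypotheses (u0 : forall x, M < `|x| -> u x = 0) (M1 : 1 <= M).

Let mu : cmeasurable (u : borel space -> R[i]). Proof. exact: continuous_cmeasurable. Qed.

Let M_out (h : R -> R) : (forall t, M < `|t| -> h t = 0) -> forall t, ~~ (- M <= t <= M) -> h t = 0.
Proof. by move=> h0 t; rewrite -ler_norml -ltNge => /h0. Qed.

Lemma mollifier_far (b psi : R -> R) n t : (forall t, ~~ (0 < t < 1) -> b t = 0) ->
  M < `|t| -> mollifier b psi n t = 0.
Proof.
move=> b0 tM; apply: mollifier_out => //; apply/negP => /andP[t0 tn].
move: tM; rewrite gtr0_norm// ltNge => /negP; apply; apply: ltW.
apply: lt_le_trans tn _; apply: le_trans M1; rewrite invf_le1// ler1n//.
Qed.

Lemma bounded_supported_mollifier (b psi : R -> R) n : continuous b -> continuous psi ->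
  (forall t, ~~ (0 < t < 1) -> b t = 0) ->
  bounded_supported ((fun z => u z.1 * (mollifier b psi n z.2)%:C) : spacetime -> R[i]).
Proof.
move=> cb cpsi b0; have cm := continuous_mollifier cb cpsi (n := n).
have [D [_ hD]] := bounded_compact_support cm (M_out (fun t => @mollifier_far b psi n t b0)).
apply: (@bounded_supported_tensor R d u (fun t => (mollifier b psi n t)%:C) M C D) => //.
- exact: line_cmeasurable.
- by move=> t; rewrite abs1_real.
- by move=> t /(mollifier_far _ _ b0) ->.
Qed.

(** For [V1] and for [V2] the integral is asymptotic to the pairing of the initial value with [u]
    times the same mass, so the difference tends to zero. *)
Lemma initial_trace (b psi : R -> R) : continuous b -> continuous psi ->
  (forall t, 0 <= b t <= 1) -> (forall t, ~~ (0 < t < 1) -> b t = 0) ->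
  ((L (fun z => u z.1 * (mollifier b psi n z.2)%:C) : R[i]^o) @[n --> \oo] --> (0 : R[i]^o)).
Proof.
move=> cb cpsi b01 b0.
pose th n t := (mollifier b psi n t)%:C.
pose h1 t := pairing (Vt1 t) u; pose h2 t := pairing (Vt2 t) u.
pose D1 n := Cint leb setT (fun t => h1 t * th n t) - h1 0 * Cint leb setT (th n).
pose D2 n := Cint leb setT (fun t => h2 t * th n t) - h2 0 * Cint leb setT (th n).
have fu : fast_decreasing (@sq_space R d) u.
  apply: (@continuous_fast_decreasing R space _ u M C (d%:R * M ^+ 2)) => //.
    exact: sq_space_ge0.
  by move=> x xM; apply: sq_space_bound.
have rc1 t : (h1 s : R[i]^o) @[s --> t^'+] --> (h1 t : R[i]^o).
  by have [cad _ _] := cr1.2.2 u fu; exact: (cad t).1.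
have rc2 t : (h2 s : R[i]^o) @[s --> t^'+] --> (h2 t : R[i]^o).
  by have [cad _ _] := cr2.2.2 u fu; exact: (cad t).1.
have l1 := mollified_value cb cpsi b01 b0 rc1.
have l2 := mollified_value cb cpsi b01 b0 rc2.
have h := @cvg_complexD R nat _ _ D1 (fun n => - D2 n) 0 (- 0) l1 (@cvg_complexN R nat _ _ D2 0 l2).
have z : (0 : R[i]) + - 0 = 0 by rewrite oppr0 addr0.
rewrite z in h; suff -> : (fun n => L (fun z => u z.1 * (mollifier b psi n z.2)%:C)) =
  (fun n => D1 n + - D2 n) by exact: h.
apply/funext => n; rewrite /L (action_difference rep1 rep2); last exact: bounded_supported_mollifier.
have cm := continuous_mollifier cb cpsi (n := n).
have [D [_ hD]] := bounded_compact_support cm (M_out (fun t => @mollifier_far b psi n t b0)).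
have neg t : t < 0 -> mollifier b psi n t = 0.
  by move=> t0; apply: mollifier_out => //; rewrite ltNge (ltW t0).
have far t : M < `|t| -> mollifier b psi n t = 0 by exact: mollifier_far.
rewrite (representation_at_time rep1 cr1 cu uC u0 cm hD far neg).
rewrite (representation_at_time rep2 cr2 cu uC u0 cm hD far neg).
by rewrite /D1 /D2 /h1 /h2 initial opprB addrA subrK.
Qed.

End fixed_function.
End half_transport.

(** * Sharp cut-off at time 0 *)

Section cut_transport.
Context (R : realType) (d : nat).
Local Notation space := 'rV[R]_d.
Local Notation spacetime := ((('rV[R]_d * R^o)%type : normedModType R)).
Variable g : space -> R[i].
Hypothesis mg : cmeasurable (g : borel space -> R[i]).
Hypothesis g_bounded : forall M : R, exists C : R, forall x, `|x| <= M -> abs1 (g x) <= C.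
Context dT (T : measurableType dT) (lam : {measure set T -> \bar R}).
Variables (p : T -> borel spacetime).
Variables (f1 f2 : T -> R[i]) (V1 V2 Y : set spacetime -> R[i]).
Hypotheses (rep1 : represents lam p f1 V1) (rep2 : represents lam p f2 V2).
Hypotheses (ev1 : evolution_equation g V1 Y) (ev2 : evolution_equation g V2 Y).
Variables (Vt1 Vt2 : R -> set space -> R[i]).
Hypothesis cr1 : cadlag_representation (radon_density (@indicator_halfspace R d) V1) Vt1.
Hypothesis cr2 : cadlag_representation (radon_density (@indicator_halfspace R d) V2) Vt2.
Hypothesis initial : Vt1 0 = Vt2 0.

Let L := action lam p f1 f2.

Variables (u : space -> R[i]) (M C : R).
Hypotheses (cu : continuous (u : space -> R[i]^o)) (uC : forall x, abs1 (u x) <= C).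
Hypotheses (u0 : forall x, M < `|x| -> u x = 0) (M1 : 1 <= M).
Variables (B b : R -> R) (c : R).
Hypotheses (sB : line_smooth B) (sb : line_smooth b).
Hypothesis hB : forall t, is_derive t (1 : R) B (b t).
Hypotheses (b01 : forall t, 0 <= b t <= 1) (B01 : forall t, 0 <= B t <= c).
Hypotheses (B_left : forall t, t <= 0 -> B t = 0) (B_right : forall t, 1 <= t -> B t = c).
Hypothesis b0 : forall t, ~~ (0 < t < 1) -> b t = 0.
Variables (psi dpsi : R -> R) (e1 e2 : R).
Hypotheses (spsi : line_smooth psi) (sdpsi : line_smooth dpsi).
Hypothesis hpsi : forall t, is_derive t (1 : R) psi (dpsi t).

(** A smooth cut-off at [t = 0]: in the limit, [(e1, e2) = (0, 1)] keeps [t > 0] and [(c, -1)] keeps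
    [t <= 0], both with the factor [c]. *)
Let beta n (t : R) := e1 + e2 * B (n.+1%:R * t).
Hypothesis beta_psi : forall n t, M < `|t| -> beta n t * psi t = 0.

Let sbeta n : line_smooth (beta n).
Proof.
apply: line_smoothD; first exact: line_smooth_cst.
apply: line_smoothM; first exact: line_smooth_cst.
by apply: line_smooth_comp => //; exact: line_smooth_scale.
Qed.

Let dchi n (t : R) := e2 * mollifier b psi n t + beta n t * dpsi t.

Let derive_cut n t : is_derive t (1 : R) (fun s => beta n s * psi s) (dchi n t).
Proof.
have hs : is_derive t (1 : R) (fun s : R => n.+1%:R * s) n.+1%:R.
  have := is_deriveZ (n.+1%:R : R) (is_derive_id t (1 : R)).
  by rewrite /GRing.scale /= mulr1.
have hc := @is_derive1_comp R B (fun s => n.+1%:R * s) t _ _ (hB _) hs.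
have hb : is_derive t (1 : R) (beta n) (e2 * (b (n.+1%:R * t) * n.+1%:R)).
  have := is_deriveD (is_derive_cst e1 t (1 : R)) (is_deriveZ e2 hc).
  by rewrite add0r.
apply: (is_derive_eq (is_deriveM hb (hpsi t))).
by rewrite /GRing.scale /= /dchi /mollifier; ring.
Qed.

Let sdchi n : line_smooth (dchi n).
Proof.
apply: line_smoothD; last exact: line_smoothM.
apply: line_smoothM; first exact: line_smooth_cst.
apply: line_smoothM => //; apply: line_smoothM; first exact: line_smooth_cst.
by apply: line_smooth_comp => //; exact: line_smooth_scale.
Qed.

Let beta_dpsi n t : M < `|t| -> beta n t * dpsi t = 0.
Proof.
move=> tM; have := derive_outside_support (@open_norm_gt R M) (derive_cut n) (beta_psi n) tM.
by rewrite /dchi (mollifier_far M1 psi n b0 tM) mulr0 add0r.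
Qed.

(** [psi] alone may have unbounded support. Truncation to [|t| <= M] is invisible after
    multiplication by [beta n], and it yields one integrable bound for all [n]. *)
Let w (z : spacetime) : R[i] :=
  (u z.1 * (\1_[set t : R | `|t| <= M] z.2)%:C) * transport g psi dpsi z.

Let bounded_w : bounded_supported w.
Proof.
have cut (h : R -> R) : line_smooth h -> bounded_supported ((fun z : spacetime =>
    u z.1 * ((\1_[set t : R | `|t| <= M] z.2)%:C * (h z.2)%:C)) : spacetime -> R[i]).
  move=> sh; have ch := line_smooth_continuous sh.
  have /(@compact_bounded R R^o) /bounded_setP[D hD] : compact (h @` `[- M, M]%classic).
    by apply: continuous_compact; [exact: continuous_subspaceT|exact: segment_compact].
  have mset : measurable ([set t : R | `|t| <= M] : set (measurableTypeR R)).
    rewrite (_ : [set _ | _] = `[- M, M]%classic); first exact: measurable_itv.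
    by apply/seteqP; split => t /=; rewrite in_itv /= ler_norml.
  apply: (@bounded_supported_tensor R d u (fun t => (\1_[set t : R | `|t| <= M] t)%:C * (h t)%:C)
    M C `|D|) => //.
  - exact: continuous_cmeasurable.
  - apply: cmeasurableM; last exact: line_cmeasurable.
    exact: (@cmeasurable_indic _ (measurableTypeR R) R).
  - move=> t; rewrite indicE; case: (boolP (t \in _)); last by rewrite mul0r /abs1 /= normr0 addr0.
    rewrite inE /= mul1r abs1_real => tM; apply: le_trans (ler_norm D); apply: hD.
    by exists t => //; rewrite /= in_itv /= -ler_norml.
  - move=> t tM; rewrite indicE (_ : _ \in _ = false) ?mul0r//.
    by apply/negbTE; rewrite notin_setE /= leNgt tM.
rewrite (_ : w = fun z => -1 * (u z.1 * ((\1_[set t : R | `|t| <= M] z.2)%:C * (dpsi z.2)%:C)) +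
    g z.1 * (u z.1 * ((\1_[set t : R | `|t| <= M] z.2)%:C * (psi z.2)%:C))); last first.
  apply/funext => z; rewrite /w /transport.
  move: (u _) (_%:C) (_%:C) (g _) (_%:C) => x1 x2 x3 x4 x5; ring.
apply: bounded_supportedD.
  apply: (@bounded_supportedM_bounded R spacetime (fun _ => -1) _ 1); last exact: cut.
    exact: cmeasurable_cst.
  by move=> _; rewrite /abs1 /= normrN normr1 oppr0 normr0 addr0.
apply: (@bounded_supportedM R spacetime (fun z => g z.1)); last exact: cut.
  exact: cmeasurable_space.
exact: symbol_bounded.
Qed.

(** The identity is applied to [beta n psi]. Differentiating [beta n] produces a mollifier, whose
    contribution disappears by [initial_trace]; the rest converges by dominated convergence. *)
Lemma transport_cut :
  L (fun z => u z.1 * ((e1 + e2 * (c * (0 < z.2)%R%:R))%:C * transport g psi dpsi z)) = 0.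
Proof.
have mu : cmeasurable (u : borel space -> R[i]) by exact: continuous_cmeasurable.
have wE n z : (beta n z.2)%:C * w z = u z.1 * ((beta n z.2)%:C * transport g psi dpsi z).
  rewrite /w indicE; case: (boolP (z.2 \in _)).
    by move=> _; rewrite mulr1 mulrCA.
  rewrite notin_setE /= => /negP; rewrite -ltNge => zM; rewrite mulr0 mul0r mulr0.
  rewrite /transport mulrDr mulrN mulrCA -!rmorphM /= beta_dpsi// beta_psi//.
  by rewrite oppr0 add0r mulr0 mulr0.
have bw n : bounded_supported (fun z => (beta n z.2)%:C * w z).
  apply: (@bounded_supportedM_bounded R spacetime (fun z => (beta n z.2)%:C) w (`|e1| + `|e2| * c)) => //.
    apply: (@cmeasurable_time R d (fun t => (beta n t)%:C)).
    by apply: line_cmeasurable; exact: line_smooth_continuous.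
  move=> z; rewrite abs1_real; apply: le_trans (ler_normD _ _) _; rewrite lerD2l normrM.
  by apply: ler_wpM2l => //; have /andP[h1 h2] := B01 (n.+1%:R * z.2); rewrite ger0_norm.
have bm n : bounded_supported ((fun z => u z.1 * (mollifier b psi n z.2)%:C) : spacetime -> R[i]).
  by apply: (bounded_supported_mollifier cu uC u0 M1 n) => //; exact: line_smooth_continuous.
have LE n : L (fun z => (beta n z.2)%:C * w z) =
    e2%:C * L (fun z => u z.1 * (mollifier b psi n z.2)%:C).
  have := @transport_identity R d g mg g_bounded dT T lam p f1 f2 V1 V2 Y rep1 rep2 ev1 ev2
    (fun t => beta n t * psi t) (dchi n) M u C (line_smoothM (sbeta n) spsi) (sdchi n)
    (derive_cut n) (beta_psi n) mu uC u0.
  have -> : (fun z => u z.1 * transport g (fun t => beta n t * psi t) (dchi n) z) =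
      (fun z => (beta n z.2)%:C * w z + (- e2%:C) * (u z.1 * (mollifier b psi n z.2)%:C)).
    apply/funext => z; rewrite wE /transport /dchi rmorphD !rmorphM /=.
    move: (u _) (e2%:C) (_%:C) (_%:C) (_%:C) (g _) (_%:C) => x1 x2 x3 x4 x5 x6 x7; ring.
  have bm' : bounded_supported ((fun z => (- e2%:C) * (u z.1 * (mollifier b psi n z.2)%:C)) :
      spacetime -> R[i]).
    apply: (@bounded_supportedM_bounded R spacetime (fun _ => - e2%:C) _ (abs1 (- e2%:C)) _ _ (bm n)).
      exact: (@cmeasurable_cst _ (borel spacetime)).
    by move=> _; exact: lexx.
  rewrite (actionD rep1 rep2 (bw n) bm') => /eqP; rewrite addr_eq0 => /eqP E.
  apply: (etrans E); rewrite /L /action -CintN//; last exact: (action_integrable rep1 rep2 bm').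
  rewrite -CintZ//; last exact: (action_integrable rep1 rep2 (bm n)).
  by apply: eq_Cint => x _; rewrite !mulNr opprK mulrA.
have lim0 : ((L (fun z => (beta n z.2)%:C * w z) : R[i]^o) @[n --> \oo] --> (0 : R[i]^o)).
  have cb := line_smooth_continuous sb; have cpsi := line_smooth_continuous spsi.
  have h := initial_trace rep1 rep2 cr1 cr2 initial cu uC u0 M1 cb cpsi b01 b0.
  have h' := @cvg_complexM R nat \oo _ (fun _ => e2%:C) _ (e2%:C) 0 (cvg_cst _) h.
  rewrite mulr0 in h'.
  rewrite (_ : (fun n => _) = (fun n => e2%:C * L (fun z => u z.1 * (mollifier b psi n z.2)%:C))).
    exact: h'.
  by apply/funext => n; exact: LE.
pose G (z : spacetime) := u z.1 * ((e1 + e2 * (c * (0 < z.2)%R%:R))%:C * transport g psi dpsi z).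
have lim : ((L (fun z => (beta n z.2)%:C * w z) : R[i]^o) @[n --> \oo] --> (L G : R[i]^o)).
  have [mf _] := action_integrable rep1 rep2 bounded_w.
  have [mp _ _ _] := rep1.
  (* At [t = 0] the step is 0 for every [n], so mass at time 0 is counted with the half line
     [t <= 0]. *)
  have cvgB (t : R) : B (n.+1%:R * t) @[n --> \oo] --> (c * (0 < t)%R%:R : R).
    apply: cvg_near_cst; have [t0|t0] := ltP 0 t; last first.
      by apply: nearW => n; rewrite mulr0 B_left// mulr_ge0_le0.
    have ti : 0 < t by [].
    apply: (filterS _ (near_infty_natSinv_lt (PosNum ti))) => n /= h.
    rewrite mulr1 B_right// -(@ler_pdivrMl _ n.+1%:R) ?ltr0n// mulr1; exact: ltW.
  have cvgbeta (t : R) : ((beta n t)%:C : R[i]^o) @[n --> \oo] -->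
      ((e1 + e2 * (c * (0 < t)%R%:R))%:C : R[i]^o).
    apply: cvg_real_complex; apply: cvgD; first exact: cvg_cst.
    by apply: cvgM; [exact: cvg_cst|exact: cvgB].
  have cvgG z : ((beta n z.2)%:C * w z : R[i]^o) @[n --> \oo] --> (G z : R[i]^o).
    rewrite (_ : (fun n => _) = fun n => u z.1 * ((beta n z.2)%:C * transport g psi dpsi z)); last first.
      by apply/funext => n; exact: wE.
    apply: (@cvg_complexM R nat \oo _ (fun _ => u z.1)
      (fun n => (beta n z.2)%:C * transport g psi dpsi z)); first exact: cvg_cst.
    by apply: (@cvg_complexM R nat \oo _ (fun n => (beta n z.2)%:C) (fun _ => transport g psi dpsi z));
      [exact: cvgbeta|exact: cvg_cst].
  have cvgF x : ((beta n (p x).2)%:C * w (p x) * (f1 x - f2 x) : R[i]^o) @[n --> \oo] -->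
      (G (p x) * (f1 x - f2 x) : R[i]^o).
    apply: (@cvg_complexM R nat \oo _ (fun n => (beta n (p x).2)%:C * w (p x))
      (fun _ => f1 x - f2 x)); [exact: cvgG|exact: cvg_cst].
  have mF n : cmeasurable (fun x => (beta n (p x).2)%:C * w (p x) * (f1 x - f2 x)).
    by have [] := action_integrable rep1 rep2 (bw n).
  pose K := `|e1| + `|e2| * c.
  have mG : cmeasurable (fun x => G (p x) * (f1 x - f2 x)).
    by split; [apply: (measurable_fun_cvg (fun n => (mF n).1))|
             apply: (measurable_fun_cvg (fun n => (mF n).2))] => x _;
      have /cvg_complexP[] := cvgF x.
  have iK : lam.-integrable setT (EFin \o (fun x => K * abs1 (w (p x) * (f1 x - f2 x)))).
    have [_ iw] := action_integrable rep1 rep2 bounded_w.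
    have h (k : T -> R) : lam.-integrable setT (EFin \o k) ->
        lam.-integrable setT (EFin \o (fun x => K * k x)) by exact: integrableZl.
    exact: (h (fun x => abs1 (w (p x) * (f1 x - f2 x))) iw).
  have bnd n x : setT x -> abs1 ((beta n (p x).2)%:C * w (p x) * (f1 x - f2 x)) <=
      K * abs1 (w (p x) * (f1 x - f2 x)).
    move=> _; rewrite -mulrA; apply: le_trans (abs1M _ _) _.
    apply: ler_wpM2r; first exact: abs1_ge0.
    rewrite abs1_real; apply: le_trans (ler_normD _ _) _; rewrite lerD2l normrM.
    by apply: ler_wpM2l => //; have /andP[h1 h2] := B01 (n.+1%:R * (p x).2); rewrite ger0_norm.
  exact: (Cint_dominated measurableT mF mG (fun x _ => cvgF x) iK bnd).
exact: (cvg_unique (@norm_hausdorff _ _) lim lim0).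
Qed.

End cut_transport.

(** * Iterated primitives *)

Section iterated_primitives.
Context (R : realType).

(** Adding [A / m exp (- m t)] to [psi] or to [- psi] gives a nonincreasing function, which is
    positive or zero at [T0], where [psi] vanishes. *)
Lemma primitive_exp_bound (psi dpsi : R -> R) (T0 A m t : R) : 0 < m ->
  (forall t, is_derive t (1 : R) psi (dpsi t)) -> (forall t, T0 <= t -> psi t = 0) ->
  (forall t, `|dpsi t| <= A * expR (- (m * t))) -> `|psi t| <= A / m * expR (- (m * t)).
Proof.
move=> m0 hpsi psi0 dA.
have A0 : 0 <= A by rewrite -(pmulr_lge0 _ (expR_gt0 (- (m * 0)))); exact: le_trans (dA 0).
have Am0 s : 0 <= A / m * expR (- (m * s)) by rewrite mulr_ge0 ?expR_ge0// divr_ge0// ltW.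
have [tT|/ltW tT] := leP T0 t; first by rewrite psi0// normr0.
have he s : is_derive s (1 : R) (fun s => A / m * expR (- (m * s))) (- (A * expR (- (m * s)))).
  have hl : is_derive s (1 : R) (fun s : R => - (m * s)) (- m).
    have := is_deriveN (is_deriveZ m (is_derive_id s (1 : R))).
    by rewrite /GRing.scale /= mulr1.
  have hc := @is_derive1_comp R expR (fun s => - (m * s)) s _ _ (is_derive_expR _) hl.
  apply: (is_derive_eq (is_deriveZ (A / m) hc)).
  by rewrite /GRing.scale /= !mulrN (mulrC (expR _) m) mulrA divfK ?gt_eqF.
have d1 s := is_deriveD (hpsi s) (he s).
have d2 s := is_deriveD (is_deriveN (hpsi s)) (he s).
have le1 : psi T0 + A / m * expR (- (m * T0)) <= psi t + A / m * expR (- (m * t)).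
  apply: (le_of_derive_le0 d1 _ tT) => s _.
  by have := dA s; rewrite ler_norml => /andP[_ ?]; lra.
have le2 : - psi T0 + A / m * expR (- (m * T0)) <= - psi t + A / m * expR (- (m * t)).
  apply: (le_of_derive_le0 d2 _ tT) => s _.
  by have := dA s; rewrite ler_norml => /andP[? _]; lra.
have p0 := psi0 T0 (lexx _); have h := Am0 T0; rewrite p0 add0r in le1; rewrite p0 oppr0 add0r in le2.
by rewrite ler_norml; apply/andP; split; lra.
Qed.

(* Each primitive gains the factor [1 / (m + 1)] in the weighted norm, each application of g
   only costs m. *)
Lemma iterated_primitives_vanish (J : nat -> (R -> R) -> R[i]) (m K T0 : R) : 0 <= m ->
  (forall k psi dpsi, line_smooth psi -> line_smooth dpsi ->
    (forall t, is_derive t (1 : R) psi (dpsi t)) -> (forall t, T0 <= t -> psi t = 0) ->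
    (forall t, T0 <= t -> dpsi t = 0) -> J k dpsi = J k.+1 psi) ->
  (forall k psi A, line_smooth psi -> (forall t, T0 <= t -> psi t = 0) ->
    (forall t, `|psi t| <= A * expR (- ((m + 1) * t))) -> abs1 (J k psi) <= K * m ^+ k * A) ->
  forall theta A, line_smooth theta -> (forall t, T0 <= t -> theta t = 0) ->
    (forall t, `|theta t| <= A * expR (- ((m + 1) * t))) -> J 0%N theta = 0.
Proof.
move=> m0 H1 H2 theta A st th0 thA.
have m1 : 0 < m + 1 by lra.
have step k : exists psi, [/\ line_smooth psi, forall t, T0 <= t -> psi t = 0,
    forall t, `|psi t| <= A / (m + 1) ^+ k * expR (- ((m + 1) * t)) & J 0%N theta = J k psi].
  elim: k => [|k [psi [sp p0 pA pJ]]].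
    by exists theta; split => // t; rewrite expr0 divr1.
  have [F [hF F0]] := primitive_right (line_smooth_continuous sp) p0.
  have sF := line_smooth_primitive sp hF.
  exists F; split => // [t|]; last by rewrite pJ; exact: H1.
  have := primitive_exp_bound t m1 hF F0 pA.
  by rewrite (_ : A / _ / _ = A / (m + 1) ^+ k.+1)// exprSr invfM mulrA.
have bnd k : abs1 (J 0%N theta) <= K * A * (m / (m + 1)) ^+ k.
  have [psi [sp p0 pA ->]] := step k; apply: le_trans (H2 k psi _ sp p0 pA) _.
  by rewrite expr_div_n mulrACA.
have lim : (fun k => K * A * (m / (m + 1)) ^+ k) @ \oo --> (0 : R).
  rewrite -[X in _ --> X](mulr0 (K * A)); apply: cvgM; first exact: cvg_cst.
  apply: cvg_expr; rewrite ger0_norm ?divr_ge0// ?ltW//; rewrite ltr_pdivrMr// mul1r; lra.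
have : abs1 (J 0%N theta) <= 0.
  rewrite -(cvg_lim (@Rhausdorff R) lim); apply: limr_ge; first by apply/cvg_ex; exists 0.
  by apply: nearW => k; exact: bnd.
move=> h; have : abs1 (J 0%N theta) = 0 by apply/eqP; rewrite eq_le h abs1_ge0.
rewrite /abs1 => /eqP; rewrite paddr_eq0// !normr_eq0 => /andP[/eqP r0 /eqP i0].
exact: complex_eqP.
Qed.

End iterated_primitives.

Lemma measurable_half_line (R : realType) (b : bool) :
  measurable_fun setT (fun t : measurableTypeR R => ((0 < t)%R (+) b)%:R : R).
Proof.
have mpos : measurable (`]0, +oo[%classic : set (measurableTypeR R)) by exact: measurable_itv.
rewrite (_ : (fun _ => _) = fun t => \1_(if b then ~` `]0, +oo[%classic else `]0, +oo[%classic) t).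
  by apply: measurable_indic; case: b => //; exact: measurableC.
apply/funext => t; rewrite indicE; congr ((nat_of_bool _)%:R).
by case: b; rewrite /= ?addbT ?addbF ?in_setC mem_setE in_itv /= andbT.
Qed.

(** * Uniqueness *)

Section uniqueness.
Context (R : realType) (d : nat).
Local Notation space := 'rV[R]_d.
Local Notation spacetime := ((('rV[R]_d * R^o)%type : normedModType R)).
Variable g : space -> R[i].
Hypothesis cg : continuous (g : space -> R[i]^o).
Hypothesis g_bounded : forall M : R, exists C : R, forall x, `|x| <= M -> abs1 (g x) <= C.
Context dT (T : measurableType dT) (lam : {measure set T -> \bar R}).
Variables (p : T -> borel spacetime).
Variables (f1 f2 : T -> R[i]) (V1 V2 Y : set spacetime -> R[i]).
Hypotheses (rep1 : represents lam p f1 V1) (rep2 : represents lam p f2 V2).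
Hypotheses (ev1 : evolution_equation g V1 Y) (ev2 : evolution_equation g V2 Y).
Variables (Vt1 Vt2 : R -> set space -> R[i]).
Hypothesis cr1 : cadlag_representation (radon_density (@indicator_halfspace R d) V1) Vt1.
Hypothesis cr2 : cadlag_representation (radon_density (@indicator_halfspace R d) V2) Vt2.
Hypothesis initial : Vt1 0 = Vt2 0.

Let L := action lam p f1 f2.
Let f x := f1 x - f2 x.

Let mg : cmeasurable (g : borel space -> R[i]). Proof. exact: continuous_cmeasurable. Qed.

Section half_line.
(* [sigma = false] is the half line t > 0; [sigma = true] is the half line t <= 0, where time and
   the sign of g are reversed. *)
Variable sigma : bool.
Variables (u : space -> R[i]) (M C m : R).
Hypotheses (cu : continuous (u : space -> R[i]^o)) (uC : forall x, abs1 (u x) <= C).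
Hypotheses (u0 : forall x, M < `|x| -> u x = 0) (M1 : 1 <= M).
Hypotheses (m0 : 0 <= m) (gm : forall x, `|x| <= M -> abs1 (g x) <= m).

Let sgn : R := (-1) ^+ sigma.
Let half (psi : R -> R) (t : R) : R := (((0 < t)%R (+) sigma)%:R) * psi (sgn * t).
(** Each primitive in time is paid for by one more factor [g], with a minus sign when time is
    reversed. *)
Let U k x := u x * (sgn%:C * g x) ^+ k.

Let sgn2 : sgn * sgn = 1. Proof. by rewrite -expr2 sqrr_sign. Qed.

Let continuous_U k : continuous (U k : space -> R[i]^o).
Proof.
elim: k => [|k IH] x.
  rewrite (_ : U 0 = u); first exact: cu.
  by apply/funext => y; rewrite /U expr0 mulr1.
rewrite (_ : U k.+1 = fun y => U k y * (sgn%:C * g y)); last first.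
  by apply/funext => y; rewrite /U exprSr mulrA.
apply: (@cvg_complexM R space (nbhs x) _ (U k) (fun y => sgn%:C * g y)); first exact: IH.
apply: (@cvg_complexM R space (nbhs x) _ (fun _ => sgn%:C) g); first exact: cvg_cst.
exact: cg.
Qed.

Let abs1_sgn z : abs1 (sgn%:C * z) = abs1 z.
Proof.
rewrite /sgn; case: sigma; rewrite ?expr0 ?mul1r//.
by rewrite expr1 rmorphN /= mulN1r abs1N.
Qed.

Let C0 : 0 <= C. Proof. exact: le_trans (abs1_ge0 _) (uC 0). Qed.

Let U_le k x : abs1 (U k x) <= C * m ^+ k.
Proof.
have [xM|/u0 ux] := leP `|x| M; last first.
  by rewrite /U ux mul0r /abs1 /= normr0 addr0 mulr_ge0// exprn_ge0.
elim: k => [|k IH]; first by rewrite /U !expr0 !mulr1.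
have -> : U k.+1 x = U k x * (sgn%:C * g x) by rewrite /U exprSr mulrA.
rewrite exprSr [leRHS]mulrA; apply: le_trans (abs1M _ _) _.
by rewrite abs1_sgn; apply: ler_pM; rewrite ?abs1_ge0// gm.
Qed.

Let U_out k x : M < `|x| -> U k x = 0.
Proof. by move=> /u0; rewrite /U => ->; rewrite mul0r. Qed.

Let half_out psi t : (forall t, M <= t -> psi t = 0) -> M < `|t| -> half psi t = 0.
Proof.
move=> p0; rewrite /half /sgn; case: sigma; rewrite /= ?addbT ?addbF ?expr0 ?expr1 ?mul1r ?mulN1r.
  case: (ltP 0 t) => [_|t0]; first by rewrite mul0r.
  by rewrite ler0_norm// => /ltW /p0 ->; rewrite mulr0.
case: (ltP 0 t) => [t0|_]; last by rewrite mul0r.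
by rewrite gtr0_norm// => /ltW /p0 ->; rewrite mulr0.
Qed.

Let half_nneg psi t : half psi t = 0 \/ 0 <= sgn * t.
Proof.
rewrite /half /sgn; case: sigma; rewrite /= ?addbT ?addbF ?expr0 ?expr1 ?mul1r ?mulN1r ?oppr_ge0.
  by case: (ltP 0 t) => [_|t0]; [left; rewrite mul0r|right].
by case: (ltP 0 t) => [/ltW t0|_]; [right|left; rewrite mul0r].
Qed.

Let bounded_half k psi : line_smooth psi -> (forall t, M <= t -> psi t = 0) ->
  bounded_supported ((fun z => U k z.1 * (half psi z.2)%:C) : spacetime -> R[i]).
Proof.
move=> sp p0.
have : compact (psi @` `[- M, M]%classic).
  apply: continuous_compact; last exact: segment_compact.
  by apply: continuous_subspaceT; exact: line_smooth_continuous.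
move=> /(@compact_bounded R R^o) /bounded_setP[D hD].
have mU : cmeasurable (U k : borel space -> R[i]) by exact: (continuous_cmeasurable (@continuous_U k)).
apply: (@bounded_supported_tensor R d (U k) (fun t => (half psi t)%:C) M (C * m ^+ k) `|D|) => //.
- apply: cmeasurable_real; apply: measurable_funM; last first.
    apply: continuous_measurable_fun; apply: line_smooth_continuous.
    exact: (line_smooth_comp sp (line_smooth_scale sgn)).
  exact: measurable_half_line.
- move=> t; rewrite abs1_real; have [tM|tM] := leP `|t| M; last by rewrite (@half_out psi t p0 tM) normr0.
  rewrite /half normrM; apply: (@le_trans _ _ (1 * `|psi (sgn * t)|)).
    by apply: ler_wpM2r => //; case: (_ (+) _); rewrite ?normr1 ?normr0.
  rewrite mul1r; apply: le_trans (ler_norm D); apply: hD; exists (sgn * t) => //.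
  by rewrite /= in_itv /= -ler_norml normrM normrX normrN1 expr1n mul1r.
- exact: U_out.
- by move=> t tM; rewrite (@half_out psi t p0 tM).
Qed.

Let J k psi := L (fun z => U k z.1 * (half psi z.2)%:C).

(** This is [transport_cut] for [chi t = psi (sgn t)], with [e1] and [e2] selecting the half line;
    the nonzero factor [sgn c] is divided out. *)
Let J_step k psi dpsi : line_smooth psi -> line_smooth dpsi ->
  (forall t, is_derive t (1 : R) psi (dpsi t)) -> (forall t, M <= t -> psi t = 0) ->
  (forall t, M <= t -> dpsi t = 0) -> J k dpsi = J k.+1 psi.
Proof.
move=> sp sdp hp p0 dp0.
have [B [b [c cpos [sB sb hB bB [B_left B_right b0]]]]] := smooth_step R.
pose e1 : R := if sigma then c else 0; pose e2 : R := if sigma then -1 else 1.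
pose chi t := psi (sgn * t); pose dchi t := sgn * dpsi (sgn * t).
have schi : line_smooth chi by exact: (line_smooth_comp sp (line_smooth_scale sgn)).
have sdchi : line_smooth dchi.
  apply: line_smoothM; first exact: line_smooth_cst.
  exact: (line_smooth_comp sdp (line_smooth_scale sgn)).
have hchi t : is_derive t (1 : R) chi (dchi t).
  have hs : is_derive t (1 : R) (fun s : R => sgn * s) sgn.
    have := is_deriveZ sgn (is_derive_id t (1 : R)).
    by rewrite /GRing.scale /= mulr1.
  by have := @is_derive1_comp R psi (fun s => sgn * s) t _ _ (hp _) hs; rewrite mulrC.
(* On one side of the origin [psi] vanishes, on the other the cut-off does. For [t > M] the latter
   has reached its final value because [1 <= M]. *)
have far n t : M < `|t| -> (e1 + e2 * B (n.+1%:R * t)) * chi t = 0.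
  have n0 : 0 < n.+1%:R :> R by rewrite ltr0n.
  have n1 : 1 <= n.+1%:R :> R by rewrite ler1n.
  rewrite /e1 /e2 /chi /sgn; case: sigma; rewrite ?expr0 ?expr1 ?mul1r ?mulN1r ?add0r => tM.
    have [t0|t0] := leP 0 t.
      rewrite ger0_norm// in tM; rewrite B_right ?subrr ?mul0r//.
      have : 1 <= t by exact: le_trans M1 (ltW tM).
      by move=> t1; rewrite -[leLHS]mulr1; apply: ler_pM.
    by rewrite ltr0_norm// in tM; rewrite p0 ?mulr0// ltW.
  have [t0|t0] := leP t 0; first by rewrite B_left ?mul0r// mulr_ge0_le0// ltW.
  by rewrite gtr0_norm// in tM; rewrite p0 ?mulr0// ltW.
have := @transport_cut R d g mg g_bounded dT T lam p f1 f2 V1 V2 Y rep1 rep2 ev1 ev2 Vt1 Vt2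
  cr1 cr2 initial (U k) M (C * m ^+ k) (@continuous_U k) (@U_le k) (@U_out k) M1 B b c sB sb hB
  (fun t => (bB t).1) (fun t => (bB t).2) B_left B_right b0 chi dchi e1 e2 schi sdchi hchi far.
have b1 := bounded_half k sdp dp0; have b2 := bounded_half k.+1 sp p0.
have i1 := action_integrable rep1 rep2 b1; have i2 := action_integrable rep1 rep2 b2.
set Z := action _ _ _ _ _.
have -> : Z = - (sgn * c)%:C * (J k dpsi - J k.+1 psi).
  rewrite /J /L /action -CintB// -CintZ//; last exact: cintegrableB.
  rewrite /Z /action; apply: eq_Cint => x _; rewrite -mulrBl [RHS]mulrA; congr (_ * _).
  move: (p x) => [y t]; rewrite /=.
  have -> : U k.+1 y = U k y * (sgn%:C * g y) by rewrite /U exprSr mulrA.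
  rewrite /transport /chi /dchi /half /=.
  have -> : e1 + e2 * (c * (0 < t)%R%:R) = c * ((0 < t)%R (+) sigma)%:R.
    rewrite /e1 /e2; case: sigma; case: (0 < t)%R; rewrite /= ?mulr1 ?mulr0 ?addr0 ?mulN1r ?subrr ?add0r ?mul1r//.
  rewrite !rmorphM /=.
  have s2 : sgn%:C * sgn%:C = 1 by rewrite -rmorphM /= sgn2.
  move: (U k y) (g y) (c%:C) ((psi _)%:C) ((dpsi _)%:C) (_%:R%:C) s2.
  move: (sgn%:C) => s x1 x3 x4 x5 x6 x7 s2.
  rewrite [LHS](_ : _ = x1 * x4 * x7 * (x3 * x5 - s * x6)); last by ring.
  rewrite [RHS](_ : _ = x1 * x4 * x7 * ((s * s) * (x3 * x5) - s * x6)); last by ring.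
  by rewrite s2 mul1r.
move=> /eqP; rewrite mulf_eq0 subr_eq0 => /orP[|/eqP//].
rewrite oppr_eq0 eq_complex /= eqxx andbT mulf_eq0 signr_eq0 /= => /eqP c0.
by rewrite c0 ltxx in cpos.
Qed.

Let ball := [set z : spacetime | `|z| <= M].

Let bounded_ball : bounded_supported ((fun z => (\1_ball z)%:C) : spacetime -> R[i]).
Proof.
split; first exact: (@cmeasurable_indic _ (borel spacetime) R ball (@bounded_borel_ball R spacetime M).2).
exists M, 1 => z; rewrite abs1_real indicE; split; first by case: (_ \in _); rewrite ?normr1 ?normr0.
by move=> zM; rewrite (_ : _ \in _ = false)//; apply/negbTE; rewrite notin_setE /ball /= leNgt zM.
Qed.

Let K := C * \int[lam]_x abs1 ((\1_ball (p x))%:C * f x).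

(** On the half line [sgn t >= 0], so the exponential weight is at most 1 and [psi] is bounded by
    [A]; [U k] contributes [C m ^ k], and a ball contains the support. *)
Let J_bound k psi A : line_smooth psi -> (forall t, M <= t -> psi t = 0) ->
  (forall t, `|psi t| <= A * expR (- ((m + 1) * t))) -> abs1 (J k psi) <= K * m ^+ k * A.
Proof.
move=> sp p0 pA.
have A0 : 0 <= A by rewrite -(pmulr_lge0 _ (expR_gt0 (- ((m + 1) * 0)))); exact: le_trans (pA 0).
have Ck0 : 0 <= C * m ^+ k by rewrite mulr_ge0// exprn_ge0.
have hA t : `|half psi t| <= A.
  have [->|t0] := half_nneg psi t; first by rewrite normr0.
  rewrite /half normrM; apply: (@le_trans _ _ (1 * `|psi (sgn * t)|)).
    by apply: ler_wpM2r => //; case: (_ (+) _); rewrite ?normr1 ?normr0.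
  rewrite mul1r; apply: le_trans (pA _) _; rewrite ler_piMr// -[leRHS]expR0 ler_expR oppr_le0.
  by apply: mulr_ge0; [rewrite addr_ge0|exact: t0].
have iv := action_integrable rep1 rep2 (bounded_half k sp p0).
have [_ ib] := action_integrable rep1 rep2 bounded_ball.
have ib' : lam.-integrable setT (EFin \o (fun x => abs1 ((\1_ball (p x))%:C * f x))) by exact: ib.
rewrite (_ : K * m ^+ k * A = (C * m ^+ k * A) * \int[lam]_x abs1 ((\1_ball (p x))%:C * f x)); last first.
  by rewrite /K; move: (Rintegral _ _ _) (m ^+ k) => a b; ring.
rewrite -RintegralZl//; apply: le_trans (abs1_Cint measurableT iv) _.
apply: le_Rintegral => //; first by have [] := iv.
  have h (q : T -> R) r : lam.-integrable setT (EFin \o q) ->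
      lam.-integrable setT (EFin \o (fun x => r * q x)) by exact: integrableZl.
  exact: h.
move=> x _; apply: le_trans (abs1M _ _) _; rewrite abs1Z; last by rewrite indicE.
rewrite mulrA; apply: ler_wpM2r; first exact: abs1_ge0.
rewrite indicE; have [pM|] := boolP (p x \in ball).
  rewrite mulr1; apply: le_trans (abs1M _ _) _; rewrite abs1_real.
  by apply: ler_pM; rewrite ?abs1_ge0// U_le.
rewrite notin_setE /ball /= spacetime_norm => /negP; rewrite -ltNge lt_max => /orP[h|h].
  by rewrite (U_out _ h) mul0r /abs1 /= normr0 addr0 mulr0.
by rewrite (half_out p0 h) mulr0 /abs1 /= normr0 addr0 mulr0.
Qed.

Lemma half_line_vanish theta A : line_smooth theta -> (forall t, M <= t -> theta t = 0) ->
  (forall t, `|theta t| <= A * expR (- ((m + 1) * t))) ->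
  L (fun z => u z.1 * ((((0 < z.2)%R (+) sigma)%:R) * theta ((-1) ^+ sigma * z.2))%:C) = 0.
Proof.
move=> st th0 thA; have := @iterated_primitives_vanish R J m K M m0 J_step J_bound theta A st th0 thA.
by rewrite /J /U /half /sgn; under eq_fun do rewrite expr0 mulr1.
Qed.

End half_line.

Lemma action_vanish (u : space -> R[i]) (theta : R -> R) (M C : R) :
  continuous (u : space -> R[i]^o) -> (forall x, abs1 (u x) <= C) ->
  (forall x, M < `|x| -> u x = 0) -> 1 <= M -> line_smooth theta ->
  (forall t, M <= `|t| -> theta t = 0) -> L (fun z => u z.1 * (theta z.2)%:C) = 0.
Proof.
move=> cu uC u0 M1 st th0; have [m' gm'] := g_bounded M.
pose m := `|m'|; have gm x : `|x| <= M -> abs1 (g x) <= m.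
  by move=> /gm' h; apply: le_trans h (ler_norm _).
have m0 : 0 <= m := normr_ge0 m'.
have ct := line_smooth_continuous st.
have [D [D0 hD]] : exists D : R, 0 <= D /\ forall t, `|theta t| <= D.
  apply: (bounded_compact_support (a := - M) (b := M) ct) => t.
  by rewrite -ler_norml -ltNge => /ltW /th0.
(* For [t < M], including all negative [t], the factor [expR ((m + 1) * M)] compensates the
   exponential weight; beyond [M] the function vanishes. *)
pose A := D * expR ((m + 1) * M).
have bnd (psi : R -> R) : (forall t, `|psi t| <= D) -> (forall t, M <= t -> psi t = 0) ->
    forall t, `|psi t| <= A * expR (- ((m + 1) * t)).
  move=> pD p0 t; have [/p0 ->|tM] := leP M t.
    by rewrite normr0 mulr_ge0 ?expR_ge0// mulr_ge0 ?expR_ge0.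
  apply: le_trans (pD t) _; rewrite /A -mulrA -expRD ler_peMr//.
  rewrite -[leLHS]expR0 ler_expR -mulrBr; apply: mulr_ge0; lra.
have p0 t : M <= t -> theta t = 0 by move=> tM; apply: th0; apply: le_trans tM (ler_norm _).
have n0 t : M <= t -> theta (-1 * t) = 0.
  by move=> tM; apply: th0; rewrite mulN1r normrN; apply: le_trans tM (ler_norm _).
have h1 := @half_line_vanish false u M C m cu uC u0 M1 m0 gm theta A st p0 (bnd _ hD p0).
have h2 := @half_line_vanish true u M C m cu uC u0 M1 m0 gm _ A
  (line_smooth_comp st (line_smooth_scale (-1))) n0 (bnd _ (fun t => hD (-1 * t)) n0).
have mu : cmeasurable (u : borel space -> R[i]) by exact: (continuous_cmeasurable cu).
have mt : cmeasurable (fun t : R => (theta t)%:C) by exact: line_cmeasurable.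
have bt : bounded_supported ((fun z => u z.1 * (theta z.2)%:C) : spacetime -> R[i]).
  apply: (@bounded_supported_tensor R d u (fun t => (theta t)%:C) M C D mu mt uC _ u0).
    by move=> t; rewrite abs1_real.
  by move=> t /ltW /th0 ->.
have mpos (b : bool) : cmeasurable (fun t : R => (((0 < t)%R (+) b)%:R : R)%:C).
  by apply: cmeasurable_real; exact: measurable_half_line.
have bh (b : bool) : bounded_supported ((fun z =>
    (((0 < z.2)%R (+) b)%:R : R)%:C * (u z.1 * (theta z.2)%:C)) : spacetime -> R[i]).
  apply: (@bounded_supportedM_bounded R spacetime (fun z => (((0 < z.2)%R (+) b)%:R : R)%:C) _ 1 _ _ bt).
    exact: (@cmeasurable_time R d (fun t => (((0 < t)%R (+) b)%:R : R)%:C)).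
  by move=> z; rewrite abs1_real; case: (_ (+) _); rewrite ?normr1 ?normr0.
transitivity (L (fun z => (((0 < z.2)%R (+) false)%:R : R)%:C * (u z.1 * (theta z.2)%:C) +
  (((0 < z.2)%R (+) true)%:R : R)%:C * (u z.1 * (theta z.2)%:C))).
  congr L; apply/funext => z; rewrite -mulrDl -rmorphD /= addbT addbF.
  by case: (0 < z.2)%R; rewrite /= ?addr0 ?add0r mul1r.
rewrite /L (actionD rep1 rep2 (bh false) (bh true)) -[RHS](addr0 0); congr (_ + _).
  rewrite -[RHS]h1 /L; congr (action _ _ _ _ _); apply/funext => z.
  by rewrite expr0 mul1r rmorphM /= mulrCA.
rewrite -[RHS]h2 /L; congr (action _ _ _ _ _); apply/funext => z.
by rewrite expr1 !mulN1r opprK rmorphM /= mulrCA.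
Qed.

(** By [radon_ext0] space-time boxes suffice. The indicator of a box is the bounded limit of
    products of saturated bumps in [xi] and in [t], on which the difference of the two solutions
    vanishes. *)
Lemma represented_solutions_eq B : V1 B = V2 B.
Proof.
have repW := represents_difference rep1 rep2.
apply/eqP; rewrite -subr_eq0; apply/eqP; move: B.
apply: (radon_ext0 (@rational_event_dense R d) (@spacetime_boxes_open R d)
  (@spacetime_boxes_ball R d) (@spacetime_boxes_setI R d) (@spacetime_boxes_bounded R d)
  (represents_radon repW)) => A boxA.
have bA : bounded_borel A.
  split; first exact: spacetime_boxes_bounded.
  by apply: borel_open; exact: spacetime_boxes_open.
have /bounded_setP[N hN] := bA.1.
have [l [w [a [b AE]]]] := boxA.
have [_ _ _ E] := repW.
rewrite (representsE repW bA) Cint_mkcond.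
pose k (z : spacetime) : R := box_bump l w z.1.
pose al n x := saturate n (box_bump l w x); pose th n t := saturate n (bump a b t).
have /bounded_setP[N1 hN1] := box_bounded l w.
pose M := Num.max 1 (Num.max N1 (`|a| + `|b| + 1)).
have alE n x : 0 <= al n x <= \1_(box l w) x.
  by apply: saturate_indic => [y|y]; [exact: box_bump_ge0|exact: box_bump_gt0].
have bumpA t : (0 < bump a b t) = (t \in `]a, b[%classic) by rewrite bump_gt0 mem_setE in_itv.
have thE n t : 0 <= th n t <= \1_(`]a, b[%classic : set R) t.
  by apply: saturate_indic => [y|//]; exact: bump_ge0.
have sal n : smooth_algebra (al n : space -> R^o).
  by apply: smooth_algebra_comp; [exact: line_smooth_saturate|exact: smooth_algebra_box_bump].
have sth n : line_smooth (th n).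
  by apply: line_smooth_comp; [exact: line_smooth_saturate|exact: line_smooth_bump].
have cal n : continuous ((fun x => (al n x)%:C) : space -> R[i]^o).
  by apply: continuous_real_complex; exact: (smooth_algebra_continuous (sal n)).
have al1 n x : abs1 (al n x)%:C <= 1.
  have /andP[h0 h1] := alE n x; rewrite abs1_real ger0_norm//; apply: le_trans h1 _.
  by rewrite indicE; case: (_ \in _).
have al0 n x : M < `|x| -> (al n x)%:C = 0.
  rewrite !gt_max => /andP[_ /andP[xN _]]; have /andP[h0] := alE n x.
  rewrite indicE (_ : _ \in _ = false) => [h1|]; last first.
    by apply/negbTE; rewrite notin_setE => /hN1; rewrite leNgt xN.
  by rewrite (_ : al n x = 0)//; apply/eqP; rewrite eq_le h1 h0.
have th0 n t : M <= `|t| -> th n t = 0.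
  rewrite !ge_max => /andP[_ /andP[_ tN]]; have /andP[h0] := thE n t.
  rewrite indicE (_ : _ \in _ = false) => [h1|]; last first.
    apply/negbTE; rewrite notin_setE /= in_itv /= => /andP[at_ tb].
    have : `|t| <= `|a| + `|b|.
      rewrite ler_norml; have := ler_norm a; have := ler_norm b; have := ler_norm (- a).
      have := ler_norm (- b); rewrite !normrN => *; apply/andP; split; lra.
    by move=> h; move: tN; lra.
  by apply/eqP; rewrite eq_le h1 h0.
have M1 : 1 <= M by rewrite le_max lexx.
pose v n (z : spacetime) : R[i] := (al n z.1)%:C * (th n z.2)%:C.
have v0 n : Cint lam setT (fun x => v n (p x) * f x) = 0.
  exact: (@action_vanish (fun x => (al n x)%:C) (th n) M 1 (cal n) (al1 n) (al0 n) M1 (sth n) (th0 n)).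
have [mp mf _ _] := repW.
have mA : measurable (p @^-1` A) := represents_preimage repW bA.2.
have indA x : \1_(p @^-1` A) x = \1_(box l w) (p x).1 * \1_(`]a, b[%classic : set R) (p x).2 :> R.
  rewrite !indicE -natrM mulnb; congr ((nat_of_bool _)%:R).
  by apply/idP/andP => [|[]]; rewrite !inE AE.
have mv n : cmeasurable (fun x => v n (p x) * f x).
  apply: cmeasurableM => //.
  have thb t : abs1 (th n t)%:C <= 1.
    have /andP[h0 h1] := thE n t; rewrite abs1_real ger0_norm//; apply: le_trans h1 _.
    by rewrite indicE; case: (_ \in _).
  have tho t : M < `|t| -> (th n t)%:C = 0 by move=> tM; rewrite (th0 n t (ltW tM)).
  have [mv _] := @bounded_supported_tensor R d _ _ M 1 1 (continuous_cmeasurable (cal n))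
    (line_cmeasurable (line_smooth_continuous (sth n))) (al1 n) thb (al0 n) tho.
  exact: (cmeasurable_comp mv mp).
have lim : ((Cint lam setT (fun x => v n (p x) * f x) : R[i]^o) @[n --> \oo] -->
    (Cint lam setT (fun x => (\1_(p @^-1` A) x)%:C * f x) : R[i]^o)).
  have iA : cintegrable lam setT (fun x => (\1_(p @^-1` A) x)%:C * f x).
    by apply/(cintegrable_mkcond _ mA mf); have [_ _ fi _] := repW; exact: fi.
  have cvgv x : setT x -> ((v n (p x) * f x : R[i]^o) @[n --> \oo] -->
      ((\1_(p @^-1` A) x)%:C * f x : R[i]^o)).
    move=> _; apply: (@cvg_complexM R nat \oo _ (fun n => v n (p x)) (fun _ => f x)); last exact: cvg_cst.
    rewrite indA rmorphM /=.
    apply: (@cvg_complexM R nat \oo _ (fun n => (al n (p x).1)%:C) (fun n => (th n (p x).2)%:C)).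
      apply: cvg_real_complex; apply: cvg_saturate_indic => y; [exact: box_bump_ge0|exact: box_bump_gt0].
    by apply: cvg_real_complex; apply: cvg_saturate_indic => y; [exact: bump_ge0|exact: bumpA].
  have bnd n x : setT x -> abs1 (v n (p x) * f x) <= abs1 ((\1_(p @^-1` A) x)%:C * f x).
    move=> _; have /andP[h0 h1] := alE n (p x).1; have /andP[h2 h3] := thE n (p x).2.
    rewrite /v -rmorphM /= !abs1Z ?mulr_ge0// ?indicE//; apply: ler_wpM2r; first exact: abs1_ge0.
    by rewrite -indicE indA; apply: ler_pM.
  exact: (Cint_dominated measurableT mv iA.1 cvgv iA.2 bnd).
have lim0 : ((Cint lam setT (fun x => v n (p x) * f x) : R[i]^o) @[n --> \oo] --> (0 : R[i]^o)).
  rewrite (_ : (fun n => _) = fun _ => 0 : R[i]^o); first exact: cvg_cst.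
  by apply/funext => n; exact: v0.
exact: (cvg_unique (@norm_hausdorff _ _) lim lim0).
Qed.

End uniqueness.

Lemma solution_unique (R : realType) (d : nat) (g : 'rV[R]_d -> R[i])
    (hg : symbol_function g) (g_cont : continuous (g : 'rV[R]_d -> R[i]^o))
    (Y V1 V2 : set ('rV[R]_d * R^o) -> R[i]) (Vt1 Vt2 : R -> set 'rV[R]_d -> R[i]) :
  radon V1 -> radon V2 -> evolution_equation g V1 Y -> evolution_equation g V2 Y ->
  cadlag_representation (radon_density (@indicator_halfspace R d) V1) Vt1 ->
  cadlag_representation (radon_density (@indicator_halfspace R d) V2) Vt2 ->
  Vt1 0 = Vt2 0 -> V1 = V2.
Proof.
move=> r1 r2 ev1 ev2 cr1 cr2 init; apply/funext => B.
have [d1 [T1 [l1 [p1 [f1 [rep1 _ _]]]]]] := radon_dominated_representation r1.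
have [d2 [T2 [l2 [p2 [f2 [rep2 _ _]]]]]] := radon_dominated_representation r2.
have [mp1 _ _ _] := rep1; have [mp2 _ _ _] := rep2.
(* Each density is extended by zero to the glued space, which gives both solutions the same base
   measure and the same map. *)
have R1 := represents_glue rep1 (represents0 l2 mp2) (fun A => esym (addr0 (V1 A))).
have R2 := represents_glue (represents0 l1 mp1) rep2 (fun A => esym (add0r (V2 A))).
exact: (represented_solutions_eq g_cont (symbol_function_bounded hg) R1 R2 ev1 ev2 cr1 cr2 init).
Qed.

Theorem theorem4p1 (R : realType) (d : nat) (hd : (1 <= d)%N)
    (Y : set ('rV[R]_d * R^o) -> R[i]) (hY : slow_growing_halfspace Y)
    (g : 'rV[R]_d -> R[i]) (hg : symbol_function g)
    (g_cont : continuous (g : 'rV[R]_d -> R[i]^o))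
    (g_re : forall xi, 0 <= complex.Re (g xi))
    (V0 : set 'rV[R]_d -> R[i]) (hV0 : slow_growing (@sq_space R d) V0) :
  exists! V : set ('rV[R]_d * R^o) -> R[i],
    [/\ radon V,
        evolution_equation g V Y,
        slow_growing_halfspace (radon_density (@indicator_halfspace R d) V) &
        exists2 Vt : R -> set 'rV[R]_d -> R[i],
          cadlag_representation (radon_density (@indicator_halfspace R d) V) Vt &
          Vt 0 = V0].
Proof.
have [V [rV evV sV [Vt crV V00]]] := existence_of_solution hY hg g_cont g_re hV0.
exists V; split => [|W [rW evW _ [Wt crW W00]]]; first by split => //; exists Vt.
by apply: (solution_unique hg g_cont rV rW evV evW crV crW); rewrite V00 W00.
Qed.
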